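(* Let $T>0$ and suppose that $y$ solves $$y_t-i(\partial_x^4+\partial_x^2)y=0,\quad (x,t)\in\Omega_T=\mathbb{R}_+\times(0,T),$$ $$y(x,0)=0,\qquad y(0,t)=g_0(t),\qquad y_x(0,t)=g_1(t),$$ where $g_0,g_1$ have compact support in $(0,T)$. Suppose that $y$ is sufficiently smooth up to the boundary of $\Omega_T$ and decays sufficiently fast as $x\to\infty$, uniformly in $t\in[0,T]$. Then the associated boundary integral operator $W_b$ (the map taking the boundary data $(g_0,g_1)$ to the solution $y$, so that $y(x,t)=W_b[g_0,g_1](x,t)$) is given by $$W_b[g_0,g_1](x,t)=\int_{\partial D^+}E(k;x,t)\,G(k;T)\,dk,$$ where $D^+$, $E$ and $G$ are as defined in the context and $\partial D^+$ is the boundary of $D^+$, oriented so that $D^+$ remains at the left of $\partial D^+$ as the boundary is traversed.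
   Context: Notation: $\mathbb{R}_+=(0,\infty)$, $\mathbb{C}_+=\{k\in\mathbb{C}:\operatorname{Im}k>0\}$. $w(k)=-i(k^4-k^2)$, $D=\{k\in\mathbb{C}:\operatorname{Re}(w(k))<0\}$, $D^+=D\cap\mathbb{C}_+$. $E(k;x,t)=-\frac{1}{2\pi}e^{ikx-w(k)t}$. For $j=0,1$ the $t$-transform of $g_j$ is $\tilde g_j(k,t)=\int_0^t e^{ks}g_j(s)\,ds$. Rotated square root: for some fixed and sufficiently small $\epsilon>0$, set $\sqrt{z}^*:=|z|^{1/2}e^{i\frac{\arg z}{2}}$ with $\arg z\in[\epsilon,2\pi+\epsilon)$. Then $\nu(k)=\sqrt{1-k^2}^*$. $G(k;t)=-2ik(k+\nu(k))\,\tilde g_1(w(k),t)-2k\nu(k)(k+\nu(k))\,\tilde g_0(w(k),t)$.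
   Formalization: The rotated root in ν(k) uses arg in [ε,2π+ε) only for Re k≥0; for Re k<0 the argument is taken in [0,2π), since the printed cut gives ν the wrong sign on −1<k<−1/√2 and on the start of the left hyperbola, making the formula false. *)

(* Defs.v *)
From Stdlib Require Import Reals Lra Psatz.
From Coquelicot Require Import Coquelicot.
Open Scope R_scope.

(** * Complex-valued functions of one or two real variables *)

Definition Cexp (z : C) : C :=
  (exp (Re z) * cos (Im z), exp (Re z) * sin (Im z)).

Definition CDerive (f : R -> C) (s : R) : C :=
  (Derive (fun r => Re (f r)) s, Derive (fun r => Im (f r)) s).

Definition dx (y : R -> R -> C) : R -> R -> C :=
  fun x t => CDerive (fun s => y s t) x.

Definition dt (y : R -> R -> C) : R -> R -> C :=
  fun x t => CDerive (fun s => y x s) t.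

(** * The initial-boundary value problem *)

Definition Omega (T x t : R) : Prop := 0 < x /\ 0 < t < T.

Definition Omega_bar (T x t : R) : Prop := 0 <= x /\ 0 <= t <= T.

(** [y] is of class C^N on [Omega T] and all its partial derivatives
    [Y i j] = d_x^i d_t^j y of order at most [N] extend continuously to
    [Omega_bar T]. *)
Definition smooth_up_to_boundary (N : nat) (T : R) (y : R -> R -> C) : Prop :=
  exists Y : nat -> nat -> R -> R -> C,
    (forall x t, Omega_bar T x t -> Y 0%nat 0%nat x t = y x t) /\
    (forall i j, (i + j < N)%nat -> forall x t, Omega T x t ->
       is_derive (V := C_R_NormedModule)
         (fun s => Y i j s t) x (Y (S i) j x t) /\
       is_derive (V := C_R_NormedModule)
         (fun s => Y i j x s) t (Y i (S j) x t)) /\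
    (forall i j, (i + j <= N)%nat -> forall x t, Omega_bar T x t ->
       filterlim (fun p : R * R => Y i j (fst p) (snd p))
         (within (fun p => Omega_bar T (fst p) (snd p)) (locally (x, t)))
         (locally (Y i j x t))).

(** Decay like x^(-m), uniform in time, of the solution and of its partial
    derivatives of order at most [N]. *)
Definition decays (N m : nat) (T : R) (y : R -> R -> C) : Prop :=
  exists K : R, forall i j, (i + j <= N)%nat -> forall x t, Omega T x t ->
    Cmod (Nat.iter i dx (Nat.iter j dt y) x t) <= K / (1 + x) ^ m.

Definition compact_support_in (T : R) (g : R -> C) : Prop :=
  exists a b : R, 0 < a /\ a <= b /\ b < T /\
    forall s, ~ (a <= s <= b) -> g s = 0%C.

Record solves (T : R) (g0 g1 : R -> C) (y : R -> R -> C) : Prop := {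
  solves_pde : forall x t, Omega T x t ->
    (dt y x t - Ci * (Nat.iter 4 dx y x t + Nat.iter 2 dx y x t))%C = 0%C;
  solves_init : forall x, 0 < x -> y x 0 = 0%C;
  solves_dirichlet : forall t, 0 < t < T -> y 0 t = g0 t;
  solves_neumann : forall t, 0 < t < T ->
    filterlim (fun h : R => ((y h t - y 0 t) / h)%C)
      (at_right 0) (locally (g1 t))
}.

(** * Symbol, kernel and transforms *)

Definition w (k : C) : C := (- Ci * (k ^ 4 - k ^ 2))%C.

Definition D (k : C) : Prop := Re (w k) < 0.

Definition Dplus (k : C) : Prop := D k /\ 0 < Im k.

Definition E (k : C) (x t : R) : C :=
  (- (/ (2 * PI)) * Cexp (Ci * k * x - w k * t))%C.

Definition ttransform (g : R -> C) (k : C) (t : R) : C :=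
  RInt (V := C_R_CompleteNormedModule)
    (fun s => (Cexp (k * s) * g s)%C) 0 t.

(** Argument of [z] in [[0, 2 PI)]. *)
Definition arg0 (z : C) : R :=
  if Rle_dec 0 (Im z) then acos (Re z / Cmod z)
  else 2 * PI - acos (Re z / Cmod z).

(** Argument of [z] in [[eps, 2 PI + eps)], for [0 <= eps <= 2 PI]. *)
Definition arg_rot (eps : R) (z : C) : R :=
  if Rlt_dec (arg0 z) eps then arg0 z + 2 * PI else arg0 z.

Definition sqrt_rot (eps : R) (z : C) : C :=
  (sqrt (Cmod z) * Cexp (Ci * (arg_rot eps z / 2)))%C.

(** [1 - k ^ 2] is positive both on the part [0 <= k <= 1 / sqrt 2] of the
    boundary of the right component of [Dplus], where its argument tends to
    [2 PI] from inside, and on the part [-1 < k <= - 1 / sqrt 2] of the boundary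
    of the left component, where its argument tends to [0].  A cut of the square
    root along [arg z = eps > 0] gives the value [2 PI] on both, and the cut then
    runs through the left component near [-1].  The rotation is therefore
    performed on the right only; [nu_Dplus] shows that at every point of [Dplus]
    this agrees with the rotated root for all small [eps > 0]. *)
Definition nu (eps : R) (k : C) : C :=
  sqrt_rot (if Rlt_dec (Re k) 0 then 0 else eps) (1 - k ^ 2)%C.

Definition G (eps : R) (g0 g1 : R -> C) (k : C) (t : R) : C :=
  (- 2 * Ci * k * (k + nu eps k) * ttransform g1 (w k) t
   - 2 * k * nu eps k * (k + nu eps k) * ttransform g0 (w k) t)%C.

(** * Integration along the boundary of [Dplus]

    [Dplus] has two components, one on each side of the imaginary axis.  The
    boundary of the right one is traversed along [bd1], [bd2], [bd3] and that of
    the left one along [bd4], [bd5].  See [frontier_Dplus] and the lemmas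
    [bd1_left] to [bd5_left]. *)

Definition bd1 (u : R) : C := (0, - u).                   (* -oo < u <= 0 *)
Definition bd2 (u : R) : C := (u, 0).                     (* 0 <= u <= 1/sqrt 2 *)
Definition bd3 (u : R) : C := (sqrt (/ 2 + u ^ 2), u).    (* 0 <= u < +oo *)
Definition bd4 (u : R) : C := (u, 0).                     (* -oo < u <= -1/sqrt 2 *)
Definition bd5 (u : R) : C := (- sqrt (/ 2 + u ^ 2), u).  (* 0 <= u < +oo *)

Definition is_path_int (f : C -> C) (gamma : R -> C)
    (Fa Fb : (R -> Prop) -> Prop) (l : C) : Prop :=
  is_RInt_gen (V := C_R_NormedModule)
    (fun u => (f (gamma u) * CDerive gamma u)%C) Fa Fb l.

Definition is_int_bdDplus (f : C -> C) (l : C) : Prop :=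
  exists l1 l2 l3 l4 l5 : C,
    is_path_int f bd1 (Rbar_locally m_infty) (at_point 0) l1 /\
    is_path_int f bd2 (at_point 0) (at_point (/ sqrt 2)) l2 /\
    is_path_int f bd3 (at_point 0) (Rbar_locally p_infty) l3 /\
    is_path_int f bd4 (Rbar_locally m_infty) (at_point (- / sqrt 2)) l4 /\
    is_path_int f bd5 (at_point 0) (Rbar_locally p_infty) l5 /\
    l = (l1 + l2 + l3 + l4 + l5)%C.

(** * Consistency of the conventions *)

Lemma Re_w (a b : R) :
  Re (w (a, b)) = 2 * b * (a * (2 * a ^ 2 - 2 * b ^ 2 - 1)).
Proof. unfold w, Re, Ci; simpl; ring. Qed.

Lemma DplusE (a b : R) :
  Dplus (a, b) <-> 0 < b /\ a * (2 * a ^ 2 - 2 * b ^ 2 - 1) < 0.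
Proof.
unfold Dplus, D; rewrite Re_w; simpl Im.
split; intros [H1 H2]; split; trivial; nra.
Qed.

Lemma Re_div_Cmod_bound (z : C) : z <> 0%C -> -1 <= Re z / Cmod z <= 1.
Proof.
intros Hz.
assert (Hm : 0 < Cmod z) by now apply Cmod_gt_0.
assert (Hr : Rabs (Re z) <= Cmod z).
{ apply Rle_trans with (2 := Rmax_Cmod z); apply Rmax_l. }
apply Rabs_le_between.
unfold Rdiv; rewrite Rabs_mult, (Rabs_pos_eq (/ Cmod z)).
- apply Rmult_le_reg_r with (Cmod z); trivial.
  rewrite Rmult_assoc, Rinv_l; lra.
- now apply Rlt_le, Rinv_0_lt_compat.
Qed.

Lemma Cmod_sqr (z : C) : Cmod z ^ 2 = Re z ^ 2 + Im z ^ 2.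
Proof. unfold Cmod, Re, Im; rewrite pow2_sqrt; nra. Qed.

Lemma arg0_spec (z : C) : z <> 0%C ->
  0 <= arg0 z < 2 * PI /\
  z = (Cmod z * cos (arg0 z), Cmod z * sin (arg0 z)).
Proof.
intros Hz.
assert (Hm : 0 < Cmod z) by now apply Cmod_gt_0.
pose proof (Re_div_Cmod_bound z Hz) as Hb.
pose proof (acos_bound (Re z / Cmod z)) as Ha.
pose proof (Cmod_sqr z) as Hs.
pose proof PI_RGT_0 as Hpi.
assert (Hsin : Cmod z * sin (acos (Re z / Cmod z)) = Rabs (Im z)).
{ rewrite sin_acos by exact Hb.
  rewrite <- (sqrt_pow2 (Cmod z)) at 1 by lra.
  rewrite <- sqrt_mult_alt by nra.
  rewrite <- sqrt_Rsqr_abs; f_equal; unfold Rsqr.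
  replace (Cmod z ^ 2 * (1 - Re z / Cmod z * (Re z / Cmod z)))
    with (Cmod z ^ 2 - Re z ^ 2) by (field; lra).
  lra. }
assert (Hcos : Cmod z * cos (acos (Re z / Cmod z)) = Re z).
{ rewrite cos_acos by exact Hb; field; lra. }
unfold arg0; destruct (Rle_dec 0 (Im z)) as [Hi | Hi].
- split; [lra |].
  rewrite Hcos, Hsin, Rabs_pos_eq by exact Hi; now destruct z.
- assert (Hac : acos (Re z / Cmod z) <> 0).
  { intros H0; rewrite H0, sin_0, Rmult_0_r in Hsin.
    rewrite Rabs_left in Hsin; lra. }
  split; [lra |].
  replace (2 * PI - acos (Re z / Cmod z))
    with (- acos (Re z / Cmod z) + 2 * INR 1 * PI) by (simpl; ring).
  rewrite cos_period, sin_period, cos_neg, sin_neg.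
  rewrite Ropp_mult_distr_r_reverse, Hcos, Hsin, Rabs_left by lra.
  rewrite Ropp_involutive; now destruct z.
Qed.

Lemma arg_rot_spec (eps : R) (z : C) : 0 <= eps <= 2 * PI -> z <> 0%C ->
  eps <= arg_rot eps z < 2 * PI + eps /\
  z = (Cmod z * cos (arg_rot eps z), Cmod z * sin (arg_rot eps z)).
Proof.
intros He Hz; destruct (arg0_spec z Hz) as [Hr Hp].
unfold arg_rot; destruct (Rlt_dec (arg0 z) eps) as [Hl | Hl].
- split; [lra |].
  replace (arg0 z + 2 * PI) with (arg0 z + 2 * INR 1 * PI) by (simpl; ring).
  now rewrite cos_period, sin_period.
- split; [lra | exact Hp].
Qed.

Lemma nu_Dplus (eps : R) (k : C) : 0 < eps < PI -> Dplus k ->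
  exists e0 : R, 0 < e0 /\
    forall e, 0 < e < e0 -> nu eps k = sqrt_rot e (1 - k ^ 2)%C.
Proof.
intros He Hk; destruct k as [a b].
apply DplusE in Hk; destruct Hk as [Hb Hq].
assert (Ha : a <> 0) by (intros ->; lra).
unfold nu; simpl Re.
set (z := (1 - (a, b) ^ 2)%C).
assert (Hi : Im z = - (2 * a * b)) by (unfold z, Im; simpl; ring).
assert (Hz : z <> 0%C).
{ intros H0; rewrite H0 in Hi; simpl in Hi; nra. }
destruct (arg0_spec z Hz) as [Hr Hp].
assert (Hz2 : Im z = Cmod z * sin (arg0 z)) by (rewrite Hp at 1; reflexivity).
destruct (Rlt_dec a 0) as [Hn | Hn].
- exists (arg0 z); split.
  + destruct (proj1 Hr) as [H0 | H0]; trivial.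
    rewrite <- H0, sin_0 in Hz2; nra.
  + intros e Hlt; unfold sqrt_rot, arg_rot.
    destruct (Rlt_dec (arg0 z) 0); [lra |].
    destruct (Rlt_dec (arg0 z) e); [lra | reflexivity].
- assert (Hpi : PI < arg0 z).
  { apply Rnot_le_lt; intros Hle.
    assert (0 <= sin (arg0 z)) by (apply sin_ge_0; lra).
    assert (0 < Cmod z) by now apply Cmod_gt_0.
    assert (0 < a) by lra.
    nra. }
  exists PI; split; [lra |].
  intros e Hlt; unfold sqrt_rot, arg_rot.
  destruct (Rlt_dec (arg0 z) eps); [lra |].
  destruct (Rlt_dec (arg0 z) e); [lra | reflexivity].
Qed.

Definition frontier (A : C -> Prop) (k : C) : Prop :=
  forall eps : posreal,
    (exists z : C, ball k eps z /\ A z) /\ (exists z : C, ball k eps z /\ ~ A z).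

Definition on_bdDplus (k : C) : Prop :=
  (exists u, u <= 0 /\ k = bd1 u) \/
  (exists u, 0 <= u <= / sqrt 2 /\ k = bd2 u) \/
  (exists u, 0 <= u /\ k = bd3 u) \/
  (exists u, u <= - / sqrt 2 /\ k = bd4 u) \/
  (exists u, 0 <= u /\ k = bd5 u).

Lemma ball_pair (a b a' b' : R) (eps : posreal) :
  Rabs (a' - a) < eps -> Rabs (b' - b) < eps ->
  ball ((a, b) : C) eps ((a', b') : C).
Proof. intros H1 H2; split; assumption. Qed.

Lemma inv_sqrt2 : 0 < / sqrt 2 /\ / sqrt 2 * / sqrt 2 = / 2.
Proof.
assert (H : 0 < sqrt 2) by (apply sqrt_lt_R0; lra).
split; [now apply Rinv_0_lt_compat |].
rewrite <- Rinv_mult, sqrt_sqrt; lra.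
Qed.

Lemma hyperbola (u : R) :
  0 < sqrt (/ 2 + u ^ 2) /\
  sqrt (/ 2 + u ^ 2) * sqrt (/ 2 + u ^ 2) = / 2 + u ^ 2 /\
  Rabs u < sqrt (/ 2 + u ^ 2).
Proof.
assert (H : 0 < / 2 + u ^ 2) by nra.
split; [now apply sqrt_lt_R0 |].
split; [apply sqrt_sqrt; lra |].
rewrite <- sqrt_Rsqr_abs; apply sqrt_lt_1_alt; unfold Rsqr; nra.
Qed.

Lemma locally_pol_pos (s a b : R) :
  0 < s * (a * (2 * a ^ 2 - 2 * b ^ 2 - 1)) ->
  exists eps : posreal, forall a' b', ball ((a, b) : C) eps ((a', b') : C) ->
    0 < s * (a' * (2 * a' ^ 2 - 2 * b' ^ 2 - 1)).
Proof.
intros H.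
set (f := fun p : R * R =>
  s * (fst p * (2 * (fst p * fst p) - 2 * (snd p * snd p) - 1))).
assert (Hc : continuous f (a, b)).
{ assert (Hf : continuous (fun p : R * R => fst p) (a, b))
    by apply continuous_fst.
  assert (Hs : continuous (fun p : R * R => snd p) (a, b))
    by apply continuous_snd.
  unfold f.
  apply (continuous_mult (fun _ => s)); [apply continuous_const |].
  apply (continuous_mult (fun p : R * R => fst p)); [exact Hf |].
  apply (continuous_minus
    (fun p : R * R => 2 * (fst p * fst p) - 2 * (snd p * snd p)) (fun _ => 1));
    [| apply continuous_const].
  apply (continuous_minus
    (fun p : R * R => 2 * (fst p * fst p)) (fun p => 2 * (snd p * snd p))).
  - apply (continuous_mult (fun _ => 2)); [apply continuous_const |].
    now apply (continuous_mult (fun p : R * R => fst p)).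
  - apply (continuous_mult (fun _ => 2)); [apply continuous_const |].
    now apply (continuous_mult (fun p : R * R => snd p)). }
assert (Hp : 0 < f (a, b)) by (unfold f; simpl in *; lra).
destruct (Hc (fun v => 0 < v)) as [eps Heps].
{ now apply open_gt. }
exists eps; intros a' b' Hball.
specialize (Heps (a', b') Hball); unfold f in Heps; simpl in Heps.
simpl; lra.
Qed.

Lemma on_bd_frontier (a b : R) :
  ~ Dplus (a, b) ->
  (exists c d e0 : R, 0 < e0 /\
     forall e, 0 < e < e0 -> Dplus (a + c * e, b + d * e)) ->
  frontier Dplus (a, b).
Proof.
intros Hn [c [d [e0 [He0 H]]]] eps; split.
- set (M := 1 + Rabs c + Rabs d).
  assert (Hc := Rabs_pos c); assert (Hd := Rabs_pos d).
  assert (HM : 0 < M) by (unfold M; lra).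
  destruct eps as [eps Heps]; simpl.
  set (e := Rmin (e0 / 2) (eps / (2 * M))).
  assert (H2 : 0 < eps / (2 * M)) by (apply Rdiv_lt_0_compat; lra).
  assert (He : 0 < e) by (apply Rmin_glb_lt; lra).
  assert (Hl : e <= e0 / 2) by apply Rmin_l.
  assert (Hr : e <= eps / (2 * M)) by apply Rmin_r.
  assert (HMe : M * e < eps).
  { apply Rle_lt_trans with (M * (eps / (2 * M))).
    - apply Rmult_le_compat_l; lra.
    - replace (M * (eps / (2 * M))) with (eps / 2) by (field; lra); lra. }
  exists (a + c * e, b + d * e); split; [| apply H; lra].
  apply (ball_pair a b _ _ (mkposreal eps Heps)); simpl.
  + replace (a + c * e - a) with (c * e) by ring.
    rewrite Rabs_mult, (Rabs_pos_eq e) by lra; unfold M in HMe; nra.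
  + replace (b + d * e - b) with (d * e) by ring.
    rewrite Rabs_mult, (Rabs_pos_eq e) by lra; unfold M in HMe; nra.
- exists (a, b); split; [apply ball_center | exact Hn].
Qed.

Lemma frontier_Dplus (k : C) : frontier Dplus k <-> on_bdDplus k.
Proof.
pose proof inv_sqrt2 as [Hs0 Hs2].
destruct k as [a b]; split.
- intros HF.
  destruct (Rlt_le_dec b 0) as [Hb | Hb].
  { exfalso; assert (Hp : 0 < - b) by lra.
    destruct (HF (mkposreal _ Hp)) as [[[a' b'] [Hball Hz]] _].
    apply DplusE in Hz.
    destruct Hball as [_ Hball]; simpl in Hball.
    unfold ball in Hball; simpl in Hball; unfold AbsRing_ball in Hball.
    unfold abs, minus, plus, opp in Hball; simpl in Hball.
    apply Rabs_lt_between in Hball; lra. }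
  set (q := a * (2 * a ^ 2 - 2 * b ^ 2 - 1)).
  assert (Hq1 : q <= 0).
  { apply Rnot_lt_le; intros Hq.
    destruct (locally_pol_pos 1 a b) as [eps Heps]; [fold q; lra |].
    destruct (HF eps) as [[[a' b'] [Hball Hz]] _].
    apply DplusE in Hz; specialize (Heps a' b' Hball); lra. }
  destruct Hb as [Hb | Hb].
  + assert (Hq2 : 0 <= q).
    { apply Rnot_lt_le; intros Hq.
      destruct (locally_pol_pos (-1) a b) as [eps Heps]; [fold q; lra |].
      assert (Hm : 0 < Rmin eps b) by (apply Rmin_glb_lt; [apply cond_pos | lra]).
      destruct (HF (mkposreal _ Hm)) as [_ [[a' b'] [Hball Hz]]].
      apply Hz, DplusE; split.
      - destruct Hball as [_ Hball]; simpl in Hball.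
        unfold ball in Hball; simpl in Hball; unfold AbsRing_ball in Hball.
        unfold abs, minus, plus, opp in Hball; simpl in Hball.
        apply Rabs_lt_between in Hball.
        pose proof (Rmin_r eps b); lra.
      - assert (Hb2 : ball ((a, b) : C) eps ((a', b') : C)).
        { apply ball_le with (2 := Hball); apply Rmin_l. }
        specialize (Heps a' b' Hb2); lra. }
    assert (Hq : q = 0) by lra; unfold q in Hq.
    apply Rmult_integral in Hq; destruct Hq as [-> | Hq].
    { left; exists (- b); split; [lra |]; unfold bd1; f_equal; ring. }
    assert (Ha2 : sqrt (/ 2 + b ^ 2) = Rabs a).
    { rewrite <- sqrt_Rsqr_abs; f_equal; unfold Rsqr; nra. }
    destruct (Rle_lt_dec 0 a) as [Ha | Ha].
    * do 2 right; left; exists b; split; [lra |].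
      unfold bd3; now rewrite Ha2, Rabs_pos_eq.
    * do 4 right; exists b; split; [lra |].
      unfold bd5; rewrite Ha2, Rabs_left, Ropp_involutive by lra; reflexivity.
  + subst b; unfold q in Hq1.
    destruct (Rle_lt_dec 0 a) as [Ha | Ha].
    * right; left; exists a; split; [split; trivial | reflexivity].
      apply Rnot_lt_le; intros Hl.
      assert (/ 2 < a * a) by nra; nra.
    * do 3 right; left; exists a; split; [| reflexivity].
      apply Rnot_lt_le; intros Hl.
      assert (a * a < / 2) by nra; nra.
- intros [[u [Hu ->]] | [[u [Hu ->]] | [[u [Hu ->]] | [[u [Hu ->]] | [u [Hu ->]]]]]].
  + apply on_bd_frontier.
    { rewrite DplusE; nra. }
    exists 1, 1, (/ 2); split; [lra |]; intros e He; apply DplusE; split; [lra |].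
    rewrite Rplus_0_l, Rmult_1_l; nra.
  + apply on_bd_frontier.
    { rewrite DplusE; lra. }
    destruct (Rle_lt_dec u 0) as [H0 | H0].
    * assert (u = 0) by lra; subst u.
      exists 1, 1, 1; split; [lra |]; intros e He; apply DplusE.
      split; [lra | nra].
    * exists 0, 1, 1; split; [lra |]; intros e He; apply DplusE; split; [lra |].
      rewrite Rmult_0_l, Rplus_0_r, Rplus_0_l, Rmult_1_l.
      assert (2 * u ^ 2 - 2 * e ^ 2 - 1 < 0) by nra; nra.
  + destruct (hyperbola u) as [Hh0 [Hh2 Hh]]; unfold bd3.
    set (h := sqrt (/ 2 + u ^ 2)) in *.
    apply on_bd_frontier.
    { rewrite DplusE; intros [_ Hq].
      assert (2 * h ^ 2 - 2 * u ^ 2 - 1 = 0) by nra; nra. }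
    exists 0, 1, 1; split; [lra |]; intros e He; apply DplusE; split; [lra |].
    rewrite Rmult_0_l, Rplus_0_r, Rmult_1_l.
    assert (2 * h ^ 2 - 2 * (u + e) ^ 2 - 1 < 0) by nra; nra.
  + apply on_bd_frontier.
    { rewrite DplusE; lra. }
    assert (Hu2 : / 2 <= u * u) by nra.
    exists (-1), (/ 2), 1; split; [lra |]; intros e He; apply DplusE.
    split; [lra |].
    assert (0 < 2 * (u + -1 * e) ^ 2 - 2 * (0 + / 2 * e) ^ 2 - 1) by nra.
    nra.
  + destruct (hyperbola u) as [Hh0 [Hh2 Hh]]; unfold bd5.
    set (h := sqrt (/ 2 + u ^ 2)) in *.
    rewrite Rabs_pos_eq in Hh by lra.
    apply on_bd_frontier.
    { rewrite DplusE; intros [_ Hq].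
      assert (2 * (- h) ^ 2 - 2 * u ^ 2 - 1 = 0) by nra; nra. }
    exists (-2), 1, 1; split; [lra |]; intros e He; apply DplusE; split; [lra |].
    assert (0 < 2 * (- h + -2 * e) ^ 2 - 2 * (u + 1 * e) ^ 2 - 1) by nra.
    nra.
Qed.

(** [Dplus] lies to the left of each arc: [i * gamma'] points into it. *)
Definition keeps_left (A : C -> Prop) (gamma : R -> C) (u : R) : Prop :=
  exists d0 : R, 0 < d0 /\
    forall d, 0 < d < d0 -> A (gamma u + d * (Ci * CDerive gamma u))%C.

Lemma CDerive_pair (f g : R -> R) (u f' g' : R) :
  is_derive f u f' -> is_derive g u g' ->
  CDerive (fun v => (f v, g v)) u = (f', g').
Proof.
intros Hf Hg; unfold CDerive; simpl.
now f_equal; apply is_derive_unique.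
Qed.

Lemma hyperbola_derive (u : R) :
  is_derive (fun v => sqrt (/ 2 + v ^ 2)) u (u / sqrt (/ 2 + u ^ 2)).
Proof.
destruct (hyperbola u) as [Hh0 _].
auto_derive.
- nra.
- replace (u * (u * 1)) with (u ^ 2) by ring; field; lra.
Qed.

Lemma left_intro (A : C -> Prop) (gamma : R -> C) (u a b c d d0 : R) :
  gamma u = (a, b) -> CDerive gamma u = (c, d) -> 0 < d0 ->
  (forall e, 0 < e < d0 -> A (a - e * d, b + e * c)) ->
  keeps_left A gamma u.
Proof.
intros Hg Hd H0 HA; exists d0; split; [exact H0 |]; intros e He.
rewrite Hg, Hd.
replace ((a, b) + e * (Ci * (c, d)))%C with ((a - e * d, b + e * c) : C).
- now apply HA.
- unfold Ci, Cplus, Cmult, RtoC; simpl; f_equal; ring.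
Qed.

Lemma bd1_left (u : R) : u < 0 -> keeps_left Dplus bd1 u.
Proof.
intros Hu; apply left_intro with (a := 0) (b := - u) (c := 0) (d := -1) (d0 := / 2).
- reflexivity.
- unfold bd1; apply CDerive_pair; auto_derive; trivial; ring.
- lra.
- intros e He; apply DplusE; split; [lra | nra].
Qed.

Lemma bd2_left (u : R) : 0 < u < / sqrt 2 -> keeps_left Dplus bd2 u.
Proof.
intros Hu; pose proof inv_sqrt2 as [Hs0 Hs2].
apply left_intro with (a := u) (b := 0) (c := 1) (d := 0) (d0 := 1).
- reflexivity.
- unfold bd2; apply CDerive_pair; auto_derive; trivial; ring.
- lra.
- intros e He; apply DplusE; split; [lra |].
  rewrite Rmult_0_r, Rminus_0_r.
  assert (u * u < / 2) by nra.
  assert (2 * u ^ 2 - 2 * (0 + e * 1) ^ 2 - 1 < 0) by nra; nra.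
Qed.

Lemma bd3_left (u : R) : 0 < u -> keeps_left Dplus bd3 u.
Proof.
intros Hu; destruct (hyperbola u) as [Hh0 [Hh2 Hh]].
rewrite Rabs_pos_eq in Hh by lra.
set (h := sqrt (/ 2 + u ^ 2)) in *.
apply left_intro with (a := h) (b := u) (c := u / h) (d := 1) (d0 := h).
- reflexivity.
- unfold bd3; apply CDerive_pair; [apply hyperbola_derive |].
  auto_derive; trivial; ring.
- exact Hh0.
- assert (Hc : 0 < u / h) by now apply Rdiv_lt_0_compat.
  set (c := u / h) in *.
  intros e He; apply DplusE; split; [nra |].
  assert (0 < e * c) by nra.
  assert (2 * (h - e * 1) ^ 2 - 2 * (u + e * c) ^ 2 - 1 < 0) by nra.
  nra.
Qed.

Lemma bd4_left (u : R) : u < - / sqrt 2 -> keeps_left Dplus bd4 u.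
Proof.
intros Hu; pose proof inv_sqrt2 as [Hs0 Hs2].
assert (Hu2 : / 2 < u * u) by nra.
apply left_intro with (a := u) (b := 0) (c := 1) (d := 0)
  (d0 := Rmin 1 (u * u - / 2)).
- reflexivity.
- unfold bd4; apply CDerive_pair; auto_derive; trivial; ring.
- apply Rmin_glb_lt; lra.
- intros e He.
  pose proof (Rmin_l 1 (u * u - / 2)); pose proof (Rmin_r 1 (u * u - / 2)).
  apply DplusE; split; [lra |].
  rewrite Rmult_0_r, Rminus_0_r.
  assert (e * e < u * u - / 2) by nra.
  assert (0 < 2 * u ^ 2 - 2 * (0 + e * 1) ^ 2 - 1) by nra; nra.
Qed.

Lemma bd5_left (u : R) : 0 < u -> keeps_left Dplus bd5 u.
Proof.
intros Hu; destruct (hyperbola u) as [Hh0 [Hh2 Hh]].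
rewrite Rabs_pos_eq in Hh by lra.
set (h := sqrt (/ 2 + u ^ 2)) in *.
apply left_intro with (a := - h) (b := u) (c := - (u / h)) (d := 1) (d0 := u).
- reflexivity.
- unfold bd5; apply CDerive_pair.
  + apply (is_derive_opp (fun v => sqrt (/ 2 + v ^ 2))), hyperbola_derive.
  + auto_derive; trivial; ring.
- exact Hu.
- assert (Hc : 0 < u / h) by now apply Rdiv_lt_0_compat.
  assert (Hc1 : u / h < 1).
  { apply Rmult_lt_reg_r with h; trivial.
    unfold Rdiv; rewrite Rmult_assoc, Rinv_l; lra. }
  set (c := u / h) in *.
  intros e He; apply DplusE.
  assert (0 < e * c < e) by nra.
  split; [nra |].
  assert (0 < 2 * (- h - e * 1) ^ 2 - 2 * (u + e * - c) ^ 2 - 1) by nra.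
  nra.
Qed.

(* Main.v *)
Require Import Defs.
From Stdlib Require Import Reals Lra Lia Psatz ClassicalEpsilon.
From Coquelicot Require Import Coquelicot.
Open Scope R_scope.

(** Put [w = i z]. For [Im z > 0] the equation [w k = i z] has exactly two
    roots [k1 z], [k2 z] in the upper half-plane; for real [z] they run along
    the boundaries of the right and of the left component of [Dplus], and [nu]
    exchanges them. Cutting the solution off in time just before [T] and
    transforming in [t] turns the problem into a fourth-order equation on the
    half-line, which splits into four first-order factors. Comparing sup norms
    factor by factor, the transform of the solution is the decaying solution
    with the boundary data of [y], up to an error [O(exp (- t1 Im z) / |z|^2)],
    where the cutoff acts after the time [t1 > t]. Fourier inversion on the line
    [Im z = sigma] then represents [y x t] up to [O(exp (- (t1 - t) sigma))];
    since the main term is holomorphic in [z], its integral does not depend on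
    [sigma], and [sigma -> oo] removes the error. On the real line, the
    substitutions [z = k^2 - k^4] turn the two exponentials of the main term
    into the integrals over the boundary of [Dplus]. *)

(** * Complex-valued calculus *)

(** The cutoff is shaped by two obstacles. Transforming over all of [[0, T]] would leave the unknown
    final state [y x T] as a source that does not decay in [|z|]. The resolvent estimate in turn is
    crude: a first-order factor costs [/ Im k <= 36 |z|^3], so four of them cost [|z|^12]. A cutoff
    whose derivative vanishes to order 14 at both ends of its transition interval makes the source
    [O(|z|^-14)], and the two remaining powers make the error integrable on horizontal lines.

    Compact support of the data enters twice. The cutoff starts after the data have vanished, so the
    transforms of the boundary values are exactly those over [[0, T]] that occur in [G]. The data
    are also flat at [0] and [T], which gives these transforms the decay needed on the real line and
    for the shift of contours.

    The factors of [G] record the change of variable: [dz = (2 k - 4 k^3) dk = - 2 k (k - nu) (k +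
    nu) dk] because [k^2 + nu^2 = 1], and [k - nu] cancels against the denominator of the half-line
    solution. *)

Definition cderive (f : R -> C) (s : R) (l : C) : Prop :=
  is_derive (V := C_R_NormedModule) f s l.

Definition ccont {U : UniformSpace} (f : U -> C) (x : U) : Prop :=
  continuous (U := C_UniformSpace) f x.

Definition CInt (f : R -> C) (a b : R) : C :=
  RInt (V := C_R_CompleteNormedModule) f a b.

Lemma C_ext (a b : C) : Re a = Re b -> Im a = Im b -> a = b.
Proof. destruct a, b; simpl; intros; now f_equal. Qed.

Lemma RtoC_neq_0 (r : R) : r <> 0 -> RtoC r <> 0%C.
Proof. intros Hr E; now apply (f_equal Re) in E. Qed.

Lemma Ci_neq_0 : Ci <> 0%C.
Proof. intros E; apply (f_equal Im) in E; simpl in E; lra. Qed.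

Lemma cderive_ext_loc (f g : R -> C) (s : R) (l : C) :
  locally s (fun r => f r = g r) -> cderive f s l -> cderive g s l.
Proof. apply (is_derive_ext_loc (V := C_R_NormedModule)). Qed.

Lemma cderive_ext (f g : R -> C) (s : R) (l : C) :
  (forall r, f r = g r) -> cderive f s l -> cderive g s l.
Proof. apply (is_derive_ext (V := C_R_NormedModule)). Qed.

Lemma cderive_iff (f : R -> C) (s : R) (l : C) :
  cderive f s l <->
  is_derive (fun r => Re (f r)) s (Re l) /\ is_derive (fun r => Im (f r)) s (Im l).
Proof.
split.
- intros H; split.
  + apply (filterdiff_comp (K := R_AbsRing) (V := C_R_NormedModule) (W := R_NormedModule)
      f (fun z => fst z) (fun y => scal y l) (fun z => fst z) H).
    apply filterdiff_linear, is_linear_fst.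
  + apply (filterdiff_comp (K := R_AbsRing) (V := C_R_NormedModule) (W := R_NormedModule)
      f (fun z => snd z) (fun y => scal y l) (fun z => snd z) H).
    apply filterdiff_linear, is_linear_snd.
- intros [H1 H2].
  apply (is_derive_scal_l (V := C_R_NormedModule) _ _ _ (1, 0)) in H1.
  apply (is_derive_scal_l (V := C_R_NormedModule) _ _ _ (0, 1)) in H2.
  pose proof (is_derive_plus (K := R_AbsRing) (V := C_R_NormedModule) _ _ _ _ _ H1 H2) as H.
  assert (Hs : forall a b : R, @plus C_R_NormedModule (scal a (1, 0)) (scal b (0, 1)) = (a, b)).
  { intros a b; unfold plus, scal; simpl; unfold prod_plus, prod_scal, plus, scal; simpl.
    unfold mult; simpl; apply C_ext; simpl; ring. }
  rewrite Hs in H; destruct l as [l1 l2].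
  eapply is_derive_ext; [| exact H].
  intros t; simpl; rewrite Hs; now destruct (f t).
Qed.

Lemma ccont_iff {U : UniformSpace} (f : U -> C) (x : U) :
  ccont f x <->
  continuous (fun r => Re (f r)) x /\ continuous (fun r => Im (f r)) x.
Proof.
split.
- intros H; split.
  + apply (continuous_comp f (fun z : C => fst z)); [exact H |].
    destruct (f x); apply continuous_fst.
  + apply (continuous_comp f (fun z : C => snd z)); [exact H |].
    destruct (f x); apply continuous_snd.
- intros [H1 H2] P [eps HP].
  specialize (H1 _ (locally_ball (Re (f x)) eps)).
  specialize (H2 _ (locally_ball (Im (f x)) eps)).
  unfold filtermap in *; generalize (filter_and _ _ H1 H2).
  apply filter_imp; intros y [Hy1 Hy2]; apply HP; split; assumption.
Qed.

Section continuity.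
Context {U : UniformSpace}.
Implicit Types (f g : U -> C) (x : U).

Lemma ccont_const (c : C) x : ccont (fun _ => c) x.
Proof. apply continuous_const. Qed.

Lemma ccont_plus f g x : ccont f x -> ccont g x -> ccont (fun r => (f r + g r)%C) x.
Proof.
rewrite !ccont_iff; intros [H1 H2] [H3 H4]; split; simpl.
- now apply (continuous_plus (fun r => Re (f r)) (fun r => Re (g r))).
- now apply (continuous_plus (fun r => Im (f r)) (fun r => Im (g r))).
Qed.

Lemma ccont_opp f x : ccont f x -> ccont (fun r => (- f r)%C) x.
Proof.
rewrite !ccont_iff; intros [H1 H2]; split; simpl.
- now apply (continuous_opp (fun r => Re (f r))).
- now apply (continuous_opp (fun r => Im (f r))).
Qed.

Lemma ccont_minus f g x : ccont f x -> ccont g x -> ccont (fun r => (f r - g r)%C) x.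
Proof. intros; apply ccont_plus; [| apply ccont_opp]; assumption. Qed.

Lemma ccont_mult f g x : ccont f x -> ccont g x -> ccont (fun r => (f r * g r)%C) x.
Proof.
rewrite !ccont_iff; intros [H1 H2] [H3 H4]; split; simpl.
- apply (continuous_minus (fun r => Re (f r) * Re (g r)) (fun r => Im (f r) * Im (g r)));
  now apply (continuous_mult (K := R_AbsRing)).
- apply (continuous_plus (fun r => Re (f r) * Im (g r)) (fun r => Im (f r) * Re (g r)));
  now apply (continuous_mult (K := R_AbsRing)).
Qed.

Lemma ccont_RtoC (f : U -> R) x : continuous f x -> ccont (fun r => RtoC (f r)) x.
Proof. intros H; apply ccont_iff; split; [exact H | apply continuous_const]. Qed.

Lemma ccont_Cexp f x : ccont f x -> ccont (fun r => Cexp (f r)) x.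
Proof.
rewrite !ccont_iff; intros [H1 H2]; split; simpl.
- apply (continuous_mult (fun r => exp (Re (f r))) (fun r => cos (Im (f r)))).
  + apply (continuous_comp _ exp); [exact H1 | apply continuous_exp].
  + apply (continuous_comp _ cos); [exact H2 | apply continuous_cos].
- apply (continuous_mult (fun r => exp (Re (f r))) (fun r => sin (Im (f r)))).
  + apply (continuous_comp _ exp); [exact H1 | apply continuous_exp].
  + apply (continuous_comp _ sin); [exact H2 | apply continuous_sin].
Qed.

Lemma continuous_Cmod f x : ccont f x -> continuous (fun r => Cmod (f r)) x.
Proof.
rewrite ccont_iff; intros [H1 H2]; unfold Cmod.
apply (continuous_comp (fun r => fst (f r) ^ 2 + snd (f r) ^ 2) sqrt);
  [| apply continuous_sqrt].
apply (continuous_plus (fun r => fst (f r) ^ 2) (fun r => snd (f r) ^ 2)).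
- apply (continuous_mult (fun r => Re (f r)) (fun r => Re (f r) * 1)); [exact H1 |].
  apply (continuous_mult (fun r => Re (f r)) (fun r => 1)); [exact H1 | apply continuous_const].
- apply (continuous_mult (fun r => Im (f r)) (fun r => Im (f r) * 1)); [exact H2 |].
  apply (continuous_mult (fun r => Im (f r)) (fun r => 1)); [exact H2 | apply continuous_const].
Qed.

Lemma ccont_inv f x : ccont f x -> f x <> 0%C -> ccont (fun r => (/ f r)%C) x.
Proof.
intros Hf H0.
assert (Hm := continuous_Cmod _ _ Hf).
assert (Hd : 0 < Re (f x) ^ 2 + Im (f x) ^ 2).
{ rewrite <- Cmod_sqr; apply pow_lt; now apply Cmod_gt_0. }
revert Hf; rewrite !ccont_iff; intros [H1 H2].
assert (Hc : continuous (fun r => / (Re (f r) ^ 2 + Im (f r) ^ 2)) x).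
{ apply (continuous_comp (fun r => Re (f r) ^ 2 + Im (f r) ^ 2) Rinv).
  - apply continuous_ext with (fun r => Cmod (f r) * Cmod (f r)).
    + intros r; rewrite <- Cmod_sqr; simpl; ring.
    + now apply (continuous_mult (K := R_AbsRing)).
  - apply continuous_Rinv; lra. }
split; simpl.
- now apply (continuous_mult (K := R_AbsRing) (fun r => Re (f r))).
- apply (continuous_mult (K := R_AbsRing) (fun r => - Im (f r))); [| exact Hc].
  now apply (continuous_opp (fun r => Im (f r))).
Qed.

Lemma ccont_div f g x : ccont f x -> ccont g x -> g x <> 0%C ->
  ccont (fun r => (f r / g r)%C) x.
Proof. intros; apply ccont_mult; [| apply ccont_inv]; assumption. Qed.

End continuity.

Lemma continuous_exp_comp_gen {U : UniformSpace} (f : U -> R) (x : U) :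
  continuous f x -> continuous (fun r => exp (f r)) x.
Proof. intros H; apply (continuous_comp f exp); [exact H | apply continuous_exp]. Qed.

Lemma continuous_sin_comp_gen {U : UniformSpace} (f : U -> R) (x : U) :
  continuous f x -> continuous (fun r => sin (f r)) x.
Proof. intros H; apply (continuous_comp f sin); [exact H | apply continuous_sin]. Qed.

Lemma continuous_fst_pt {U V : UniformSpace} (p : U * V) : continuous (fun p : U * V => fst p) p.
Proof. destruct p; apply continuous_fst. Qed.

Lemma continuous_snd_pt {U V : UniformSpace} (p : U * V) : continuous (fun p : U * V => snd p) p.
Proof. destruct p; apply continuous_snd. Qed.

Ltac cont_base := fail.

Ltac cont :=
  intros;
  lazymatch goal with
  | H : ?P |- ?P => exact H
  | |- ccont (fun _ => ?c) _ => apply ccont_const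
  | |- ccont (fun r => Cplus (@?f r) (@?g r)) _ => apply (ccont_plus f g); cont
  | |- ccont (fun r => Cminus (@?f r) (@?g r)) _ => apply (ccont_minus f g); cont
  | |- ccont (fun r => Cmult (@?f r) (@?g r)) _ => apply (ccont_mult f g); cont
  | |- ccont (fun r => Copp (@?f r)) _ => apply (ccont_opp f); cont
  | |- ccont (fun r => Cexp (@?f r)) _ => apply (ccont_Cexp f); cont
  | |- ccont (fun r => RtoC (@?f r)) _ => apply (ccont_RtoC f); cont
  | |- ccont RtoC _ => apply (ccont_RtoC (fun r => r)), continuous_id
  | |- ccont (fun r => r) _ => apply (continuous_id (U := C_UniformSpace))
  | |- continuous (fun _ => ?c) _ => apply continuous_const
  | |- continuous (fun r => r) _ => apply continuous_id
  | |- continuous (fun r => fst r) _ => apply continuous_fst_pt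
  | |- continuous (fun r => snd r) _ => apply continuous_snd_pt
  | |- continuous (fun r => Rplus (@?f r) (@?g r)) _ =>
      apply (continuous_plus (V := R_NormedModule) f g); cont
  | |- continuous (fun r => Rminus (@?f r) (@?g r)) _ =>
      apply (continuous_minus (V := R_NormedModule) f g); cont
  | |- continuous (fun r => Rmult (@?f r) (@?g r)) _ =>
      apply (continuous_mult (K := R_AbsRing) f g); cont
  | |- continuous (fun r => Ropp (@?f r)) _ =>
      apply (continuous_opp (V := R_NormedModule) f); cont
  | |- continuous (fun r => exp (@?f r)) _ => apply (continuous_exp_comp_gen f); cont
  | |- continuous (fun r => sin (@?f r)) _ => apply (continuous_sin_comp_gen f); cont
  | |- continuous (fun r => Cmod (@?f r)) _ => apply (continuous_Cmod f); cont
  | |- _ => first [ assumption | match goal with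
      | H : forall _, ccont ?f _ |- ccont ?f _ => apply H
      | H : forall _, continuous ?f _ |- continuous ?f _ => apply H
      | H : forall _, ccont ?f _ |- ccont (fun r => ?f (@?g r)) _ =>
          apply (continuous_comp g f); [cont | apply H]
      | H : forall _, continuous ?f _ |- continuous (fun r => ?f (@?g r)) _ =>
          apply (continuous_comp g f); [cont | apply H]
      end | solve [cont_base] | match goal with
      | H : forall _, _ |- _ => solve [apply H; first [assumption | lia]]
      end ]
  end.

Lemma Rderive_mult (f g : R -> R) (s a b : R) :
  is_derive f s a -> is_derive g s b ->
  is_derive (fun r => f r * g r) s (a * g s + f s * b).
Proof.
intros; apply (is_derive_mult (K := R_AbsRing)); trivial; intros; apply Rmult_comm.
Qed.

Lemma Rderive_plus (f g : R -> R) (s a b : R) :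
  is_derive f s a -> is_derive g s b -> is_derive (fun r => f r + g r) s (a + b).
Proof. apply (is_derive_plus (K := R_AbsRing) (V := R_NormedModule)). Qed.

Lemma Rderive_opp (f : R -> R) (s a : R) :
  is_derive f s a -> is_derive (fun r => - f r) s (- a).
Proof. apply (is_derive_opp (K := R_AbsRing) (V := R_NormedModule)). Qed.

Section derivatives.
Implicit Types (f g : R -> C) (s : R) (l m : C).

Lemma cderive_const (c : C) s : cderive (fun _ => c) s 0%C.
Proof. apply (is_derive_const (K := R_AbsRing) (V := C_R_NormedModule) c). Qed.

Lemma cderive_plus f g s l m :
  cderive f s l -> cderive g s m -> cderive (fun r => (f r + g r)%C) s (l + m)%C.
Proof. intros; now apply (is_derive_plus (V := C_R_NormedModule)). Qed.

Lemma cderive_opp f s l : cderive f s l -> cderive (fun r => (- f r)%C) s (- l)%C.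
Proof. intros; now apply (is_derive_opp (V := C_R_NormedModule)). Qed.

Lemma cderive_minus f g s l m :
  cderive f s l -> cderive g s m -> cderive (fun r => (f r - g r)%C) s (l - m)%C.
Proof. intros; apply cderive_plus; [| apply cderive_opp]; assumption. Qed.

Lemma cderive_mult f g s l m :
  cderive f s l -> cderive g s m ->
  cderive (fun r => (f r * g r)%C) s (l * g s + f s * m)%C.
Proof.
rewrite !cderive_iff; intros [H1 H2] [H3 H4]; split; simpl; unfold Re, Im in *.
- evar_last;
    [exact (is_derive_minus _ _ _ _ _ (Rderive_mult _ _ _ _ _ H1 H3) (Rderive_mult _ _ _ _ _ H2 H4)) |].
  unfold minus, plus, opp; simpl; ring.
- evar_last;
    [exact (is_derive_plus _ _ _ _ _ (Rderive_mult _ _ _ _ _ H1 H4) (Rderive_mult _ _ _ _ _ H2 H3)) |].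
  unfold plus; simpl; ring.
Qed.

Lemma cderive_RtoC (f : R -> R) s (l : R) :
  is_derive f s l -> cderive (fun r => RtoC (f r)) s l.
Proof. intros H; apply cderive_iff; split; [exact H | apply (is_derive_const (V := R_NormedModule) 0)]. Qed.

Lemma cderive_id s : cderive RtoC s 1%C.
Proof. apply (cderive_RtoC (fun r => r)), (is_derive_id (K := R_AbsRing)). Qed.

Lemma cderive_Cexp f s l :
  cderive f s l -> cderive (fun r => Cexp (f r)) s (Cexp (f s) * l)%C.
Proof.
rewrite !cderive_iff; intros [H1 H2].
assert (Hx := is_derive_comp exp _ s _ _ (is_derive_exp _) H1).
assert (Hc := is_derive_comp cos _ s _ _ (is_derive_cos _) H2).
assert (Hs := is_derive_comp sin _ s _ _ (is_derive_sin _) H2).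
split; simpl.
- evar_last; [exact (Rderive_mult _ _ _ _ _ Hx Hc) |].
  unfold scal; simpl; unfold mult; simpl; unfold Re, Im; ring.
- evar_last; [exact (Rderive_mult _ _ _ _ _ Hx Hs) |].
  unfold scal; simpl; unfold mult; simpl; unfold Re, Im; ring.
Qed.

Lemma cderive_ccont f s l : cderive f s l -> ccont f s.
Proof.
intros H; apply (ex_derive_continuous (V := C_R_NormedModule)); now exists l.
Qed.

Lemma cderive_inv f s l : cderive f s l -> f s <> 0%C ->
  cderive (fun r => (/ f r)%C) s (- (l / (f s * f s)))%C.
Proof.
intros Hf H0.
assert (Hd : 0 < Re (f s) ^ 2 + Im (f s) ^ 2).
{ rewrite <- Cmod_sqr; apply pow_lt; now apply Cmod_gt_0. }
revert Hf; rewrite !cderive_iff; intros [H1 H2].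
assert (Hq := Rderive_plus _ _ _ _ _ (Rderive_mult _ _ _ _ _ H1 H1) (Rderive_mult _ _ _ _ _ H2 H2)).
assert (Hi := is_derive_inv _ _ _ Hq); cbv beta in Hi.
assert (Hn1 : Re (f s) * Re (f s) + Im (f s) * Im (f s) <> 0) by (simpl in Hd; lra).
specialize (Hi Hn1).
assert (Hn : Re (f s) * (Re (f s) * 1) + Im (f s) * (Im (f s) * 1) <> 0) by (simpl in Hd; lra).
(* The denominator [f s * f s] of the claimed derivative has squared modulus [|f s|^4]; [field] asks
   that it be nonzero. *)
assert (Hn' : (Re (f s) * Re (f s) - Im (f s) * Im (f s)) * (Re (f s) * Re (f s) - Im (f s) * Im (f s))
  + (Re (f s) * Im (f s) + Im (f s) * Re (f s)) * (Re (f s) * Im (f s) + Im (f s) * Re (f s)) <> 0).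
{ replace (_ + _) with ((Re (f s) * Re (f s) + Im (f s) * Im (f s)) ^ 2) by ring.
  now apply pow_nonzero. }
split.
- apply is_derive_ext with (fun r => Re (f r) * / (Re (f r) * Re (f r) + Im (f r) * Im (f r))).
  { intros r; simpl; unfold Rdiv; f_equal; f_equal; unfold Re, Im; ring. }
  evar_last; [exact (Rderive_mult _ _ _ _ _ H1 Hi) |].
  simpl; simpl in Hn'; unfold Re, Im in *; field; repeat split; assumption.
- apply is_derive_ext with (fun r => - (Im (f r) * / (Re (f r) * Re (f r) + Im (f r) * Im (f r)))).
  { intros r; simpl; unfold Rdiv; rewrite Ropp_mult_distr_l; f_equal; f_equal; unfold Re, Im; ring. }
  evar_last; [exact (Rderive_opp _ _ _ (Rderive_mult _ _ _ _ _ H2 Hi)) |].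
  simpl; simpl in Hn'; unfold Re, Im in *; field; repeat split; assumption.
Qed.

End derivatives.

Lemma Cexp_plus (a b : C) : Cexp (a + b) = (Cexp a * Cexp b)%C.
Proof.
unfold Cexp; apply C_ext; simpl; rewrite exp_plus, ?cos_plus, ?sin_plus; unfold Re, Im; ring.
Qed.

Lemma Cexp_0 : Cexp 0 = 1%C.
Proof. unfold Cexp; simpl; rewrite exp_0, cos_0, sin_0; apply C_ext; simpl; ring. Qed.

Lemma Cmod_Cexp (z : C) : Cmod (Cexp z) = exp (Re z).
Proof.
unfold Cmod, Cexp; simpl.
replace (_ + _) with (exp (Re z) * exp (Re z) * ((sin (Im z))² + (cos (Im z))²))
  by (unfold Rsqr; ring).
rewrite sin2_cos2, Rmult_1_r; apply sqrt_square, Rlt_le, exp_pos.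
Qed.

Lemma Cmod_le_abs (z : C) : Cmod z <= Rabs (Re z) + Rabs (Im z).
Proof.
apply Rsqr_incr_0_var; [| apply Rplus_le_le_0_compat; apply Rabs_pos].
pose proof (Cmod_sqr z) as H; unfold Rsqr; simpl in H.
pose proof (Rabs_pos (Re z)); pose proof (Rabs_pos (Im z)).
pose proof (pow2_abs (Re z)); pose proof (pow2_abs (Im z)); nra.
Qed.

Lemma Im_le_Cmod (z : C) : Rabs (Im z) <= Cmod z.
Proof. apply Rle_trans with (2 := Rmax_Cmod z); apply Rmax_r. Qed.

Lemma Cmod_minus_le (a b : C) : Cmod (a - b) <= Cmod a + Cmod b.
Proof. unfold Cminus; rewrite <- (Cmod_opp b); apply Cmod_triangle. Qed.

Lemma Cmod_inv_triangle (a b : C) : Cmod a - Cmod b <= Cmod (a - b).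
Proof.
pose proof (Cmod_triangle (a - b) b) as H.
replace (a - b + b)%C with a in H by ring; lra.
Qed.

Lemma Re_plus (a b : C) : Re (a + b) = Re a + Re b. Proof. reflexivity. Qed.
Lemma Im_plus (a b : C) : Im (a + b) = Im a + Im b. Proof. reflexivity. Qed.
Lemma Re_opp (a : C) : Re (- a) = - Re a. Proof. reflexivity. Qed.
Lemma Im_opp (a : C) : Im (- a) = - Im a. Proof. reflexivity. Qed.
Lemma Re_minus (a b : C) : Re (a - b) = Re a - Re b. Proof. reflexivity. Qed.
Lemma Im_minus (a b : C) : Im (a - b) = Im a - Im b. Proof. reflexivity. Qed.
Lemma Re_mult (a b : C) : Re (a * b) = Re a * Re b - Im a * Im b. Proof. reflexivity. Qed.
Lemma Im_mult (a b : C) : Im (a * b) = Re a * Im b + Im a * Re b. Proof. reflexivity. Qed.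
Lemma Re_RtoC (r : R) : Re (RtoC r) = r. Proof. reflexivity. Qed.
Lemma Im_RtoC (r : R) : Im (RtoC r) = 0. Proof. reflexivity. Qed.
Lemma Re_Ci : Re Ci = 0. Proof. reflexivity. Qed.
Lemma Im_Ci : Im Ci = 1. Proof. reflexivity. Qed.
Lemma Re_pair (a b : R) : Re (a, b) = a. Proof. reflexivity. Qed.
Lemma Im_pair (a b : R) : Im (a, b) = b. Proof. reflexivity. Qed.

Ltac reim :=
  repeat progress (rewrite ?Re_mult, ?Im_mult, ?Re_minus, ?Im_minus, ?Re_plus, ?Im_plus, ?Re_opp, ?Im_opp);
  rewrite ?Re_RtoC, ?Im_RtoC, ?Re_Ci, ?Im_Ci, ?Re_pair, ?Im_pair.
Tactic Notation "reim_in" hyp(H) :=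
  repeat progress (rewrite ?Re_mult, ?Im_mult, ?Re_minus, ?Im_minus, ?Re_plus, ?Im_plus, ?Re_opp, ?Im_opp in H);
  rewrite ?Re_RtoC, ?Im_RtoC, ?Re_Ci, ?Im_Ci, ?Re_pair, ?Im_pair in H.

(** * Integrals of complex-valued functions over an interval *)

Lemma ex_CInt (f : R -> C) (a b : R) : (forall z, ccont f z) ->
  ex_RInt (V := C_R_NormedModule) f a b.
Proof. intros H; apply (ex_RInt_continuous (V := C_R_CompleteNormedModule)); intros z _; apply H. Qed.

Lemma CInt_correct (f : R -> C) (a b : R) : (forall z, ccont f z) ->
  is_RInt (V := C_R_NormedModule) f a b (CInt f a b).
Proof. intros H; apply (RInt_correct (V := C_R_CompleteNormedModule)); now apply ex_CInt. Qed.

Lemma CInt_pair (f : R -> C) (a b : R) : (forall z, ccont f z) ->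
  CInt f a b = (RInt (fun t => Re (f t)) a b, RInt (fun t => Im (f t)) a b).
Proof.
intros H; pose proof (CInt_correct f a b H) as HI.
apply C_ext; simpl; symmetry; apply is_RInt_unique.
- apply (is_RInt_fct_extend_fst (U := R_NormedModule) (V := R_NormedModule) _ _ _ _ HI).
- apply (is_RInt_fct_extend_snd (U := R_NormedModule) (V := R_NormedModule) _ _ _ _ HI).
Qed.

Lemma scal_RtoC (r : R) (z : C) : scal (V := C_R_NormedModule) r z = (r * z)%C.
Proof. apply C_ext; simpl; unfold scal; simpl; unfold mult, Re, Im; simpl; ring. Qed.

Lemma CInt_const (c : C) (a b : R) : CInt (fun _ => c) a b = ((b - a)%R * c)%C.
Proof. rewrite <- scal_RtoC; apply (RInt_const (V := C_R_CompleteNormedModule)). Qed.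

Lemma CInt_ext (f g : R -> C) (a b : R) : a <= b ->
  (forall t, a < t < b -> f t = g t) -> CInt f a b = CInt g a b.
Proof.
intros Hab H; apply (RInt_ext (V := C_R_CompleteNormedModule)).
rewrite Rmin_left, Rmax_right by assumption; exact H.
Qed.

Lemma CInt_plus (f g : R -> C) (a b : R) :
  (forall z, ccont f z) -> (forall z, ccont g z) ->
  CInt (fun t => (f t + g t)%C) a b = (CInt f a b + CInt g a b)%C.
Proof.
intros Hf Hg; apply (is_RInt_unique (V := C_R_CompleteNormedModule)).
apply (is_RInt_plus (V := C_R_NormedModule)); now apply CInt_correct.
Qed.

(** The integral is linear over the reals by construction; a complex factor has to be pulled out
    through the components. *)
Lemma CInt_mult (c : C) (f : R -> C) (a b : R) : (forall z, ccont f z) ->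
  CInt (fun t => (c * f t)%C) a b = (c * CInt f a b)%C.
Proof.
intros Hf.
assert (H1 : forall z, continuous (fun t => Re (f t)) z) by (intros z; now apply ccont_iff).
assert (H2 : forall z, continuous (fun t => Im (f t)) z) by (intros z; now apply ccont_iff).
assert (E1 : ex_RInt (fun t => Re (f t)) a b)
  by (apply (ex_RInt_continuous (V := R_CompleteNormedModule)); intros; apply H1).
assert (E2 : ex_RInt (fun t => Im (f t)) a b)
  by (apply (ex_RInt_continuous (V := R_CompleteNormedModule)); intros; apply H2).
apply (RInt_correct (V := R_CompleteNormedModule)) in E1.
apply (RInt_correct (V := R_CompleteNormedModule)) in E2.
rewrite (CInt_pair f a b Hf).
rewrite CInt_pair by cont.
set (I1 := RInt (fun t => Re (f t)) a b) in *.
set (I2 := RInt (fun t => Im (f t)) a b) in *.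
apply C_ext; simpl; apply is_RInt_unique.
- apply (is_RInt_minus (V := R_NormedModule) (fun t => fst c * Re (f t)) (fun t => snd c * Im (f t)));
  now apply (is_RInt_scal (V := R_NormedModule)).
- apply (is_RInt_plus (V := R_NormedModule) (fun t => fst c * Im (f t)) (fun t => snd c * Re (f t)));
  now apply (is_RInt_scal (V := R_NormedModule)).
Qed.

Lemma CInt_opp (f : R -> C) (a b : R) : (forall z, ccont f z) ->
  CInt (fun t => (- f t)%C) a b = (- CInt f a b)%C.
Proof.
intros Hf; replace (- CInt f a b)%C with (- (1) * CInt f a b)%C by ring.
rewrite <- CInt_mult by exact Hf.
apply (RInt_ext (V := C_R_CompleteNormedModule)); intros x _.
assert (E : (- f x = - (1) * f x)%C) by ring; exact E.
Qed.

Lemma CInt_minus (f g : R -> C) (a b : R) :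
  (forall z, ccont f z) -> (forall z, ccont g z) ->
  CInt (fun t => (f t - g t)%C) a b = (CInt f a b - CInt g a b)%C.
Proof.
intros Hf Hg; unfold Cminus; rewrite CInt_plus, CInt_opp; trivial.
intros z; now apply ccont_opp.
Qed.

Lemma CInt_Chasles (f : R -> C) (a b c : R) : (forall z, ccont f z) ->
  (CInt f a b + CInt f b c)%C = CInt f a c.
Proof.
intros Hf; apply (RInt_Chasles (V := C_R_CompleteNormedModule)); now apply ex_CInt.
Qed.

Lemma CInt_point (f : R -> C) (a : R) : CInt f a a = 0%C.
Proof. apply (RInt_point (V := C_R_CompleteNormedModule)). Qed.

Lemma CInt_swap (f : R -> C) (a b : R) : (forall z, ccont f z) ->
  CInt f a b = (- CInt f b a)%C.
Proof.
intros Hf; pose proof (CInt_Chasles f a b a Hf) as H; rewrite CInt_point in H.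
replace (CInt f a b) with ((CInt f a b + CInt f b a) - CInt f b a)%C by ring.
rewrite H; ring.
Qed.

Lemma Cmod_CInt_le (f : R -> C) (g : R -> R) (a b : R) : a <= b ->
  (forall z, ccont f z) -> (forall z, continuous g z) ->
  (forall t, a <= t <= b -> Cmod (f t) <= g t) ->
  Cmod (CInt f a b) <= RInt g a b.
Proof.
intros Hab Hf Hg H; rewrite Cmod_norm.
apply (norm_RInt_le (V := C_R_NormedModule) f g a b); trivial.
- intros x Hx; rewrite <- Cmod_norm; now apply H.
- now apply CInt_correct.
- apply (RInt_correct (V := R_CompleteNormedModule)).
  apply (ex_RInt_continuous (V := R_CompleteNormedModule)); intros; apply Hg.
Qed.

Lemma Cmod_CInt_le_const (f : R -> C) (M : R) (a b : R) : a <= b ->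
  (forall z, ccont f z) ->
  (forall t, a <= t <= b -> Cmod (f t) <= M) ->
  Cmod (CInt f a b) <= (b - a) * M.
Proof.
intros Hab Hf H.
apply Rle_trans with (RInt (fun _ => M) a b).
- apply Cmod_CInt_le; trivial; intros; apply continuous_const.
- rewrite (RInt_const (V := R_CompleteNormedModule)); apply Rle_refl.
Qed.

Lemma cderive_CInt (f : R -> C) (a x : R) : (forall z, ccont f z) ->
  cderive (fun r => CInt f a r) x (f x).
Proof.
intros Hf; apply (is_derive_RInt (V := C_R_NormedModule) f (fun r => CInt f a r) a).
- apply filter_forall; intros r; now apply CInt_correct.
- apply Hf.
Qed.

(** The main tool for estimates: derivatives are required in the open interval alone and [P'] need
    not be integrable, so it applies up to the boundary of the domain. *)
Lemma cderive_mean_value (P P' : R -> C) (Q Q' : R -> R) (a b : R) : a <= b ->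
  (forall s, a <= s <= b -> ccont P s) -> (forall s, a <= s <= b -> continuous Q s) ->
  (forall s, a < s < b -> cderive P s (P' s)) ->
  (forall s, a < s < b -> is_derive Q s (Q' s)) ->
  (forall s, a < s < b -> Cmod (P' s) <= Q' s) ->
  Cmod (P b - P a) <= Q b - Q a.
Proof.
intros Hab HcP HcQ HP HQ Hle.
destruct (Req_dec a b) as [<- | Hne].
{ replace (P a - P a)%C with (RtoC 0) by ring; rewrite Cmod_0; lra. }
assert (Hlt : a < b) by lra; clear Hab Hne.
set (d := (P b - P a)%C).
(* Projecting P on the direction of the increment reduces this to the real mean value theorem. *)
set (h := fun s => Re d * Re (P s) + Im d * Im (P s) - Cmod d * Q s).
(* [MVT_gen] locates the intermediate point in the closed interval; the default value 0 satisfies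
   the wanted sign at the ends. *)
set (h' := fun s => if Rlt_dec a s then if Rlt_dec s b then
  Re d * Re (P' s) + Im d * Im (P' s) - Cmod d * Q' s else 0 else 0).
destruct (MVT_gen h a b h') as [c [Hc He]];
  rewrite ?Rmin_left, ?Rmax_right in * by lra.
- intros s Hs; specialize (HP s Hs); specialize (HQ s Hs).
  apply cderive_iff in HP; destruct HP as [H1 H2].
  unfold h'; destruct (Rlt_dec a s); [| lra]; destruct (Rlt_dec s b); [| lra].
  apply (is_derive_minus (fun s => Re d * Re (P s) + Im d * Im (P s)) (fun s => Cmod d * Q s)).
  + apply (is_derive_plus (fun s => Re d * Re (P s)) (fun s => Im d * Im (P s)));
    [now apply (is_derive_scal (fun s => Re (P s))) | now apply (is_derive_scal (fun s => Im (P s)))].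
  + now apply is_derive_scal.
- intros s Hs; apply continuity_pt_filterlim.
  specialize (HcP s Hs); apply ccont_iff in HcP; destruct HcP as [H1 H2].
  apply (continuous_minus (fun s => Re d * Re (P s) + Im d * Im (P s)) (fun s => Cmod d * Q s)).
  + cont.
  + cont.
- assert (Hdot : forall z : C, Re d * Re z + Im d * Im z <= Cmod d * Cmod z).
  { intros z; rewrite <- (Cmod_conj d), <- Cmod_mult.
    apply Rle_trans with (2 := re_le_Cmod _); apply Rle_trans with (2 := Rle_abs _).
    destruct d, z; simpl; lra. }
  assert (Hh' : h' c <= 0).
  { unfold h'; destruct (Rlt_dec a c); [| lra]; destruct (Rlt_dec c b); [| lra].
    pose proof (Hdot (P' c)); pose proof (Hle c (conj r r0)); pose proof (Cmod_ge_0 d); nra. }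
  assert (Hq : 0 <= Q b - Q a).
  { destruct (MVT_gen Q a b (fun s => if Rlt_dec a s then if Rlt_dec s b then Q' s else 0 else 0))
      as [c' [Hc' Hec']]; rewrite ?Rmin_left, ?Rmax_right in * by lra.
    - intros s Hs; destruct (Rlt_dec a s); [| lra]; destruct (Rlt_dec s b); [| lra]; now apply HQ.
    - intros s Hs; apply continuity_pt_filterlim; now apply HcQ.
    - rewrite Hec'; apply Rmult_le_pos; [| lra].
      destruct (Rlt_dec a c'); [| lra]; destruct (Rlt_dec c' b); [| lra].
      apply Rle_trans with (2 := Hle c' (conj r r0)), Cmod_ge_0. }
  assert (Hd : h b - h a = Cmod d ^ 2 - Cmod d * (Q b - Q a)).
  { rewrite Cmod_sqr; unfold h, d; destruct (P a), (P b); simpl; ring. }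
  assert (h b - h a <= 0) by (rewrite He; nra).
  pose proof (Cmod_ge_0 d); nra.
Qed.

(** [F] minus the primitive of [f] has derivative zero, so the mean value inequality with majorant 0
    makes it constant. *)
Lemma CInt_FTC (F f : R -> C) (a b : R) : a <= b ->
  (forall s, a <= s <= b -> ccont F s) -> (forall s, ccont f s) ->
  (forall s, a < s < b -> cderive F s (f s)) ->
  CInt f a b = (F b - F a)%C.
Proof.
intros Hab HF Hf Hd.
assert (H : Cmod ((F b - CInt f a b) - (F a - CInt f a a)) <= 0 - 0).
{ apply (cderive_mean_value (fun s => (F s - CInt f a s)%C) (fun s => (f s - f s)%C)
    (fun _ => 0) (fun _ => 0)); trivial.
  - intros s Hs; apply ccont_minus; [now apply HF |].
    apply cderive_ccont with (f s); now apply cderive_CInt.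
  - cont.
  - intros s Hs; apply cderive_minus; [now apply Hd | now apply cderive_CInt].
  - intros; apply (is_derive_const (V := R_NormedModule)).
  - intros s Hs; replace (f s - f s)%C with (RtoC 0) by ring; rewrite Cmod_0; lra. }
rewrite CInt_point in H.
assert (H0 : ((F b - CInt f a b) - (F a - 0))%C = 0%C).
{ apply Cmod_eq_0, Rle_antisym; [lra | apply Cmod_ge_0]. }
replace (CInt f a b) with (F b - F a - ((F b - CInt f a b) - (F a - 0)))%C by ring.
rewrite H0; ring.
Qed.

(** * Integrals depending on a parameter *)

Lemma ccont_eps {U : UniformSpace} (f : U -> C) (x : U) :
  ccont f x <-> forall eps : posreal, locally x (fun y => Cmod (f y - f x) < eps).
Proof.
split.
- intros H eps.
  assert (He : 0 < eps / 2) by (pose proof (cond_pos eps); lra).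
  specialize (H _ (locally_ball (f x) (mkposreal _ He))).
  revert H; apply (filter_imp (F := locally x)); intros y [H1 H2].
  eapply Rle_lt_trans; [apply Cmod_le_abs |].
  change (Rabs (Re (f y) - Re (f x)) < eps / 2) in H1.
  change (Rabs (Im (f y) - Im (f x)) < eps / 2) in H2.
  replace (Re (f y - f x)) with (Re (f y) - Re (f x)) by (simpl; unfold Re; ring).
  replace (Im (f y - f x)) with (Im (f y) - Im (f x)) by (simpl; unfold Im; ring).
  lra.
- intros H P [eps HP]; specialize (H eps).
  revert H; apply (filter_imp (F := locally x)); intros y Hy; apply HP.
  split.
  + eapply Rle_lt_trans; [| exact Hy]; eapply Rle_trans; [| apply re_le_Cmod].
    right; apply f_equal; simpl; unfold Re, minus, plus, opp; simpl; ring.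
  + eapply Rle_lt_trans; [| exact Hy]; eapply Rle_trans; [| apply Im_le_Cmod].
    right; apply f_equal; simpl; unfold Im, minus, plus, opp; simpl; ring.
Qed.

Lemma ccont_CInt_param_le {U : UniformSpace} (f : U -> R -> C) (a b : R) (u : U) : a <= b ->
  (forall t, ccont (fun p : U * R => f (fst p) (snd p)) (u, t)) ->
  (forall v t, ccont (f v) t) -> ccont (fun v => CInt (f v) a b) u.
Proof.
intros Hab Hj Hc; apply ccont_eps; intros eps.
(* The summand 1 keeps the quotient meaningful when [a = b]. *)
assert (He : 0 < eps / (2 * (b - a + 1))).
{ apply Rdiv_lt_0_compat; [apply cond_pos | lra]. }
set (e := eps / (2 * (b - a + 1))) in *.
assert (He2 : 0 < e / 2) by lra.
assert (Hloc : forall t, exists d : posreal, forall v s, ball u d v -> Rabs (s - t) < d ->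
  Cmod (f v s - f u t) < e / 2).
{ intros t; destruct (proj1 (ccont_eps _ _) (Hj t) (mkposreal _ He2)) as [d Hd].
  exists d; intros v s Hv Hs; apply (Hd (v, s)); split; assumption. }
set (delta := fun t => proj1_sig (constructive_indefinite_description _ (Hloc t))).
assert (Hdelta : forall t v s, ball u (delta t) v -> Rabs (s - t) < delta t ->
  Cmod (f v s - f u t) < e / 2).
{ intros t; exact (proj2_sig (constructive_indefinite_description _ (Hloc t))). }
destruct (compactness_value_1d a b delta) as [d Hd].
exists d; intros v Hv.
rewrite <- (CInt_minus _ _ _ _ (Hc v) (Hc u)).
apply Rle_lt_trans with ((b - a) * e).
- apply Cmod_CInt_le_const; trivial; [intros; now apply ccont_minus |].
  (* [compactness_value_1d] provides its covering point under a double negation, so the inequality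
     is proved by contradiction. *)
  intros s Hs; apply Rnot_lt_le; intros Hlt; apply (Hd s Hs); intros [t [Ht [Hst Hdt]]].
  assert (H1 := Hdelta t v s (ball_le _ _ _ Hdt _ Hv) Hst).
  assert (H2 := Hdelta t u s (ball_center _ _) Hst).
  apply (Rlt_irrefl e), Rlt_trans with (1 := Hlt).
  replace (f v s - f u s)%C with ((f v s - f u t) - (f u s - f u t))%C by ring.
  eapply Rle_lt_trans; [apply Cmod_minus_le | lra].
- assert (Hq : (b - a) * e < 2 * (b - a + 1) * e) by (apply Rmult_lt_compat_r; lra).
  apply Rlt_le_trans with (1 := Hq); right; unfold e; field; lra.
Qed.

Lemma ccont_CInt_param {U : UniformSpace} (f : U -> R -> C) (a b : R) (u : U) :
  (forall t, ccont (fun p : U * R => f (fst p) (snd p)) (u, t)) ->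
  (forall v t, ccont (f v) t) -> ccont (fun v => CInt (f v) a b) u.
Proof.
intros Hj Hc; destruct (Rle_lt_dec a b) as [Hab | Hab].
- now apply ccont_CInt_param_le.
- apply (continuous_ext (fun v => (- CInt (f v) b a)%C)).
  + intros v; now rewrite (CInt_swap (f v) a b).
  + apply ccont_opp, ccont_CInt_param_le; trivial; lra.
Qed.

Lemma is_derive_RInt_param_cont (h dh : R -> R -> R) (a b x : R) :
  locally x (fun u => forall t, is_derive (fun r => h r t) u (dh u t)) ->
  (forall t, continuous (fun p : R * R => dh (fst p) (snd p)) (x, t)) ->
  (forall u t, continuous (h u) t) ->
  is_derive (fun r => RInt (h r) a b) x (RInt (dh x) a b).
Proof.
intros Hn Hj Hc; evar_last; [apply is_derive_RInt_param |].
- revert Hn; apply filter_imp; intros u Hu t _; exists (dh u t); apply Hu.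
- intros t _; apply continuity_2d_pt_ext_loc with dh.
  + destruct Hn as [d Hd]; exists d; intros u v Hu Hv; symmetry; apply is_derive_unique, Hd, Hu.
  + apply continuity_2d_pt_filterlim, Hj.
- apply filter_forall; intros r.
  apply (ex_RInt_continuous (V := R_CompleteNormedModule)); intros; apply Hc.
- apply (RInt_ext (V := R_CompleteNormedModule)); intros t _; apply is_derive_unique.
  now apply locally_singleton in Hn.
Qed.

Lemma cderive_CInt_param (f df : R -> R -> C) (a b x : R) (d : posreal) :
  (forall u t, Rabs (u - x) < d -> cderive (fun r => f r t) u (df u t)) ->
  (forall t, ccont (fun p : R * R => df (fst p) (snd p)) (x, t)) ->
  (forall u t, ccont (f u) t) -> (forall t, ccont (df x) t) ->
  cderive (fun r => CInt (f r) a b) x (CInt (df x) a b).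
Proof.
intros Hd Hj Hc Hc'; rewrite (CInt_pair (df x) a b Hc').
apply (cderive_ext (fun r => (RInt (fun t => Re (f r t)) a b, RInt (fun t => Im (f r t)) a b))).
{ intros r; symmetry; apply CInt_pair, Hc. }
apply cderive_iff; split.
- apply (is_derive_RInt_param_cont (fun r t => Re (f r t)) (fun r t => Re (df r t))).
  + exists d; intros u Hu t; apply (proj1 (cderive_iff _ _ _) (Hd u t Hu)).
  + intros t; apply (proj1 (ccont_iff _ _) (Hj t)).
  + intros u t; apply (proj1 (ccont_iff _ _) (Hc u t)).
- apply (is_derive_RInt_param_cont (fun r t => Im (f r t)) (fun r t => Im (df r t))).
  + exists d; intros u Hu t; apply (proj1 (cderive_iff _ _ _) (Hd u t Hu)).
  + intros t; apply (proj1 (ccont_iff _ _) (Hj t)).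
  + intros u t; apply (proj1 (ccont_iff _ _) (Hc u t)).
Qed.

(** * The roots of the symbol *)

(** The principal square root on the closed upper half-plane. Below the real axis it takes the value
    at the conjugate, so that it is continuous on the whole plane with values in the closed first
    quadrant. *)
Definition csq (z : C) : C :=
  (sqrt ((Cmod z + Re z) / 2), sqrt ((Cmod z - Re z) / 2)).

Lemma csq_args (z : C) : 0 <= (Cmod z + Re z) / 2 /\ 0 <= (Cmod z - Re z) / 2.
Proof.
pose proof (re_le_Cmod z) as H; apply Rabs_le_between in H; split; lra.
Qed.

Lemma csq_quadrant (z : C) : 0 <= Re (csq z) /\ 0 <= Im (csq z).
Proof. split; apply sqrt_pos. Qed.

Lemma csq_sqr (z : C) : 0 <= Im z -> (csq z * csq z)%C = z.
Proof.
intros Hz; destruct (csq_args z) as [H1 H2]; pose proof (Cmod_sqr z) as Hs.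
apply C_ext; simpl.
- rewrite !sqrt_sqrt by assumption; field.
- rewrite Rmult_comm, <- sqrt_mult by assumption.
  replace ((Cmod z - Re z) / 2 * ((Cmod z + Re z) / 2)) with ((Im z / 2) * (Im z / 2))
    by (simpl in Hs; field_simplify; lra).
  rewrite sqrt_square by lra; field.
Qed.

Lemma csq_unique (c : C) : 0 <= Re c -> 0 <= Im c -> csq (c * c) = c.
Proof.
intros H1 H2; unfold csq; rewrite Cmod_mult.
replace (Cmod c * Cmod c) with (Cmod c ^ 2) by ring; rewrite Cmod_sqr.
apply C_ext; simpl.
- rewrite <- (sqrt_square (Re c)) at 3 by assumption; f_equal; unfold Re, Im; field.
- rewrite <- (sqrt_square (Im c)) at 3 by assumption; f_equal; unfold Re, Im; field.
Qed.

Lemma Cmod_csq (z : C) : 0 <= Im z -> Cmod (csq z) ^ 2 = Cmod z.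
Proof.
intros Hz; rewrite <- (csq_sqr z Hz) at 2; rewrite Cmod_mult; ring.
Qed.

Lemma csq_open_quadrant (z : C) : 0 < Im z -> 0 < Re (csq z) /\ 0 < Im (csq z).
Proof.
intros Hz; destruct (csq_quadrant z) as [H1 H2].
assert (H : 2 * (Re (csq z) * Im (csq z)) = Im z).
{ rewrite <- (csq_sqr z) at 3 by lra; simpl; unfold Re, Im; ring. }
nra.
Qed.

Lemma ccont_csq {U : UniformSpace} (f : U -> C) (x : U) :
  ccont f x -> ccont (fun r => csq (f r)) x.
Proof.
intros H; pose proof (continuous_Cmod f x H) as Hm.
apply ccont_iff in H; destruct H as [H1 _].
apply ccont_iff; split; unfold csq; simpl.
- apply (continuous_comp (fun r => (Cmod (f r) + Re (f r)) * / 2) sqrt); [cont | apply continuous_sqrt].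
- apply (continuous_comp (fun r => (Cmod (f r) - Re (f r)) * / 2) sqrt); [cont | apply continuous_sqrt].
Qed.

Lemma ex_derive_sqrt_comp (f : R -> R) (s : R) :
  ex_derive f s -> 0 < f s -> ex_derive (fun r => sqrt (f r)) s.
Proof.
intros [l H] H0; exists (l * / (2 * sqrt (f s))).
apply (is_derive_comp sqrt f s (/ (2 * sqrt (f s))) l); [| exact H].
apply is_derive_Reals, derivable_pt_lim_sqrt; exact H0.
Qed.

(** [0 < Im] keeps both radicands positive, so the components are differentiable; the value of the
    derivative is then read off from the derivative of the square. *)
Lemma cderive_csq (f : R -> C) (s : R) (l : C) : cderive f s l -> 0 < Im (f s) ->
  cderive (fun r => csq (f r)) s (l / (2 * csq (f s)))%C.
Proof.
intros Hf H0; pose proof Hf as Hf'.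
apply cderive_iff in Hf; destruct Hf as [H1 H2].
assert (E1 : ex_derive (fun r => Re (f r)) s) by (eexists; exact H1).
assert (E2 : ex_derive (fun r => Im (f r)) s) by (eexists; exact H2).
assert (Em : ex_derive (fun r => Cmod (f r)) s).
{ apply (ex_derive_sqrt_comp (fun r => fst (f r) ^ 2 + snd (f r) ^ 2)).
  - apply (ex_derive_plus (V := R_NormedModule) (fun r => fst (f r) ^ 2) (fun r => snd (f r) ^ 2));
    now apply ex_derive_pow.
  - unfold Im in H0; nra. }
assert (Hab : 0 < (Cmod (f s) + Re (f s)) / 2 /\ 0 < (Cmod (f s) - Re (f s)) / 2).
{ pose proof (Cmod_sqr (f s)); pose proof (Cmod_ge_0 (f s)); split; nra. }
destruct Hab as [Ha Hb].
assert (EA : ex_derive (fun r => sqrt ((Cmod (f r) + Re (f r)) / 2)) s).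
{ apply (ex_derive_sqrt_comp (fun r => (Cmod (f r) + Re (f r)) / 2)); [| exact Ha].
  apply (ex_derive_ext (fun r => / 2 * (Cmod (f r) + Re (f r)))); [intros; unfold Rdiv; apply Rmult_comm |].
  apply (ex_derive_scal (fun r => Cmod (f r) + Re (f r)) (/ 2)).
  now apply (ex_derive_plus (V := R_NormedModule) (fun r => Cmod (f r)) (fun r => Re (f r))). }
assert (EB : ex_derive (fun r => sqrt ((Cmod (f r) - Re (f r)) / 2)) s).
{ apply (ex_derive_sqrt_comp (fun r => (Cmod (f r) - Re (f r)) / 2)); [| exact Hb].
  apply (ex_derive_ext (fun r => / 2 * (Cmod (f r) - Re (f r)))); [intros; unfold Rdiv; apply Rmult_comm |].
  apply (ex_derive_scal (fun r => Cmod (f r) - Re (f r)) (/ 2)).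
  now apply (ex_derive_minus (V := R_NormedModule) (fun r => Cmod (f r)) (fun r => Re (f r))). }
destruct EA as [la EA], EB as [lb EB].
assert (Hm : cderive (fun r => csq (f r)) s (la, lb)) by (apply cderive_iff; split; assumption).
pose proof (cderive_mult _ _ _ _ _ Hm Hm) as Hsq; cbv beta in Hsq.
assert (Hsq2 : cderive f s ((la, lb) * csq (f s) + csq (f s) * (la, lb))%C).
{ apply (cderive_ext_loc (fun r => (csq (f r) * csq (f r))%C)); [| exact Hsq].
  pose proof (cderive_ccont _ _ _ Hf') as Hc; apply ccont_iff in Hc; destruct Hc as [_ Hc].
  specialize (Hc _ (open_gt 0 _ H0)).
  revert Hc; apply (filter_imp (F := locally s)); intros r Hr; apply csq_sqr; simpl in Hr; lra. }
assert (He : l = ((la, lb) * csq (f s) + csq (f s) * (la, lb))%C).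
{ apply cderive_iff in Hsq2; destruct Hsq2 as [H3 H4].
  apply C_ext.
  - rewrite <- (is_derive_unique _ _ _ H1); exact (is_derive_unique _ _ _ H3).
  - rewrite <- (is_derive_unique _ _ _ H2); exact (is_derive_unique _ _ _ H4). }
assert (Hn : csq (f s) <> 0%C).
{ intros Hn; destruct (csq_open_quadrant (f s) H0) as [Hp _].
  rewrite Hn in Hp; simpl in Hp; lra. }
assert (Hdiv : forall m : C, l = (m * csq (f s) + csq (f s) * m)%C -> (l / (2 * csq (f s)))%C = m).
{ intros m ->; field; exact Hn. }
rewrite (Hdiv _ He); exact Hm.
Qed.

(** [k1 z] and [k2 z] are the roots in the closed upper half-plane of
    [w k = Ci * z], for [0 <= Im z]. *)
Definition rq (z : C) : C := csq z.
(** The equation [w k = Ci * z] reads [k^4 - k^2 + z = 0], so the squares of the roots have sum 1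
    and product [z]. With [k1 * k2 = - rq] this gives [(k1 - k2)^2 = 2 rq + 1] and
    [(k1 + k2)^2 = - (2 rq - 1)], which explains the two further square roots. *)
Definition rr (z : C) : C := csq (2 * rq z - 1).
Definition rd (z : C) : C := csq (2 * rq z + 1).
Definition k1 (z : C) : C := ((rd z + Ci * rr z) / 2)%C.
Definition k2 (z : C) : C := ((- rd z + Ci * rr z) / 2)%C.


Section roots.
Variable z : C.
Hypothesis Hz : 0 <= Im z.

Lemma Im_rq : 0 <= Im (2 * rq z - 1)%C /\ 0 <= Im (2 * rq z + 1)%C.
Proof.
destruct (csq_quadrant z) as [_ H]; fold (rq z) in H.
reim; lra.
Qed.

Lemma two_neq_0 : (2 : C) <> 0%C.
Proof. apply RtoC_neq_0; lra. Qed.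

Lemma Ci_sqr : (Ci * Ci)%C = (- (1))%C.
Proof. apply C_ext; simpl; ring. Qed.

Lemma k1_minus_k2 : (k1 z - k2 z)%C = rd z.
Proof. unfold k1, k2; field. Qed.

Lemma k1_mult_k2 : (k1 z * k2 z)%C = (- rq z)%C.
Proof.
unfold k1, k2.
replace ((rd z + Ci * rr z) / 2 * ((- rd z + Ci * rr z) / 2))%C
  with (((Ci * Ci) * (rr z * rr z) - rd z * rd z) / 4)%C
  by field.
rewrite Ci_sqr; destruct Im_rq as [H1 H2].
unfold rr, rd; rewrite !csq_sqr by assumption.
field.
Qed.

Lemma k1_sqr_k2 : (k1 z * k1 z + k2 z * k2 z)%C = 1%C.
Proof.
replace (k1 z * k1 z + k2 z * k2 z)%C
  with ((k1 z - k2 z) * (k1 z - k2 z) + 2 * (k1 z * k2 z))%C by ring.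
rewrite k1_minus_k2, k1_mult_k2; destruct Im_rq as [H1 H2].
unfold rd; rewrite csq_sqr by assumption; ring.
Qed.

Lemma k1_k2_sqr : (k1 z * k1 z * (k2 z * k2 z))%C = z.
Proof.
replace (k1 z * k1 z * (k2 z * k2 z))%C with ((k1 z * k2 z) * (k1 z * k2 z))%C by ring.
rewrite k1_mult_k2.
replace (- rq z * - rq z)%C with (rq z * rq z)%C by ring.
now apply csq_sqr.
Qed.

(** Since [rq z] has nonnegative real part, [Re (2 rq + 1) >= 1]. Hence the denominator [k1 - k2] of
    the half-line solution stays away from 0, also on the real axis. *)
Lemma Cmod_rd_ge_1 : 1 <= Cmod (rd z).
Proof.
destruct Im_rq as [H1 H2].
pose proof (Cmod_csq _ H2) as H; fold (rd z) in H.
pose proof (re_le_Cmod (2 * rq z + 1)) as Hr; apply Rabs_le_between in Hr.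
destruct (csq_quadrant z) as [Hp _]; fold (rq z) in Hp.
assert (Hre : Re (2 * rq z + 1) = 2 * Re (rq z) + 1) by (reim; ring).
pose proof (Cmod_ge_0 (rd z)); nra.
Qed.

Lemma Im_k1 : Im (k1 z) = (Im (rd z) + Re (rr z)) / 2.
Proof. unfold k1, Cdiv; rewrite <- RtoC_inv by lra; reim; field. Qed.

Lemma Im_k2 : Im (k2 z) = (Re (rr z) - Im (rd z)) / 2.
Proof. unfold k2, Cdiv; rewrite <- RtoC_inv by lra; reim; field. Qed.

Lemma Cmod_k_sqr : Cmod (k1 z) ^ 2 <= 2 * Cmod (rq z) + 1 /\ Cmod (k2 z) ^ 2 <= 2 * Cmod (rq z) + 1.
Proof.
destruct Im_rq as [H1 H2].
pose proof (Cmod_csq _ H2) as Hd; fold (rd z) in Hd.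
pose proof (Cmod_csq _ H1) as Hr; fold (rr z) in Hr.
assert (Hb1 : Cmod (2 * rq z + 1) <= 2 * Cmod (rq z) + 1).
{ eapply Rle_trans; [apply Cmod_triangle |].
  rewrite Cmod_mult, !Cmod_R, !Rabs_pos_eq; lra. }
assert (Hb2 : Cmod (2 * rq z - 1) <= 2 * Cmod (rq z) + 1).
{ eapply Rle_trans; [apply Cmod_minus_le |].
  rewrite Cmod_mult, !Cmod_R, !Rabs_pos_eq; lra. }
assert (Hk : forall a b : C, Cmod ((a + b) / 2) <= (Cmod a + Cmod b) / 2).
{ intros a b; rewrite Cmod_div by apply two_neq_0.
  rewrite Cmod_R, Rabs_pos_eq by lra.
  pose proof (Cmod_triangle a b); lra. }
pose proof (Hk (rd z) (Ci * rr z)%C) as K1; pose proof (Hk (- rd z)%C (Ci * rr z)%C) as K2.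
rewrite Cmod_opp in K2; rewrite Cmod_mult, Cmod_Ci, Rmult_1_l in K1, K2.
fold (k1 z) in K1; fold (k2 z) in K2.
pose proof (Cmod_ge_0 (k1 z)); pose proof (Cmod_ge_0 (k2 z)).
pose proof (Cmod_ge_0 (rd z)); pose proof (Cmod_ge_0 (rr z)).
set (D := Cmod (rd z)) in *; set (R' := Cmod (rr z)) in *.
assert (((D + R') / 2) ^ 2 <= 2 * Cmod (rq z) + 1) by nra.
split; nra.
Qed.

Lemma Cmod_k_le : Cmod (k1 z) <= 2 * (1 + Cmod z) /\ Cmod (k2 z) <= 2 * (1 + Cmod z).
Proof.
destruct Cmod_k_sqr as [H1 H2].
pose proof (Cmod_csq z Hz) as Hq; fold (rq z) in Hq.
pose proof (Cmod_ge_0 (k1 z)); pose proof (Cmod_ge_0 (k2 z)).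
pose proof (Cmod_ge_0 z); pose proof (Cmod_ge_0 (rq z)).
assert (Cmod (rq z) <= 1 + Cmod z) by nra.
split; nra.
Qed.

Lemma w_root (k l : C) : (k * k + l * l)%C = 1%C -> (k * k * (l * l))%C = z -> w k = (Ci * z)%C.
Proof.
intros H1 H2; unfold w; rewrite <- H2.
replace (l * l)%C with (1 - k * k)%C by (rewrite <- H1; ring).
simpl; ring.
Qed.

Lemma w_k1 : w (k1 z) = (Ci * z)%C.
Proof. apply w_root with (k2 z); [apply k1_sqr_k2 | apply k1_k2_sqr]. Qed.

Lemma w_k2 : w (k2 z) = (Ci * z)%C.
Proof.
apply w_root with (k1 z); [rewrite Cplus_comm; apply k1_sqr_k2 | rewrite Cmult_comm; apply k1_k2_sqr].
Qed.

(** In terms of moduli, [Im rr ^ 2 = (|2 rq - 1| - Re (2 rq - 1)) / 2] and [Re rd ^ 2 = (|2 rq + 1|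
    + Re (2 rq + 1)) / 2], and [2 rq + 1] has the larger modulus. *)
Lemma Re_rd_Im_rr : (0 <= Re (rq z)) -> Im (rr z) ^ 2 + 2 * Re (rq z) <= Re (rd z) ^ 2.
Proof.
intros H0; destruct Im_rq as [H1 H2].
pose proof (csq_sqr _ H1) as Hr; fold (rr z) in Hr.
pose proof (csq_sqr _ H2) as Hd; fold (rd z) in Hd.
pose proof (Cmod_csq _ H2) as Hmd; fold (rd z) in Hmd.
pose proof (Cmod_csq _ H1) as Hmr; fold (rr z) in Hmr.
rewrite Cmod_sqr in Hmd, Hmr.
assert (Hle : Cmod (2 * rq z - 1) <= Cmod (2 * rq z + 1)).
{ apply Rsqr_incr_0_var; [| apply Cmod_ge_0].
  rewrite !Rsqr_pow2, !Cmod_sqr.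
  replace (Re (2 * rq z - 1)) with (2 * Re (rq z) - 1) by (reim; ring).
  replace (Re (2 * rq z + 1)) with (2 * Re (rq z) + 1) by (reim; ring).
  replace (Im (2 * rq z - 1)) with (2 * Im (rq z)) by (reim; ring).
  replace (Im (2 * rq z + 1)) with (2 * Im (rq z)) by (reim; ring).
  nra. }
apply (f_equal Re) in Hr, Hd.
reim_in Hr; reim_in Hd; nra.
Qed.

(** For [k2] one needs [Im rd <= Re rr]. Both [Re rr * Im rr] and [Re rd * Im rd] equal [Im rq], and
    [Im rr <= Re rd] by [Re_rd_Im_rr]; divide by [Re rd > 0]. *)
Lemma Im_k_nonneg : 0 <= Im (k1 z) /\ 0 <= Im (k2 z).
Proof.
rewrite Im_k1, Im_k2.
destruct Im_rq as [H1 H2].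
destruct (csq_quadrant z) as [Q1 Q2]; fold (rq z) in Q1, Q2.
destruct (csq_quadrant (2 * rq z - 1)) as [R1 R2]; fold (rr z) in R1, R2.
destruct (csq_quadrant (2 * rq z + 1)) as [D1 D2]; fold (rd z) in D1, D2.
split; [lra |].
pose proof (csq_sqr _ H1) as Hr; fold (rr z) in Hr; apply (f_equal Im) in Hr.
pose proof (csq_sqr _ H2) as Hd; fold (rd z) in Hd; apply (f_equal Im) in Hd.
pose proof (csq_sqr _ H1) as Hr'; fold (rr z) in Hr'; apply (f_equal Re) in Hr'.
pose proof (csq_sqr _ H2) as Hd'; fold (rd z) in Hd'; apply (f_equal Re) in Hd'.
pose proof (Re_rd_Im_rr Q1) as Hle.
assert (Hrd : Im (rr z) <= Re (rd z)) by nra.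
pose proof Cmod_rd_ge_1 as Hd1.
assert (Hs : 1 <= Re (rd z) ^ 2 + Im (rd z) ^ 2) by (rewrite <- Cmod_sqr; nra).
reim_in Hr; reim_in Hd; reim_in Hr'; reim_in Hd'; unfold Re, Im in *.
assert (Hre : 1 <= fst (rd z) * fst (rd z)) by nra.
assert (fst (rr z) * snd (rr z) = snd (rd z) * fst (rd z)) by lra.
assert (fst (rr z) * fst (rd z) >= snd (rd z) * fst (rd z)) by nra.
assert (0 < fst (rd z)) by nra.
nra.
Qed.

(** The formula [Re_w] contains the factor [Im k], and [Re (w k) = - Im z]. So a root cannot
    approach the real axis faster than [Im z] divided by a cubic in [|k|]. *)
Lemma Im_root_lower (k : C) : 0 <= Im k -> w k = (Ci * z)%C ->
  Im z <= Im k * (2 * Cmod k * (1 + 2 * Cmod k ^ 2)).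
Proof.
intros Hk Hw; apply (f_equal Re) in Hw.
assert (Hr : Re (Ci * z) = - Im z) by (reim; ring).
pose proof (re_le_Cmod k) as Ha; pose proof (Im_le_Cmod k) as Hb; pose proof (Cmod_sqr k) as Hs.
apply Rabs_le_between in Ha.
destruct k as [a b]; rewrite Hr, Re_w in Hw; simpl Re in *; simpl Im in *.
pose proof (Cmod_ge_0 (a, b)); set (m := Cmod (a, b)) in *.
assert (HX : -(1 + 2 * m ^ 2) <= 2 * a ^ 2 - 2 * b ^ 2 - 1 <= 1 + 2 * m ^ 2) by nra.
set (X := 2 * a ^ 2 - 2 * b ^ 2 - 1) in *.
assert (- (a * X) <= m * (1 + 2 * m ^ 2)).
{ apply Rle_trans with (Rabs (a * X)); [rewrite <- Rabs_Ropp; apply Rle_abs |].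
  rewrite Rabs_mult; apply Rmult_le_compat; try apply Rabs_pos; apply Rabs_le_between; lra. }
nra.
Qed.

End roots.

Lemma Im_k_inv_le (z : C) : 1 <= Im z ->
  (0 < Im (k1 z) /\ / Im (k1 z) <= 36 * Cmod z ^ 3) /\
  (0 < Im (k2 z) /\ / Im (k2 z) <= 36 * Cmod z ^ 3).
Proof.
intros Hz1; assert (Hz : 0 <= Im z) by lra.
assert (Hm : 1 <= Cmod z).
{ apply Rle_trans with (1 := Hz1); apply Rle_trans with (2 := Im_le_Cmod z); apply Rle_abs. }
destruct (Cmod_k_sqr z) as [K1 K2].
pose proof (Cmod_csq z Hz) as Hq; fold (rq z) in Hq.
pose proof (Cmod_ge_0 (rq z)).
assert (Hq1 : Cmod (rq z) <= Cmod z) by nra.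
destruct (Im_k_nonneg z) as [I1 I2].
assert (Hgen : forall k, 0 <= Im k -> w k = (Ci * z)%C -> Cmod k ^ 2 <= 2 * Cmod (rq z) + 1 ->
  0 < Im k /\ / Im k <= 36 * Cmod z ^ 3).
{ intros k Hk Hw Hk2; pose proof (Im_root_lower z k Hk Hw) as Hl.
  pose proof (Cmod_ge_0 k).
  assert (Hk3 : Cmod k <= 2 * Cmod z) by nra.
  assert (Hp : Im k <> 0) by (intros E0; rewrite E0 in Hl; lra).
  assert (Hp' : 0 < Im k) by lra.
  split; [exact Hp' |].
  (* With [|k| <= 2 |z|] the cubic is at most [4 |z| (1 + 8 |z|^2)], and [1 <= |z|] gives 36. *)
  assert (HB : 2 * Cmod k * (1 + 2 * Cmod k ^ 2) <= 36 * Cmod z ^ 3).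
  { assert (Hk4 : Cmod k ^ 2 <= 4 * Cmod z ^ 2) by nra.
    apply Rle_trans with (2 * (2 * Cmod z) * (1 + 2 * (4 * Cmod z ^ 2))).
    - apply Rmult_le_compat; nra.
    - nra. }
  apply Rmult_le_reg_l with (Im k); [exact Hp' |].
  rewrite Rinv_r by lra; nra. }
split; apply Hgen; trivial; [now apply w_k1 | now apply w_k2].
Qed.

Section root_regularity.
Context {U : UniformSpace}.

Lemma ccont_roots (f : U -> C) (x : U) : ccont f x ->
  ccont (fun r => rd (f r)) x /\ ccont (fun r => k1 (f r)) x /\ ccont (fun r => k2 (f r)) x.
Proof.
intros H; assert (Hq : ccont (fun r => rq (f r)) x) by now apply ccont_csq.
assert (Hd : ccont (fun r => rd (f r)) x).
{ apply ccont_csq, ccont_plus; [apply ccont_mult; [apply ccont_const | exact Hq] | apply ccont_const]. }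
assert (Hr : ccont (fun r => (Ci * rr (f r))%C) x).
{ apply ccont_mult; [apply ccont_const |].
  apply ccont_csq, ccont_minus; [apply ccont_mult; [apply ccont_const | exact Hq] | apply ccont_const]. }
assert (H2 : (2 : C) <> 0%C) by apply two_neq_0.
split; [exact Hd | split].
- apply ccont_div; [now apply ccont_plus | apply ccont_const | exact H2].
- apply ccont_div; [| apply ccont_const | exact H2].
  apply ccont_plus; [now apply ccont_opp | exact Hr].
Qed.

End root_regularity.

(** The sign conditions say that [- a b], [a - b] and [- Ci (a + b)] lie in the closed first
    quadrant, so they are the values of [csq] used in [rq], [rd] and [rr]. This identifies the roots
    on the real axis without any limit. *)
Lemma roots_unique (a b : C) : (a * a + b * b)%C = 1%C ->
  0 <= Re (a - b) -> 0 <= Im (a - b) -> 0 <= Im (a + b) -> Re (a + b) <= 0 ->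
  Re (a * b) <= 0 -> Im (a * b) <= 0 ->
  k1 (a * a * (b * b))%C = a /\ k2 (a * a * (b * b))%C = b.
Proof.
intros H1 D1 D2 R1 R2 Q1 Q2.
assert (Hq : rq (a * a * (b * b))%C = (- (a * b))%C).
{ unfold rq; replace (a * a * (b * b))%C with (- (a * b) * - (a * b))%C by ring.
  reim_in Q1; reim_in Q2; reim_in R1; reim_in R2; apply csq_unique; reim; lra. }
assert (Hd : rd (a * a * (b * b))%C = (a - b)%C).
{ unfold rd; rewrite Hq.
  replace (2 * - (a * b) + 1)%C with ((a - b) * (a - b))%C by (rewrite <- H1; ring).
  now apply csq_unique. }
assert (Hr : rr (a * a * (b * b))%C = (- Ci * (a + b))%C).
{ unfold rr; rewrite Hq.
  replace (2 * - (a * b) - 1)%C with ((- Ci * (a + b)) * (- Ci * (a + b)))%C.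
  - reim_in Q1; reim_in Q2; reim_in R1; reim_in R2; apply csq_unique; reim; lra.
  - rewrite <- H1.
    replace (- Ci * (a + b) * (- Ci * (a + b)))%C with ((Ci * Ci) * ((a + b) * (a + b)))%C by ring.
    rewrite Ci_sqr; ring. }
assert (Hc : (Ci * (- Ci * (a + b)))%C = (a + b)%C).
{ replace (Ci * (- Ci * (a + b)))%C with (- (Ci * Ci) * (a + b))%C by ring.
  rewrite Ci_sqr; ring. }
unfold k1, k2; rewrite Hd, Hr, Hc; split; field.
Qed.

(** * Holomorphy and the shift of contours *)

(** Holomorphy on the open upper half-plane, tested along straight lines. *)
Definition holo (f : C -> C) : Prop :=
  exists f' : C -> C, forall z, 0 < Im z ->
    ccont f z /\ ccont f' z /\
    forall (p v : C) (s : R), (p + s * v)%C = z ->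
      cderive (fun r => f (p + r * v)%C) s (f' z * v)%C.

Lemma ccont_id (z : C) : ccont (fun z => z) z.
Proof. apply (continuous_id (U := C_UniformSpace)). Qed.

Lemma cderive_eq (f : R -> C) (s : R) (l m : C) : cderive f s l -> l = m -> cderive f s m.
Proof. now intros H <-. Qed.

Lemma cderive_line (p v : C) (s : R) : cderive (fun r => (p + r * v)%C) s v.
Proof.
eapply cderive_eq.
- apply cderive_plus; [apply cderive_const | apply cderive_mult; [apply cderive_id | apply cderive_const]].
- cbv beta; ring.
Qed.

Lemma holo_const (c : C) : holo (fun _ => c).
Proof.
exists (fun _ => RtoC 0); intros z Hz; split; [apply ccont_const | split; [apply ccont_const |]].
intros p v s _; eapply cderive_eq; [apply cderive_const | ring].
Qed.

Lemma holo_id : holo (fun z => z).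
Proof.
exists (fun _ => RtoC 1); intros z Hz; split; [apply ccont_id | split; [apply ccont_const |]].
intros p v s _; eapply cderive_eq; [apply cderive_line | ring].
Qed.

Lemma holo_plus (f g : C -> C) : holo f -> holo g -> holo (fun z => (f z + g z)%C).
Proof.
intros [f' Hf] [g' Hg]; exists (fun z => (f' z + g' z)%C); intros z Hz.
destruct (Hf z Hz) as [F1 [F2 F3]], (Hg z Hz) as [G1 [G2 G3]].
split; [now apply ccont_plus | split; [now apply ccont_plus |]].
intros p v s E; eapply cderive_eq; [apply cderive_plus; [now apply F3 | now apply G3] | ring].
Qed.

Lemma holo_opp (f : C -> C) : holo f -> holo (fun z => (- f z)%C).
Proof.
intros [f' Hf]; exists (fun z => (- f' z)%C); intros z Hz.
destruct (Hf z Hz) as [F1 [F2 F3]].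
split; [now apply ccont_opp | split; [now apply ccont_opp |]].
intros p v s E; eapply cderive_eq; [apply cderive_opp; now apply F3 | ring].
Qed.

Lemma holo_minus (f g : C -> C) : holo f -> holo g -> holo (fun z => (f z - g z)%C).
Proof. intros; apply holo_plus; [| apply holo_opp]; assumption. Qed.

Lemma holo_mult (f g : C -> C) : holo f -> holo g -> holo (fun z => (f z * g z)%C).
Proof.
intros [f' Hf] [g' Hg]; exists (fun z => (f' z * g z + f z * g' z)%C); intros z Hz.
destruct (Hf z Hz) as [F1 [F2 F3]], (Hg z Hz) as [G1 [G2 G3]].
split; [now apply ccont_mult | split].
- cont.
- intros p v s E; eapply cderive_eq; [apply cderive_mult; [now apply F3 | now apply G3] |].
  cbv beta; rewrite E; ring.
Qed.

Lemma holo_inv (f : C -> C) : holo f -> (forall z, 0 < Im z -> f z <> 0%C) ->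
  holo (fun z => (/ f z)%C).
Proof.
intros [f' Hf] H0; exists (fun z => (- (f' z / (f z * f z)))%C); intros z Hz.
destruct (Hf z Hz) as [F1 [F2 F3]]; specialize (H0 z Hz).
split; [now apply ccont_inv | split].
- apply ccont_opp, ccont_div; [exact F2 | now apply ccont_mult |].
  now apply Cmult_neq_0.
- intros p v s E; eapply cderive_eq; [apply cderive_inv; [now apply F3 |] |].
  + now rewrite E.
  + cbv beta; rewrite E; field; exact H0.
Qed.

Lemma holo_div (f g : C -> C) : holo f -> holo g -> (forall z, 0 < Im z -> g z <> 0%C) ->
  holo (fun z => (f z / g z)%C).
Proof. intros; apply holo_mult; [| apply holo_inv]; assumption. Qed.

Lemma holo_Cexp (f : C -> C) : holo f -> holo (fun z => Cexp (f z)).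
Proof.
intros [f' Hf]; exists (fun z => (Cexp (f z) * f' z)%C); intros z Hz.
destruct (Hf z Hz) as [F1 [F2 F3]].
split; [now apply ccont_Cexp | split].
- cont.
- intros p v s E; eapply cderive_eq; [apply cderive_Cexp; now apply F3 |].
  cbv beta; rewrite E; ring.
Qed.

Lemma csq_neq_0 (z : C) : 0 < Im z -> csq z <> 0%C.
Proof.
intros Hz E; destruct (csq_open_quadrant z Hz) as [H _]; rewrite E in H; reim_in H; lra.
Qed.

Lemma holo_csq (f : C -> C) : holo f -> (forall z, 0 < Im z -> 0 < Im (f z)) ->
  holo (fun z => csq (f z)).
Proof.
intros [f' Hf] H0; exists (fun z => (f' z / (2 * csq (f z)))%C); intros z Hz.
destruct (Hf z Hz) as [F1 [F2 F3]]; specialize (H0 z Hz); pose proof (csq_neq_0 _ H0) as Hn.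
split; [now apply ccont_csq | split].
- apply ccont_div; [exact F2 | apply ccont_mult; [apply ccont_const | now apply ccont_csq] |].
  apply Cmult_neq_0; [apply two_neq_0 | exact Hn].
- intros p v s E; eapply cderive_eq; [apply cderive_csq; [now apply F3 |] |].
  + now rewrite E.
  + cbv beta; rewrite E; field; exact Hn.
Qed.

Lemma holo_roots : holo rd /\ holo k1 /\ holo k2.
Proof.
assert (Hq : holo rq) by (apply holo_csq; [apply holo_id | trivial]).
assert (Hp : forall z, 0 < Im z -> 0 < Im (rq z)) by (intros z Hz; now apply csq_open_quadrant).
assert (Hr : holo rr).
{ apply holo_csq; [apply holo_minus; [apply holo_mult; [apply holo_const | exact Hq] | apply holo_const] |].
  intros z Hz; specialize (Hp z Hz); reim; lra. }
assert (Hd : holo rd).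
{ apply holo_csq; [apply holo_plus; [apply holo_mult; [apply holo_const | exact Hq] | apply holo_const] |].
  intros z Hz; specialize (Hp z Hz); reim; lra. }
assert (Hir : holo (fun z => (Ci * rr z)%C)) by (apply holo_mult; [apply holo_const | exact Hr]).
split; [exact Hd | split].
- apply holo_div; [now apply holo_plus | apply holo_const | intros; apply two_neq_0].
- apply holo_div; [| apply holo_const | intros; apply two_neq_0].
  apply holo_plus; [now apply holo_opp | exact Hir].
Qed.

(** The [t]-transform in the variable [z], where [w = Ci * z]. *)
Definition lap (g : R -> C) (T : R) (z : C) : C :=
  CInt (fun s => (Cexp (Ci * z * s) * g s)%C) 0 T.

Section transform.
Variables (T : R) (g : R -> C).
Hypothesis HT : 0 <= T.
Hypothesis Hg : forall s, ccont g s.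

Lemma ccont_kernel {U : UniformSpace} (h : U -> C) (k : U -> R) (u : U) :
  ccont h u -> continuous k u ->
  ccont (fun p => (Cexp (Ci * h p * k p) * g (k p))%C) u.
Proof. cont. Qed.

Lemma ccont_lap (z : C) : ccont (lap g T) z.
Proof.
apply (ccont_CInt_param (U := C_UniformSpace) (fun z s => (Cexp (Ci * z * s) * g s)%C)).
- intros s; apply (ccont_kernel (fun p => fst p) (fun p => snd p));
    [apply (continuous_fst (U := C_UniformSpace) (V := R_UniformSpace))
    |apply (continuous_snd (U := C_UniformSpace) (V := R_UniformSpace))].
- cont.
Qed.

End transform.

Lemma holo_lap (g : R -> C) (T : R) : 0 <= T -> (forall s : R, ccont g s) -> holo (lap g T).
Proof.
intros HT Hg; exists (lap (fun s : R => (Ci * s * g s)%C) T); intros z Hz.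
assert (Hg' : forall s : R, ccont (fun s : R => (Ci * s * g s)%C) s).
{ cont. }
split; [now apply ccont_lap | split; [now apply ccont_lap |]].
intros p v s E.
pose proof (cderive_CInt_param (fun (r s0 : R) => (Cexp (Ci * (p + r * v) * s0) * g s0)%C)
  (fun (r s0 : R) => (v * (Cexp (Ci * (p + r * v) * s0) * (Ci * s0 * g s0)))%C) 0 T s (mkposreal 1 Rlt_0_1)) as HD.
eapply cderive_eq; [apply HD |].
- intros u t _; eapply cderive_eq.
  + apply cderive_mult; [| apply cderive_const].
    apply cderive_Cexp, cderive_mult; [| apply cderive_const].
    apply cderive_mult; [apply cderive_const | apply cderive_line].
  + cbv beta; ring.
- cont.
- cont.
- cont.
- rewrite CInt_mult; [| intros t; apply (ccont_kernel _ Hg' (fun _ => (p + s * v)%C) (fun s => s));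
    [apply ccont_const | apply continuous_id]].
  rewrite Cmult_comm; rewrite E; reflexivity.
Qed.

(** The integral along the line at height [s] is differentiated in [s]: the integrand becomes
    [Ci * f'], which integrates to a difference of the values of [Ci * f] at the two ends, at most
    [2 M]. This happens for [0 < s < S]; continuity of [f] carries the estimate down to the real
    axis. *)
Lemma contour_shift (f : C -> C) (S M r : R) : holo f -> (forall z : C, ccont f z) ->
  0 < S -> 0 < r ->
  (forall s : R, 0 < s < S -> Cmod (f (r + s * Ci)%C) <= M /\ Cmod (f (- r + s * Ci)%C) <= M) ->
  Cmod (CInt (fun u : R => f (u + S * Ci)%C) (- r) r - CInt (fun u : R => f u) (- r) r) <= 2 * M * S.
Proof.
intros [f' Hf] Hc HS Hr HM.
assert (Hcl : forall (s u : R), ccont (fun u : R => f (u + s * Ci)%C) u).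
{ intros s u; apply (continuous_comp (fun u : R => (u + s * Ci)%C) f); [| apply Hc].
  apply ccont_plus; [apply ccont_RtoC, continuous_id | apply ccont_const]. }
set (A := fun s : R => CInt (fun u : R => f (u + s * Ci)%C) (- r) r).
assert (HA0 : CInt (fun u : R => f u) (- r) r = A 0).
{ apply CInt_ext; [lra |]; intros u _; f_equal; ring. }
rewrite HA0; fold (A S).
replace (2 * M * S) with (2 * M * S - 2 * M * 0) by ring.
assert (Him : forall s u : R, Im (u + s * Ci)%C = s) by (intros; reim; ring).
apply (cderive_mean_value A (fun s : R => (Ci * (f (r + s * Ci) - f (- r + s * Ci)))%C)
  (fun s => 2 * M * s) (fun _ => 2 * M)); [lra | | | | |].
- intros s Hs.
  apply (ccont_CInt_param (fun s u : R => f (u + s * Ci)%C)); [| intros; apply Hcl].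
  intros u; apply (continuous_comp (fun q : R * R => (snd q + fst q * Ci)%C) f); [| apply Hc].
  apply ccont_plus; [| apply ccont_mult; [| apply ccont_const]]; apply ccont_RtoC;
    [apply continuous_snd | apply continuous_fst].
- cont.
- intros s Hs.
  assert (Hf'c : forall u, ccont (fun u : R => f' (u + s * Ci)%C) u).
  { intros u; apply (continuous_comp (fun u : R => (u + s * Ci)%C) f').
    - apply ccont_plus; [apply ccont_RtoC, continuous_id | apply ccont_const].
    - apply (Hf (u + s * Ci)%C); rewrite Him; lra. }
  eapply cderive_eq.
  + apply (cderive_CInt_param (fun s u : R => f (u + s * Ci)%C)
      (fun s u : R => (f' (u + s * Ci) * Ci)%C) (- r) r s (mkposreal s (proj1 Hs))).
    * intros u t Hu; simpl in Hu; apply Rabs_lt_between in Hu.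
      assert (Hp : 0 < Im (t + u * Ci)%C) by (rewrite Him; lra).
      now apply (proj2 (proj2 (Hf _ Hp))).
    * intros u; apply ccont_mult; [| apply ccont_const].
      apply (continuous_comp (fun q : R * R => (snd q + fst q * Ci)%C) f').
      -- apply ccont_plus; [| apply ccont_mult; [| apply ccont_const]]; apply ccont_RtoC;
           [apply continuous_snd | apply continuous_fst].
      -- apply (Hf (u + s * Ci)%C); rewrite Him; lra.
    * intros; apply Hcl.
    * cont.
  + rewrite (CInt_FTC (fun u : R => (Ci * f (u + s * Ci))%C)).
    * rewrite RtoC_opp; ring.
    * lra.
    * intros u _; apply ccont_mult; [apply ccont_const | apply Hcl].
    * cont.
    * intros u _.
      assert (Hp : 0 < Im (s * Ci + u * 1)%C) by (reim; lra).
      eapply cderive_eq.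
      -- apply cderive_mult; [apply cderive_const |].
         apply (cderive_ext (fun u : R => f (s * Ci + u * 1)%C)).
         { intros r0; f_equal; ring. }
         now apply (proj2 (proj2 (Hf _ Hp))).
      -- cbv beta.
         replace (s * Ci + u * 1)%C with (u + s * Ci)%C by ring; ring.
- intros s Hs; auto_derive; trivial; ring.
- intros s Hs; rewrite Cmod_mult, Cmod_Ci, Rmult_1_l.
  destruct (HM s Hs) as [H1 H2].
  eapply Rle_trans; [apply Cmod_minus_le | lra].
Qed.

(** * The half-line resolvent *)

Lemma is_derive_exp_scal (c b x : R) : is_derive (fun r => c * exp (b * r)) x (c * b * exp (b * x)).
Proof. auto_derive; trivial; ring. Qed.

Lemma cderive_Cexp_lin (c : C) (x : R) : cderive (fun r => Cexp (c * r)) x (Cexp (c * x) * c)%C.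
Proof.
eapply cderive_eq; [apply cderive_Cexp, cderive_mult; [apply cderive_const | apply cderive_id] |].
cbv beta; ring.
Qed.

Lemma ccont_Cexp_lin (c : C) (x : R) : ccont (fun r : R => Cexp (c * r)) x.
Proof. cont. Qed.

(** With the integrating factor [exp (- i k x)] the derivative is at most [M exp (b x)], [b = Im k],
    and [M / b * exp (b x)] is a majorant; integration starts from the zero of [p]. *)
Lemma first_order_bound_zero (k : C) (p q : R -> C) (M : R) :
  0 < Im k -> (forall x, ccont p x) -> p 0 = 0%C ->
  (forall x, 0 < x -> cderive p x (Ci * k * p x + q x)%C) ->
  (forall x, 0 < x -> Cmod (q x) <= M) ->
  forall x, 0 <= x -> Cmod (p x) <= M / Im k.
Proof.
intros Hk Hc H0 Hd HM x Hx; set (b := Im k) in *.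
assert (Hmod : forall s : R, Cmod (Cexp (- (Ci * k) * s)) = exp (b * s)).
{ intros s; rewrite Cmod_Cexp; f_equal; reim; unfold b; ring. }
assert (H : Cmod (Cexp (- (Ci * k) * x) * p x - Cexp (- (Ci * k) * 0) * p 0)
  <= M / b * exp (b * x) - M / b * exp (b * 0)).
{ apply (cderive_mean_value (fun s => (Cexp (- (Ci * k) * s) * p s)%C)
    (fun s => (Cexp (- (Ci * k) * s) * q s)%C)
    (fun s => M / b * exp (b * s)) (fun s => M / b * b * exp (b * s))); trivial.
  - cont.
  - cont.
  - intros s Hs; eapply cderive_eq; [apply cderive_mult; [apply cderive_Cexp_lin | now apply Hd] |].
    cbv beta; ring.
  - intros s Hs; apply is_derive_exp_scal.
  - intros s Hs; rewrite Cmod_mult, Hmod, Rmult_comm; apply Rmult_le_compat_r;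
      [apply Rlt_le, exp_pos |].
    replace (M / b * b) with M by (field; lra); now apply HM. }
rewrite H0, Rmult_0_r, exp_0, Cmult_0_r in H.
assert (HM0 : 0 <= M) by (apply Rle_trans with (2 := HM 1 Rlt_0_1), Cmod_ge_0).
replace (Cexp (- (Ci * k) * x) * p x - 0)%C with (Cexp (- (Ci * k) * x) * p x)%C in H by ring.
rewrite Cmod_mult, Hmod in H.
apply Rmult_le_reg_l with (exp (b * x)); [apply exp_pos |].
assert (0 <= M / b) by (apply Rdiv_le_0_compat; lra); lra.
Qed.

Lemma exp_opp_small (b K e : R) : 0 < b -> 0 < e -> exists L0, 0 < L0 /\ forall L, L0 <= L -> K * exp (- b * L) < e.
Proof.
intros Hb He; exists (Rabs K / (b * e) + 1); pose proof (Rabs_pos K) as HK.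
assert (HbL : 0 <= Rabs K / (b * e)) by (apply Rdiv_le_0_compat; nra).
split; [lra |]; intros L HL.
assert (Hpos : 0 < exp (- b * L)) by apply exp_pos.
apply Rle_lt_trans with (Rabs K * exp (- b * L)).
{ apply Rmult_le_compat_r; [lra | apply Rle_abs]. }
assert (H1 : 1 + b * L <= exp (b * L)) by apply exp_ineq1_le.
assert (H2 : exp (b * L) * exp (- b * L) = 1).
{ rewrite <- exp_plus; replace (b * L + - b * L) with 0 by ring; apply exp_0. }
assert (H3 : Rabs K < e * (1 + b * L)).
{ assert (Hq : b * e * (Rabs K / (b * e)) = Rabs K) by (field; lra).
  assert (b * e * (Rabs K / (b * e) + 1) <= b * e * L) by (apply Rmult_le_compat_l; nra).
  nra. }
assert (H4 : Rabs K * exp (- b * L) < e * (1 + b * L) * exp (- b * L)) by (apply Rmult_lt_compat_r; lra).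
assert (H5 : (1 + b * L) * exp (- b * L) <= 1).
{ rewrite <- H2; apply Rmult_le_compat_r; lra. }
nra.
Qed.

(** Here the homogeneous solutions grow. Integration comes in from infinity, where [exp (i k L) p L]
    tends to 0 because [p] is bounded, so no initial value enters. *)
Lemma first_order_bound_infinity (k : C) (p q : R -> C) (M B : R) :
  0 < Im k -> (forall x, ccont p x) ->
  (forall x, 0 <= x -> Cmod (p x) <= B) ->
  (forall x, 0 < x -> cderive p x (- (Ci * k) * p x + q x)%C) ->
  (forall x, 0 < x -> Cmod (q x) <= M) ->
  forall x, 0 <= x -> Cmod (p x) <= M / Im k.
Proof.
intros Hk Hc HB Hd HM x Hx; set (b := Im k) in *.
assert (HM0 : 0 <= M) by (apply Rle_trans with (2 := HM 1 Rlt_0_1), Cmod_ge_0).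
assert (Hmod : forall s : R, Cmod (Cexp (Ci * k * s)) = exp (- b * s)).
{ intros s; rewrite Cmod_Cexp; f_equal; reim; unfold b; ring. }
assert (H : forall L, x <= L -> Cmod (Cexp (Ci * k * L) * p L - Cexp (Ci * k * x) * p x)
  <= - (M / b) * exp (- b * L) - - (M / b) * exp (- b * x)).
{ intros L HL; apply (cderive_mean_value (fun s => (Cexp (Ci * k * s) * p s)%C)
    (fun s => (Cexp (Ci * k * s) * q s)%C)
    (fun s => - (M / b) * exp (- b * s)) (fun s => - (M / b) * - b * exp (- b * s))); trivial.
  - cont.
  - cont.
  - intros s Hs; eapply cderive_eq;
      [apply cderive_mult; [apply cderive_Cexp_lin | apply Hd; lra] |].
    cbv beta; ring.
  - intros s Hs; apply is_derive_exp_scal.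
  - intros s Hs; rewrite Cmod_mult, Hmod, Rmult_comm; apply Rmult_le_compat_r;
      [apply Rlt_le, exp_pos |].
    replace (- (M / b) * - b) with M by (field; lra); apply HM; lra. }
assert (HMb : 0 <= M / b) by (apply Rdiv_le_0_compat; lra).
apply Rmult_le_reg_l with (exp (- b * x)); [apply exp_pos |].
apply le_epsilon; intros e He.
destruct (exp_opp_small b B e Hk He) as [L0 [HL0 HL]].
set (L := Rmax L0 x).
assert (HxL : x <= L) by apply Rmax_r.
specialize (H L HxL); specialize (HL L (Rmax_l _ _)); specialize (HB L (Rle_trans _ _ _ Hx HxL)).
assert (H1 : Cmod (Cexp (Ci * k * x) * p x) - Cmod (Cexp (Ci * k * L) * p L) <=
  Cmod (Cexp (Ci * k * L) * p L - Cexp (Ci * k * x) * p x)).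
{ rewrite <- (Cmod_opp (_ - _)).
  replace (- (Cexp (Ci * k * L) * p L - Cexp (Ci * k * x) * p x))%C
    with (Cexp (Ci * k * x) * p x - Cexp (Ci * k * L) * p L)%C by ring.
  apply Cmod_inv_triangle. }
rewrite !Cmod_mult, !Hmod in H1.
pose proof (exp_pos (- b * L)).
assert (0 <= M / b * exp (- b * L)) by (apply Rmult_le_pos; lra).
assert (exp (- b * L) * Cmod (p L) <= B * exp (- b * L)) by (rewrite Rmult_comm; apply Rmult_le_compat_r; lra).
lra.
Qed.

(** Each of the four first-order factors of [d^4 + d^2 + z] costs a factor
    [/ Im a] or [/ Im b]. *)
Lemma fourth_order_bound (z a b : C) (Z : nat -> R -> C) (F : R -> C) (M B : R) :
  0 < Im a -> 0 < Im b -> (a - b)%C <> 0%C ->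
  (a * a + b * b)%C = 1%C -> (a * a * (b * b))%C = z ->
  (forall i x, (i < 4)%nat -> ccont (Z i) x) ->
  (forall i x, (i < 4)%nat -> 0 <= x -> Cmod (Z i x) <= B) ->
  (forall i x, (i < 4)%nat -> 0 < x -> cderive (Z i) x (Z (S i) x)) ->
  (forall x, 0 < x -> (Z 4%nat x + Z 2%nat x + z * Z 0%nat x)%C = F x) ->
  (forall x, 0 < x -> Cmod (F x) <= M) ->
  forall x, 0 <= x ->
    Cmod (Z 0%nat x -
      (Cexp (Ci * a * x) * (Z 1%nat 0 - Ci * b * Z 0%nat 0)
       - Cexp (Ci * b * x) * (Z 1%nat 0 - Ci * a * Z 0%nat 0)) / (Ci * (a - b)))
    <= M / Im a / Im b / Im a / Im b.
Proof.
intros Ha Hb Hab Hs Hp Hc HB Hd HF HM.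
set (c1 := (Ci * a)%C); set (c2 := (Ci * b)%C).
assert (Hc12 : (c1 * c1 + c2 * c2)%C = (- (1))%C).
{ unfold c1, c2; replace (Ci * a * (Ci * a) + Ci * b * (Ci * b))%C
    with (Ci * Ci * (a * a + b * b))%C by ring; rewrite Ci_sqr, Hs; ring. }
assert (Hcp : (c1 * c1 * (c2 * c2))%C = z).
{ unfold c1, c2; replace (Ci * a * (Ci * a) * (Ci * b * (Ci * b)))%C
    with (Ci * Ci * (Ci * Ci) * (a * a * (b * b)))%C by ring; rewrite Ci_sqr, Hp; ring. }
(* [W = (d - c1)(d^2 - c2^2) Z] and [U = (d - c1)(d - c2) Z], so that [(d + c1) W = F] and
   [(d + c2) U = W]. These growing factors are inverted from infinity; the decaying ones [d - c1],
   [d - c2] are inverted from 0. *)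
set (W := fun x => (Z 3%nat x + (- c1) * Z 2%nat x + (- (c2 * c2)) * Z 1%nat x + c1 * (c2 * c2) * Z 0%nat x)%C).
set (U := fun x => (Z 2%nat x + - (c1 + c2) * Z 1%nat x + c1 * c2 * Z 0%nat x)%C).
assert (Z0 := fun x => Hc 0%nat x ltac:(lia)); assert (Z1 := fun x => Hc 1%nat x ltac:(lia)).
assert (Z2 := fun x => Hc 2%nat x ltac:(lia)); assert (Z3 := fun x => Hc 3%nat x ltac:(lia)).
assert (D0 := fun x => Hd 0%nat x ltac:(lia)); assert (D1 := fun x => Hd 1%nat x ltac:(lia)).
assert (D2 := fun x => Hd 2%nat x ltac:(lia)); assert (D3 := fun x => Hd 3%nat x ltac:(lia)).
assert (B0 := fun x => HB 0%nat x ltac:(lia)); assert (B1 := fun x => HB 1%nat x ltac:(lia)).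
assert (B2 := fun x => HB 2%nat x ltac:(lia)); assert (B3 := fun x => HB 3%nat x ltac:(lia)).
clear Hc Hd HB.
assert (Hscd : forall (c : C) (f : R -> C) x l, cderive f x l -> cderive (fun x => (c * f x)%C) x (c * l)%C).
{ intros; eapply cderive_eq; [apply cderive_mult; [apply cderive_const | eassumption] |]; cbv beta; ring. }
assert (HB0 : forall (c : C) f x, 0 <= x -> Cmod (f x) <= B -> Cmod (c * f x) <= Cmod c * B).
{ intros; rewrite Cmod_mult; apply Rmult_le_compat_l; [apply Cmod_ge_0 | assumption]. }
assert (HW : forall x, 0 <= x -> Cmod (W x) <= M / Im a).
{ apply (first_order_bound_infinity a W F M
    (B + Cmod (- c1) * B + Cmod (- (c2 * c2)) * B + Cmod (c1 * (c2 * c2)) * B)); trivial.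
  - unfold W; cont.
  - intros x Hx; unfold W.
    eapply Rle_trans; [apply Cmod_triangle | apply Rplus_le_compat; [| now auto]].
    eapply Rle_trans; [apply Cmod_triangle | apply Rplus_le_compat; [| now auto]].
    eapply Rle_trans; [apply Cmod_triangle | apply Rplus_le_compat; [| now auto]].
    now auto.
  - intros x Hx; eapply cderive_eq.
    + unfold W; apply cderive_plus; [apply cderive_plus; [apply cderive_plus |] |];
        [apply D3 | apply Hscd, D2 | apply Hscd, D1 | apply Hscd, D0]; exact Hx.
    + rewrite <- HF by exact Hx; fold c1; unfold W.
      replace (Z 4%nat x + Z 2%nat x + z * Z 0%nat x)%C
        with (Z 4%nat x - (- (1)) * Z 2%nat x + z * Z 0%nat x)%C by ring.
      rewrite <- Hc12, <- Hcp; ring. }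
assert (HU : forall x, 0 <= x -> Cmod (U x) <= M / Im a / Im b).
{ apply (first_order_bound_infinity b U W (M / Im a)
    (B + Cmod (- (c1 + c2)) * B + Cmod (c1 * c2) * B)); trivial.
  - unfold U; cont.
  - intros x Hx; unfold U.
    eapply Rle_trans; [apply Cmod_triangle | apply Rplus_le_compat; [| now auto]].
    eapply Rle_trans; [apply Cmod_triangle | apply Rplus_le_compat; [| now auto]].
    now auto.
  - intros x Hx; eapply cderive_eq.
    + unfold U; apply cderive_plus; [apply cderive_plus |];
        [apply D2 | apply Hscd, D1 | apply Hscd, D0]; exact Hx.
    + fold c2; unfold U, W; ring.
  - intros x Hx; apply HW; lra. }
set (A := Z 1%nat 0); set (B' := Z 0%nat 0).
set (e1 := fun x : R => Cexp (c1 * x)); set (e2 := fun x : R => Cexp (c2 * x)).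
assert (He1 : forall x, ccont e1 x) by (intros; apply ccont_Cexp_lin).
assert (He2 : forall x, ccont e2 x) by (intros; apply ccont_Cexp_lin).
assert (De1 : forall x, cderive e1 x (e1 x * c1)%C) by (intros; apply cderive_Cexp_lin).
assert (De2 : forall x, cderive e2 x (e2 x * c2)%C) by (intros; apply cderive_Cexp_lin).
assert (E10 : e1 0 = 1%C) by (unfold e1; rewrite Cmult_0_r; apply Cexp_0).
assert (E20 : e2 0 = 1%C) by (unfold e2; rewrite Cmult_0_r; apply Cexp_0).
(* Subtracting a multiple of [e1], which [d - c1] annihilates, makes the value at 0 vanish; [V]
   below does the same for the last factor. *)
set (V1 := fun x => (Z 1%nat x + - c2 * Z 0%nat x + - (A - c2 * B') * e1 x)%C).
assert (HV1 : forall x, 0 <= x -> Cmod (V1 x) <= M / Im a / Im b / Im a).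
{ apply (first_order_bound_zero a V1 U (M / Im a / Im b)); trivial.
  - unfold V1; cont.
  - unfold V1; rewrite E10; fold A; fold B'; ring.
  - intros x Hx; eapply cderive_eq.
    + unfold V1; apply cderive_plus; [apply cderive_plus |];
        [apply D1 | apply Hscd, D0 | apply Hscd, De1]; exact Hx.
    + fold c1; unfold V1, U; ring.
  - intros x Hx; apply HU; lra. }
assert (Hcc : (Ci * (a - b))%C <> 0%C).
{ apply Cmult_neq_0; [apply Ci_neq_0 | exact Hab]. }
set (g1 := ((A - c2 * B') / (Ci * (a - b)))%C); set (g2 := (- ((A - c1 * B') / (Ci * (a - b))))%C).
set (V := fun x => (Z 0%nat x + - g1 * e1 x + - g2 * e2 x)%C).
pose proof Ci_neq_0 as HCi.
intros x Hx.
replace (Z 0%nat x - (Cexp (c1 * x) * (A - c2 * B') - Cexp (c2 * x) * (A - c1 * B')) / (Ci * (a - b)))%C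
  with (V x) by (unfold V, g1, g2, e1, e2; field; now split).
revert x Hx.
apply (first_order_bound_zero b V V1 (M / Im a / Im b / Im a)); trivial.
- unfold V; cont.
- unfold V; rewrite E10, E20; fold B'; unfold g1, g2, c1, c2; field; now split.
- intros x Hx; eapply cderive_eq.
  + unfold V; apply cderive_plus; [apply cderive_plus |];
      [apply D0 | apply Hscd, De1 | apply Hscd, De2]; exact Hx.
  + fold c2; unfold V, V1, g1, g2, c1, c2; field; now split.
- intros x Hx; apply HV1; lra.
Qed.

(** * Fourier inversion *)

Lemma CInt_comp (f : R -> C) (g dg : R -> R) (a b : R) : a <= b ->
  (forall x, ccont f x) ->
  (forall x, a <= x <= b -> is_derive g x (dg x) /\ continuous dg x) ->
  CInt (fun y => (dg y * f (g y))%C) a b = CInt f (g a) (g b).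
Proof.
intros Hab Hf Hg.
pose proof (RInt_comp (V := C_R_CompleteNormedModule) f g dg a b) as H.
rewrite Rmin_left, Rmax_right in H by assumption.
unfold CInt; rewrite <- H; [| intros; apply Hf | exact Hg].
apply (CInt_ext _ _ a b Hab); intros t _; symmetry; apply scal_RtoC.
Qed.

Lemma CInt_shift (f : R -> C) (t c : R) : 0 <= c -> (forall x, ccont f x) ->
  CInt (fun s => f (t + s)) 0 c = CInt f t (t + c).
Proof.
intros Hc Hf; pose proof (CInt_comp f (fun s => t + s) (fun _ => 1) 0 c Hc Hf) as H.
rewrite Rplus_0_r in H; rewrite <- H.
- apply CInt_ext; [exact Hc |]; intros; ring.
- intros x _; split; [auto_derive; trivial; ring | apply continuous_const].
Qed.

Lemma CInt_reflect (f : R -> C) (t c : R) : 0 <= c -> (forall x, ccont f x) ->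
  CInt (fun s => f (t - s)) 0 c = CInt f (t - c) t.
Proof.
intros Hc Hf; pose proof (CInt_comp f (fun s => t - s) (fun _ => -1) 0 c Hc Hf) as H.
rewrite Rminus_0_r in H; rewrite (CInt_swap f (t - c)) by exact Hf; rewrite <- H.
- rewrite <- CInt_opp.
  + apply CInt_ext; [exact Hc |]; intros; ring.
  + cont.
- intros x _; split; [auto_derive; trivial; ring | apply continuous_const].
Qed.

Lemma CInt_zero (a b : R) : CInt (fun _ => RtoC 0) a b = 0%C.
Proof. rewrite CInt_const; ring. Qed.

(** * Exchange of the order of integration *)

Section fubini.
Variable f : R -> R -> C.
Hypothesis Hf : forall u t, ccont (fun p : R * R => f (fst p) (snd p)) (u, t).

Lemma ccont_2d_l (u t : R) : ccont (fun u => f u t) u.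
Proof.
apply (continuous_comp (fun u : R => (u, t)) (fun p : R * R => f (fst p) (snd p))); [| apply Hf].
apply (continuous_comp_2 (fun u : R => u) (fun _ => t) (fun a b => (a, b)));
  [apply continuous_id | apply continuous_const | ].
apply continuous_ext with (fun p : R * R => p); [now intros [] | apply continuous_id].
Qed.

Lemma ccont_2d_r (u t : R) : ccont (f u) t.
Proof.
apply (continuous_comp (fun t : R => (u, t)) (fun p : R * R => f (fst p) (snd p))); [| apply Hf].
apply (continuous_comp_2 (fun _ => u) (fun t : R => t) (fun a b => (a, b)));
  [apply continuous_const | apply continuous_id | ].
apply continuous_ext with (fun p : R * R => p); [now intros [] | apply continuous_id].
Qed.

Lemma ccont_2d_swap (p : R * R) : ccont (fun p : R * R => f (snd p) (fst p)) p.
Proof.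
apply (continuous_comp (fun p : R * R => (snd p, fst p)) (fun p : R * R => f (fst p) (snd p))); [| apply Hf].
apply (continuous_comp_2 (fun p : R * R => snd p) (fun p => fst p) (fun a b => (a, b))); [cont | cont |].
apply continuous_ext with (fun p : R * R => p); [now intros [] | cont].
Qed.

(** Seen as functions of the upper limit in [u], both sides have the same derivative and vanish at
    [a]. *)
Lemma CInt_exchange (a b c d : R) : a <= b -> c <= d ->
  CInt (fun u => CInt (f u) c d) a b = CInt (fun t => CInt (fun u => f u t) a b) c d.
Proof.
intros Hab Hcd.
assert (H : forall r u, ccont (fun t => CInt (fun u => f u t) a r) u).
{ intros r u; apply (ccont_CInt_param (fun t u => f u t)); [intros; apply ccont_2d_swap | intros; apply ccont_2d_l]. }
assert (Hi : forall s, ccont (fun u => CInt (f u) c d) s).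
{ intros s; apply (ccont_CInt_param f); [intros; apply Hf | intros; apply ccont_2d_r]. }
set (F := fun r => CInt (fun t => CInt (fun u => f u t) a r) c d).
assert (HF : forall r, cderive F r (CInt (f r) c d)).
{ intros r; apply (cderive_CInt_param (fun r t => CInt (fun u => f u t) a r) f c d r (mkposreal 1 Rlt_0_1)).
  - intros u t _; apply (cderive_CInt (fun u => f u t)); intros; apply ccont_2d_l.
  - intros; apply Hf.
  - intros; apply H.
  - intros; apply ccont_2d_r. }
rewrite (CInt_FTC F (fun u => CInt (f u) c d)); trivial.
- unfold F at 2; rewrite (CInt_ext _ (fun _ => RtoC 0)); [| exact Hcd | intros; apply CInt_point].
  rewrite CInt_zero; unfold F; ring.
intros s _; eapply cderive_ccont, HF.
Qed.

End fubini.

(** * The Riemann-Lebesgue lemma and the Dirichlet kernel *)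

Lemma Cmod_CInt_le_mod (f h : R -> C) (a b : R) : a <= b ->
  (forall z, ccont f z) -> (forall z, ccont h z) ->
  (forall t, a <= t <= b -> Cmod (f t) <= Cmod (h t)) ->
  Cmod (CInt f a b) <= Cmod (CInt (fun t => RtoC (Cmod (h t))) a b).
Proof.
intros Hab Hf Hh H.
assert (Hm : forall z, continuous (fun t => Cmod (h t)) z) by (intros; apply continuous_Cmod, Hh).
apply Rle_trans with (1 := Cmod_CInt_le f _ a b Hab Hf Hm H).
rewrite CInt_pair by cont.
apply Rle_trans with (2 := re_le_Cmod _), Rle_abs.
Qed.

Lemma ccont_CInt_bound (f : R -> C) (a x : R) : (forall z, ccont f z) ->
  ccont (fun r => CInt f a r) x.
Proof. intros Hf; apply cderive_ccont with (f x); now apply cderive_CInt. Qed.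

Lemma riemann_lebesgue (psi : R -> C) (c e : R) : 0 <= c -> 0 < e ->
  (forall x, ccont psi x) ->
  exists R0, 0 < R0 /\ forall r, R0 <= r ->
    Cmod (CInt (fun s => (psi s * sin (r * s)%R)%C) 0 c) < e.
Proof.
intros Hc He Hpsi.
(* Compare the integral with its translate by half a period [PI / r]. *)
set (m := fun s : R => RtoC (Cmod (psi s))).
assert (Hm : forall s, ccont m s) by (intros; apply ccont_RtoC, continuous_Cmod, Hpsi).
assert (Hsh : forall h s : R, continuous (fun s => s - h) s).
{ cont. }
assert (Hpsih : forall h s, ccont (fun s => psi (s - h)%R) s).
{ cont. }
(* For [h = PI / r], [N h] dominates twice the integral: the first term is the difference from the
   translate, the other two are the masses of [psi] on [[- h, 0]] and [[c - h, c]]. It is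
   complex-valued so that the continuity lemmas for [CInt] apply. *)
set (N := fun h : R => (CInt (fun s => RtoC (Cmod (psi s - psi (s - h)%R))) 0 c
  + (- CInt m 0 (0 - h) - CInt m c (c - h)))%C).
assert (HN : ccont N 0).
{ apply ccont_plus; [| apply ccont_minus; [apply ccont_opp |]].
  - apply (ccont_CInt_param (fun h s => RtoC (Cmod (psi s - psi (s - h)%R)))).
    + cont.
    + cont.
  - apply (continuous_comp (fun h => 0 - h) (fun r => CInt m 0 r)).
    + cont.
    + now apply ccont_CInt_bound.
  - apply (continuous_comp (fun h => c - h) (fun r => CInt m c r)).
    + cont.
    + now apply ccont_CInt_bound. }
assert (HN0 : N 0 = 0%C).
{ unfold N; rewrite !Rminus_0_r, !CInt_point, (CInt_ext _ (fun _ => RtoC 0)); [rewrite CInt_zero; ring | exact Hc |].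
  intros t _; rewrite Rminus_0_r; replace (psi t - psi t)%C with (RtoC 0) by ring; now rewrite Cmod_0. }
destruct (proj1 (ccont_eps _ _) HN (mkposreal e He)) as [d Hd]; simpl in Hd.
pose proof (cond_pos d) as Hd0.
exists (2 * PI / d); pose proof PI_RGT_0 as Hpi.
assert (HR0 : 0 < 2 * PI / d) by (apply Rdiv_lt_0_compat; lra).
split; [exact HR0 |]; intros r Hr.
set (h := PI / r); assert (Hh : 0 < h) by (apply Rdiv_lt_0_compat; lra).
assert (Hhd : h < d).
{ assert (Hq : 2 * PI <= r * d).
  { replace (2 * PI) with (2 * PI / d * d) by (field; lra); apply Rmult_le_compat_r; lra. }
  unfold h; apply Rmult_lt_reg_r with r; [lra |].
  replace (PI / r * r) with PI by (field; lra); lra. }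
assert (HNh : Cmod (N h) < e).
{ replace (N h) with (N h - N 0)%C by (rewrite HN0; ring).
  apply Hd; change (Rabs (h - 0) < d); rewrite Rminus_0_r, Rabs_pos_eq; lra. }
set (g := fun s : R => (psi s * sin (r * s)%R)%C).
assert (Hsin : forall s, ccont (fun s => RtoC (sin (r * s))) s).
{ cont. }
assert (Hg : forall s, ccont g s) by (intros; apply ccont_mult; [apply Hpsi | apply Hsin]).
(* Since [sin (r (s - h)) = - sin (r s)], this is [g s + g (s - h)]: the translate reinforces
   [g]. *)
set (k := fun s : R => ((psi s - psi (s - h)%R) * sin (r * s)%R)%C).
assert (Hk : forall s, ccont k s).
{ intros s; apply ccont_mult; [apply ccont_minus; [apply Hpsi | apply Hpsih] | apply Hsin]. }
assert (HI : CInt k 0 c = (2 * CInt g 0 c + CInt g (0 - h) 0 - CInt g (c - h) c)%C).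
{ assert (Hgh : CInt (fun s => g (- h + s)%R) 0 c = CInt g (- h) (- h + c)) by now apply CInt_shift.
  rewrite (CInt_ext k (fun s => (g s + g (- h + s)%R)%C)); [| exact Hc |].
  - rewrite CInt_plus; [| exact Hg |].
    + rewrite Hgh.
      rewrite <- (CInt_Chasles g (- h) 0 (- h + c)), <- (CInt_Chasles g 0 c (- h + c)) by exact Hg.
      replace (- h + c) with (c - h) by ring; rewrite (CInt_swap g c (c - h)) by exact Hg.
      rewrite Rminus_0_l; ring.
    + cont.
  - intros s _; unfold k, g.
    replace (- h + s) with (s - h) by ring.
    replace (r * (s - h)) with (r * s - PI) by (unfold h; field; lra).
    rewrite sin_minus, cos_PI, sin_PI.
    replace (sin (r * s) * -1 - cos (r * s) * 0) with (- sin (r * s)) by ring.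
    rewrite RtoC_opp; ring. }
assert (HNn : Cmod (CInt k 0 c) + Cmod (CInt g (0 - h) 0) + Cmod (CInt g (c - h) c) <= Cmod (N h)).
{ unfold N.
  assert (Hre : forall (f : R -> C) a b, a <= b -> (forall s, ccont f s) ->
    exists v, 0 <= v /\ CInt (fun s => RtoC (Cmod (f s))) a b = RtoC v).
  { intros f a b Hab Hf; exists (RInt (fun s => Cmod (f s)) a b); split.
    - apply RInt_ge_0; [exact Hab | |].
      + apply (ex_RInt_continuous (V := R_CompleteNormedModule)); intros; apply continuous_Cmod, Hf.
      + intros; apply Cmod_ge_0.
    - rewrite CInt_pair by cont.
      apply C_ext; [reflexivity |]; simpl.
      rewrite (RInt_const (V := R_CompleteNormedModule)); apply Rmult_0_r. }
  rewrite <- (CInt_swap m (0 - h) 0) by exact Hm.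
  replace (CInt m (0 - h) 0 - CInt m c (c - h))%C with (CInt m (0 - h) 0 + CInt m (c - h) c)%C
    by (rewrite (CInt_swap m c (c - h)) by exact Hm; ring).
  assert (Hkh : forall s, ccont (fun s => (psi s - psi (s - h)%R)%C) s)
    by cont.
  assert (Hsb : forall (z : C) s, Cmod (z * sin (r * s)%R) <= Cmod z).
  { intros z s; rewrite Cmod_mult, Cmod_R.
    assert (Rabs (sin (r * s)) <= 1) by (apply Rabs_le, SIN_bound).
    pose proof (Cmod_ge_0 z); nra. }
  assert (L1 : Cmod (CInt k 0 c) <= Cmod (CInt (fun s => RtoC (Cmod (psi s - psi (s - h)%R))) 0 c)).
  { apply (Cmod_CInt_le_mod k (fun s => (psi s - psi (s - h)%R)%C)); trivial; intros; apply Hsb. }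
  assert (L2 : Cmod (CInt g (0 - h) 0) <= Cmod (CInt m (0 - h) 0)).
  { apply (Cmod_CInt_le_mod g psi); trivial; [lra |]; intros; apply Hsb. }
  assert (L3 : Cmod (CInt g (c - h) c) <= Cmod (CInt m (c - h) c)).
  { apply (Cmod_CInt_le_mod g psi); trivial; [lra |]; intros; apply Hsb. }
  destruct (Hre _ 0 c Hc Hkh) as [v1 [V1 E1]].
  destruct (Hre psi (0 - h) 0 ltac:(lra) Hpsi) as [v2 [V2 E2]].
  destruct (Hre psi (c - h) c ltac:(lra) Hpsi) as [v3 [V3 E3]].
  fold m in E2, E3; cbv beta in E1; rewrite E1 in *; rewrite E2 in *; rewrite E3 in *.
  rewrite <- !RtoC_plus; rewrite Cmod_R, Rabs_pos_eq in * by lra; lra. }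
assert (H2 : (2 * CInt g 0 c)%C = (CInt k 0 c - CInt g (0 - h) 0 + CInt g (c - h) c)%C)
  by (rewrite HI; ring).
assert (H3 : Cmod (2 * CInt g 0 c) <= Cmod (N h)).
{ rewrite H2; eapply Rle_trans; [apply Cmod_triangle |].
  eapply Rle_trans; [apply Rplus_le_compat_r, Cmod_minus_le | exact HNn]. }
rewrite Cmod_mult, Cmod_R, Rabs_pos_eq in H3 by lra.
pose proof (Cmod_ge_0 (CInt g 0 c)).
fold g; lra.
Qed.

(** The Dirichlet kernel [2 sin (r s) / s], written as an integral so that it has its natural value
    at [s = 0]. *)
Definition dirichlet (r s : R) : C := CInt (fun u => Cexp (Ci * u * s)) (- r) r.

Lemma continuous_RtoC_fst (p : R * R) : ccont (fun p : R * R => RtoC (fst p)) p.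
Proof. cont. Qed.

Lemma continuous_RtoC_snd (p : R * R) : ccont (fun p : R * R => RtoC (snd p)) p.
Proof. cont. Qed.

Lemma ccont_RtoC_id (x : R) : ccont RtoC x.
Proof. cont. Qed.

Lemma ccont_dirichlet (r s : R) : ccont (dirichlet r) s.
Proof.
apply (ccont_CInt_param (fun s u : R => Cexp (Ci * u * s))).
- cont.
- cont.
Qed.

Lemma Cexp_imag (a b : R) : Cexp (Ci * a * b) = (cos (a * b), sin (a * b)).
Proof.
unfold Cexp; reim.
replace ((0 * a - 1 * 0) * b - (0 * 0 + 1 * a) * 0) with 0 by ring.
replace ((0 * a - 1 * 0) * 0 + (0 * 0 + 1 * a) * b) with (a * b) by ring.
rewrite exp_0; f_equal; ring.
Qed.

Lemma dirichlet_eq (r s : R) : 0 <= r -> (s * dirichlet r s)%C = (2 * sin (r * s)%R)%C.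
Proof.
intros Hr; unfold dirichlet.
assert (Hc : forall u : R, ccont (fun u : R => Cexp (Ci * u * s)) u).
{ cont. }
rewrite <- CInt_mult by exact Hc.
rewrite (CInt_FTC (fun u : R => (- Ci * Cexp (Ci * u * s))%C)).
- rewrite !Cexp_imag.
  replace (- r * s) with (- (r * s)) by ring; rewrite cos_neg, sin_neg.
  apply C_ext; simpl; ring.
- lra.
- cont.
- cont.
- intros u _; eapply cderive_eq.
  + apply cderive_mult; [apply cderive_const |].
    apply cderive_Cexp, cderive_mult; [| apply cderive_const].
    apply cderive_mult; [apply cderive_const | apply cderive_id].
  + cbv beta; replace (RtoC 0 * Cexp (Ci * u * s) + - Ci * (Cexp (Ci * u * s) * ((0 * u + Ci * 1) * s + Ci * u * 0)))%C
      with (- (Ci * Ci) * (s * Cexp (Ci * u * s)))%C by ring.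
    rewrite Ci_sqr; ring.
Qed.

Lemma dirichlet_even (r s : R) : 0 <= r -> dirichlet r (- s) = dirichlet r s.
Proof.
intros Hr; destruct (Req_dec s 0) as [-> | Hs]; [f_equal; ring |].
assert (Hs' : RtoC s <> 0%C) by now apply RtoC_neq_0.
pose proof (dirichlet_eq r s Hr) as H1; pose proof (dirichlet_eq r (- s) Hr) as H2.
replace (r * - s) with (- (r * s)) in H2 by ring; rewrite sin_neg, !RtoC_opp in H2.
replace (dirichlet r (- s)) with (/ s * (s * dirichlet r (- s)))%C by (field; exact Hs').
replace (s * dirichlet r (- s))%C with (- (- s * dirichlet r (- s)))%C by ring.
rewrite H2; replace (- (2 * - sin (r * s)))%C with (2 * sin (r * s)%R)%C by ring.
rewrite <- H1; field; exact Hs'.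
Qed.

(* The transform of [exp (- s)] on [[0, L]] is [(1 - exp ((i u - 1) L)) / (1 - i u)]. *)
Lemma dirichlet_exp_limit (r L : R) : 0 < r -> 0 < L ->
  Cmod (2 * atan r - CInt (fun s => (exp (- s) * dirichlet r s)%C) 0 L) <= 2 * r * exp (- L).
Proof.
intros Hr HL.
set (f := fun u s : R => Cexp ((Ci * u - 1) * s)).
assert (Hf : forall u t, ccont (fun p : R * R => f (fst p) (snd p)) (u, t)).
{ intros u t; apply ccont_Cexp, ccont_mult; [| apply continuous_RtoC_snd].
  apply ccont_minus; [| apply ccont_const].
  apply ccont_mult; [apply ccont_const | apply continuous_RtoC_fst]. }
assert (Hn : forall u : R, (Ci * u - 1)%C <> 0%C).
{ intros u E; apply (f_equal Re) in E; reim_in E; lra. }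
rewrite (CInt_ext _ (fun s => CInt (fun u => f u s) (- r) r)); [| lra |].
2:{ intros s _; unfold dirichlet; rewrite <- CInt_mult.
    - apply CInt_ext; [lra |]; intros u _; unfold f.
      replace ((Ci * u - 1) * s)%C with (RtoC (- s) + Ci * u * s)%C by (rewrite RtoC_opp; ring).
      rewrite Cexp_plus; f_equal; unfold Cexp; apply C_ext; simpl; rewrite ?cos_0, ?sin_0; ring.
    - cont. }
rewrite <- (CInt_exchange f Hf) by lra.
assert (Hlin : forall u, ccont (fun u : R => (Ci * u - 1)%C) u).
{ cont. }
assert (Hinv : forall u, ccont (fun u : R => (/ (Ci * u - 1))%C) u).
{ intros u; apply ccont_inv; [apply Hlin | apply Hn]. }
assert (HeL : forall u, ccont (fun u : R => Cexp ((Ci * u - 1) * L)) u).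
{ cont. }
rewrite (CInt_ext _ (fun u => (Cexp ((Ci * u - 1) * L) * / (Ci * u - 1) - / (Ci * u - 1))%C)); [| lra |].
2:{ intros u _; rewrite (CInt_FTC (fun s : R => (Cexp ((Ci * u - 1) * s) * / (Ci * u - 1))%C)).
    - rewrite Cmult_0_r, Cexp_0; ring.
    - lra.
    - cont.
    - intros s; apply (ccont_2d_r f Hf).
    - intros s _; eapply cderive_eq;
        [apply cderive_mult; [apply cderive_Cexp_lin | apply cderive_const] |].
      cbv beta; unfold f; field; apply Hn. }
rewrite CInt_minus; [| intros; apply ccont_mult; auto | exact Hinv].
assert (Hat : CInt (fun u : R => / (Ci * u - 1))%C (- r) r = (- (2 * atan r))%C).
{ assert (HF : forall u : R, cderive (fun u => (- atan u, - (ln (1 + u ^ 2) / 2))) u (/ (Ci * u - 1))%C).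
  { intros u; apply cderive_iff; split; simpl.
    + evar_last; [apply Rderive_opp, is_derive_Reals, derivable_pt_lim_atan |].
      unfold Rsqr; field; nra.
    + auto_derive; [nra |]; field; nra. }
  rewrite (CInt_FTC (fun u => (- atan u, - (ln (1 + u ^ 2) / 2)))).
  - rewrite atan_opp; apply C_ext; simpl; [ring |].
    replace (- r * (- r * 1)) with (r * (r * 1)) by ring; ring.
  - lra.
  - intros s _; eapply cderive_ccont, HF.
  - exact Hinv.
  - intros u _; apply HF. }
rewrite Hat.
replace (2 * atan r - (CInt (fun u : R => (Cexp ((Ci * u - 1) * L) * / (Ci * u - 1))%C) (- r) r - - (2 * atan r)))%C
  with (- CInt (fun u : R => (Cexp ((Ci * u - 1) * L) * / (Ci * u - 1))%C) (- r) r)%C by ring.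
rewrite Cmod_opp.
replace (2 * r * exp (- L)) with ((r - - r) * exp (- L)) by ring.
apply Cmod_CInt_le_const; [lra | intros; apply ccont_mult; auto |].
intros u _; rewrite Cmod_mult, Cmod_Cexp, Cmod_inv by apply Hn.
replace (Re ((Ci * u - 1) * L)) with (- L) by (reim; ring).
assert (H1 : 1 <= Cmod (Ci * u - 1)).
{ apply Rle_trans with (2 := re_le_Cmod _); reim.
  replace (0 * u - 1 * 0 - 1) with (- (1)) by ring; rewrite Rabs_Ropp, Rabs_R1; lra. }
rewrite <- (Rmult_1_r (exp (- L))) at 2; apply Rmult_le_compat_l; [apply Rlt_le, exp_pos |].
apply Rle_trans with (/ 1); [apply Rinv_le_contravar; lra | lra].
Qed.

(* By parts: [sin (r s)] integrates to [- cos (r s) / r] against the decreasing [2 exp (- s) / s]. *)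
Lemma dirichlet_exp_tail (r c L : R) : 0 < r -> 0 < c -> c <= L ->
  Cmod (CInt (fun s => (exp (- s) * dirichlet r s)%C) c L) <= 2 * (2 * exp (- c) / c) / r.
Proof.
intros Hr Hc HL.
set (f := fun s => 2 * exp (- s) / s).
set (I := fun s => CInt (fun s => (exp (- s) * dirichlet r s)%C) c s).
assert (Hker : forall s, ccont (fun s => (exp (- s) * dirichlet r s)%C) s).
{ intros s; apply ccont_mult; [| apply ccont_dirichlet].
  apply ccont_RtoC, (continuous_comp (fun s => - s) exp); [| apply continuous_exp].
  apply (continuous_opp (V := R_NormedModule)), continuous_id. }
assert (Hf' : forall s, 0 < s -> is_derive f s (- (f s * (1 + / s)))).
{ intros s Hs; unfold f; auto_derive; [lra |]; field; lra. }
assert (Hfc : forall s, 0 < s -> is_derive (fun s => f s * cos (r * s) / r) s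
  (- (f s * (1 + / s)) * cos (r * s) / r - f s * sin (r * s))).
{ intros s Hs; unfold f; auto_derive; [lra |]; field; lra. }
assert (Hfp : forall s, 0 < s -> 0 < f s).
{ intros s Hs; unfold f; apply Rdiv_lt_0_compat; [pose proof (exp_pos (- s)); lra | exact Hs]. }
assert (HP : Cmod ((I L + (f L * cos (r * L) / r)%R) - (I c + (f c * cos (r * c) / r)%R))
  <= - (f L / r) - - (f c / r)).
{ apply (cderive_mean_value (fun s => (I s + (f s * cos (r * s) / r)%R)%C)
    (fun s => RtoC (- (f s * (1 + / s)) * cos (r * s) / r))
    (fun s => - (f s / r)) (fun s => f s * (1 + / s) / r)); trivial.
  - intros s Hs; apply ccont_plus; [now apply ccont_CInt_bound |].
    eapply cderive_ccont, cderive_RtoC, Hfc; lra.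
  - intros s Hs; apply (ex_derive_continuous (V := R_NormedModule)).
    assert (Hs0 : 0 < s) by lra; specialize (Hf' s Hs0).
    exists (- (- (f s * (1 + / s)) * / r)).
    apply Rderive_opp; evar_last; [exact (Rderive_mult _ _ _ _ _ Hf' (is_derive_const (V := R_NormedModule) (/ r) s)) |].
    unfold zero; simpl; ring.
  - intros s Hs; eapply cderive_eq.
    + apply cderive_plus; [now apply cderive_CInt |].
      apply (cderive_RtoC (fun s => f s * cos (r * s) / r)), Hfc; lra.
    + assert (Hs' : RtoC s <> 0%C) by (apply RtoC_neq_0; lra).
      replace (dirichlet r s) with (/ s * (s * dirichlet r s))%C by (field; exact Hs').
      rewrite dirichlet_eq by lra.
      rewrite <- RtoC_inv by lra; rewrite <- !RtoC_mult, <- RtoC_plus.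
      f_equal; unfold f; field; lra.
  - intros s Hs; assert (Hs0 : 0 < s) by lra; specialize (Hf' s Hs0).
    evar_last;
      [apply Rderive_opp; exact (Rderive_mult _ _ _ _ _ Hf' (is_derive_const (V := R_NormedModule) (/ r) s)) |].
    unfold zero; simpl; field; lra.
  - intros s Hs; assert (Hs0 : 0 < s) by lra; specialize (Hfp s Hs0).
    assert (0 < / s) by now apply Rinv_0_lt_compat.
    rewrite Cmod_R; unfold Rdiv; rewrite !Rabs_mult, Rabs_Ropp, Rabs_mult.
    rewrite (Rabs_pos_eq (f s)), (Rabs_pos_eq (1 + / s)), (Rabs_pos_eq (/ r))
      by (try apply Rlt_le, Rinv_0_lt_compat; lra).
    apply Rmult_le_compat_r; [apply Rlt_le, Rinv_0_lt_compat; lra |].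
    rewrite <- (Rmult_1_r (f s * (1 + / s))) at 2.
    apply Rmult_le_compat_l; [apply Rmult_le_pos; lra |].
    apply Rabs_le, COS_bound. }
assert (Ic : I c = 0%C) by apply CInt_point.
rewrite Ic in HP.
assert (Hb : forall s, 0 < s -> Cmod (RtoC (f s * cos (r * s) / r)) <= f s / r).
{ intros s Hs; specialize (Hfp s Hs); rewrite Cmod_R; unfold Rdiv; rewrite !Rabs_mult.
  rewrite (Rabs_pos_eq (f s)), (Rabs_pos_eq (/ r)) by (try apply Rlt_le, Rinv_0_lt_compat; lra).
  apply Rmult_le_compat_r; [apply Rlt_le, Rinv_0_lt_compat; lra |].
  rewrite <- (Rmult_1_r (f s)) at 2; apply Rmult_le_compat_l; [lra |].
  apply Rabs_le, COS_bound. }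
pose proof (Hb L ltac:(lra)) as HbL; pose proof (Hb c Hc) as Hbc.
assert (EI : I L = (((I L + (f L * cos (r * L) / r)%R) - (0 + (f c * cos (r * c) / r)%R))
   - (RtoC (f L * cos (r * L) / r) - RtoC (f c * cos (r * c) / r)))%C) by ring.
fold (I L); rewrite EI.
eapply Rle_trans; [apply Cmod_minus_le |].
pose proof (Cmod_minus_le (RtoC (f L * cos (r * L) / r)) (RtoC (f c * cos (r * c) / r))).
replace (2 * (2 * exp (- c) / c) / r) with (f c / r + f c / r) by (unfold f; field; lra).
lra.
Qed.

(** The weight [exp (- s)] turns the conditionally convergent integral of [sin s / s] into the
    elementary value [2 atan r]. The integral over [[0, L]] is close to it for large [L], and the
    part beyond [c] is [O(/ r)]. *)
Lemma dirichlet_exp_bound (r c : R) : 0 < r -> 0 < c ->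
  Cmod (2 * atan r - CInt (fun s => (exp (- s) * dirichlet r s)%C) 0 c) <= 2 * (2 * exp (- c) / c) / r.
Proof.
intros Hr Hc; apply le_epsilon; intros e He.
destruct (exp_opp_small 1 (2 * r) e Rlt_0_1 He) as [L0 [HL0 HL]].
set (L := Rmax L0 c); specialize (HL L (Rmax_l _ _)); replace (- (1) * L) with (- L) in HL by ring.
assert (HcL : c <= L) by apply Rmax_r.
pose proof (dirichlet_exp_limit r L Hr ltac:(lra)) as H1.
pose proof (dirichlet_exp_tail r c L Hr Hc HcL) as H2.
assert (Hker : forall s, ccont (fun s => (exp (- s) * dirichlet r s)%C) s).
{ intros s; apply ccont_mult; [| apply ccont_dirichlet].
  apply ccont_RtoC, (continuous_comp (fun s => - s) exp); [| apply continuous_exp].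
  apply (continuous_opp (V := R_NormedModule)), continuous_id. }
rewrite <- (CInt_Chasles _ 0 c L) in H1 by exact Hker.
match goal with |- Cmod (?a - ?x) <= _ => match type of H2 with Cmod ?y <= _ =>
  replace (a - x)%C with (a - (x + y) + y)%C by ring end end.
eapply Rle_trans; [apply Cmod_triangle | lra].
Qed.

Lemma atan_le (y : R) : 0 <= y -> atan y <= y.
Proof.
intros Hy.
destruct (MVT_gen atan 0 y (fun x => / (1 + x²))) as [c [Hc He]].
- intros x _; apply is_derive_atan.
- intros x _; apply continuity_pt_filterlim, continuous_atan.
- rewrite atan_0, !Rminus_0_r in He; rewrite He.
  rewrite <- (Rmult_1_l y) at 2; apply Rmult_le_compat_r; [exact Hy |].
  pose proof (Rle_0_sqr c); rewrite <- Rinv_1 at 2; apply Rinv_le_contravar; lra.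
Qed.

Lemma two_atan_bound (r : R) : 0 < r -> Rabs (2 * atan r - PI) <= 2 / r.
Proof.
intros Hr; pose proof (atan_inv r Hr) as H; pose proof (atan_bound r).
assert (Hi : 0 < / r) by now apply Rinv_0_lt_compat.
pose proof (atan_le (/ r) ltac:(lra)).
rewrite Rabs_left1; unfold Rdiv; lra.
Qed.

Lemma continuous_quotient_at_0 (u : R -> R) (l : R) : u 0 = 0 -> is_derive u 0 l ->
  (forall x, continuous u x) ->
  forall x, continuous (fun s => if Req_EM_T s 0 then l else u s / s) x.
Proof.
intros H0 Hd Hc x; destruct (Req_EM_T x 0) as [-> | Hx].
- apply is_derive_Reals in Hd.
  intros P [eps HP].
  destruct (Hd eps (cond_pos eps)) as [d Hd'].
  exists d; intros y Hy; apply HP.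
  destruct (Req_EM_T 0 0) as [_ | E]; [| now elim E].
  destruct (Req_EM_T y 0) as [-> | E]; [apply ball_center |].
  change (Rabs (y - 0) < d) in Hy; rewrite Rminus_0_r in Hy.
  specialize (Hd' y E Hy); rewrite Rplus_0_l, H0, Rminus_0_r in Hd'; exact Hd'.
- apply (continuous_ext_loc _ (fun s => u s * / s)).
  + assert (Hp : 0 < Rabs x) by now apply Rabs_pos_lt.
    exists (mkposreal _ Hp); intros y Hy; change (Rabs (y - x) < Rabs x) in Hy.
    destruct (Req_EM_T y 0) as [-> | E]; [| reflexivity].
    rewrite Rminus_0_l, Rabs_Ropp in Hy; lra.
  + apply (continuous_mult (K := R_AbsRing)); [apply Hc |].
    apply continuous_Rinv_comp; [apply continuous_id | exact Hx].
Qed.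

(** One derivative at 0 suffices to divide out the zero and keep the quotient continuous. *)
Lemma factor_at_0 (q : R -> C) (l : C) : q 0 = 0%C -> cderive q 0 l -> (forall x, ccont q x) ->
  exists psi : R -> C, (forall x, ccont psi x) /\ forall s, q s = (s * psi s)%C.
Proof.
intros H0 Hd Hc; apply cderive_iff in Hd; destruct Hd as [D1 D2].
exists (fun s => (if Req_EM_T s 0 then Re l else Re (q s) / s,
  if Req_EM_T s 0 then Im l else Im (q s) / s)); split.
- intros x; apply ccont_iff; split.
  + apply (continuous_quotient_at_0 (fun s => Re (q s))); [now rewrite H0 | exact D1 |].
    intros y; apply (proj1 (ccont_iff _ _) (Hc y)).
  + apply (continuous_quotient_at_0 (fun s => Im (q s))); [now rewrite H0 | exact D2 |].
    intros y; apply (proj1 (ccont_iff _ _) (Hc y)).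
- intros s; destruct (Req_EM_T s 0) as [-> | E].
  + rewrite H0; ring.
  + apply C_ext; reim; field; exact E.
Qed.

(** Split [phi s] as [(phi s - exp (- s) phi 0) + exp (- s) phi 0]. The first part is [s psi s],
    which turns the kernel into [2 sin (r s)] and falls to [riemann_lebesgue]; the second
    contributes [2 atan r * phi 0], which tends to [PI * phi 0]. *)
Lemma dirichlet_limit (phi : R -> C) (l : C) (c e : R) : 0 < c -> 0 < e ->
  (forall x, ccont phi x) -> cderive phi 0 l ->
  exists R0, 0 < R0 /\ forall r, R0 <= r ->
    Cmod (CInt (fun s => (phi s * dirichlet r s)%C) 0 c - PI * phi 0) < e.
Proof.
intros Hc He Hphi Hd.
assert (Hexp : forall s, ccont (fun s => RtoC (exp (- s))) s).
{ cont. }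
assert (Dexp : cderive (fun s => RtoC (exp (- s))) 0 (RtoC (- (1)))).
{ apply cderive_RtoC; auto_derive; trivial; rewrite Ropp_0, exp_0; ring. }
destruct (factor_at_0 (fun s => (phi s - exp (- s) * phi 0)%C) (l + phi 0)%C) as [psi [Hpsi Hq]].
- rewrite Ropp_0, exp_0; ring.
- eapply cderive_eq; [apply cderive_minus; [exact Hd | apply cderive_mult; [exact Dexp | apply cderive_const]] |].
  cbv beta; rewrite RtoC_opp; ring.
- cont.
- assert (He4 : 0 < e / 4) by lra.
  destruct (riemann_lebesgue psi c (e / 4) (Rlt_le _ _ Hc) He4 Hpsi) as [R1 [HR1 HR]].
  set (K := 2 * (2 * exp (- c) / c)).
  assert (HK : 0 <= K).
  { unfold K; apply Rmult_le_pos; [lra |]; apply Rdiv_le_0_compat; [| exact Hc].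
    pose proof (exp_pos (- c)); lra. }
  set (m := Cmod (phi 0)); assert (Hm : 0 <= m) by apply Cmod_ge_0.
  (* Beyond [R2] the errors [m K / r] of [dirichlet_exp_bound] and [2 m / r] of [two_atan_bound] add
     up to at most [e / 4]. *)
  set (R2 := 4 * (m * (K + 2) + 1) / e).
  assert (Hmk : 0 <= m * (K + 2)) by (apply Rmult_le_pos; lra).
  assert (HR2 : 0 < R2) by (apply Rdiv_lt_0_compat; lra).
  exists (R1 + R2); split; [lra |]; intros r Hr.
  assert (Hr0 : 0 < r) by lra.
  specialize (HR r ltac:(lra)).
  assert (HE : CInt (fun s => (phi s * dirichlet r s)%C) 0 c =
    (phi 0 * CInt (fun s => (exp (- s) * dirichlet r s)%C) 0 c
     + 2 * CInt (fun s => (psi s * sin (r * s)%R)%C) 0 c)%C).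
  { rewrite <- !CInt_mult, <- CInt_plus.
    - apply CInt_ext; [lra |]; intros s _.
      replace (phi s) with ((phi s - exp (- s) * phi 0) + exp (- s) * phi 0)%C by ring.
      rewrite Hq.
      replace ((s * psi s + exp (- s) * phi 0) * dirichlet r s)%C
        with (psi s * (s * dirichlet r s) + exp (- s) * phi 0 * dirichlet r s)%C by ring.
      rewrite dirichlet_eq by lra; ring.
    - intros z; apply ccont_mult; [apply ccont_const |]; apply ccont_mult; [apply Hexp | apply ccont_dirichlet].
    - cont.
    - cont.
    - intros z; apply ccont_mult; [apply Hexp | apply ccont_dirichlet]. }
  rewrite HE.
  pose proof (dirichlet_exp_bound r c Hr0 Hc) as Hb; fold K in Hb.
  pose proof (two_atan_bound r Hr0) as Ha.
  set (J := CInt (fun s => (exp (- s) * dirichlet r s)%C) 0 c) in *.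
  set (S := CInt (fun s => (psi s * sin (r * s)%R)%C) 0 c) in *.
  replace (phi 0 * J + 2 * S - PI * phi 0)%C
    with (- (phi 0 * (2 * atan r - J)) + phi 0 * (RtoC (2 * atan r - PI)) + 2 * S)%C
    by (rewrite RtoC_minus, RtoC_mult; ring).
  eapply Rle_lt_trans; [apply Cmod_triangle |].
  eapply Rle_lt_trans; [apply Rplus_le_compat_r, Cmod_triangle |].
  rewrite Cmod_opp, !Cmod_mult, !Cmod_R, (Rabs_pos_eq 2) by lra; fold m.
  assert (Hr2 : m * (K + 2) / r <= e / 4).
  { apply Rmult_le_reg_l with r; [exact Hr0 |].
    replace (r * (m * (K + 2) / r)) with (m * (K + 2)) by (field; lra).
    assert (Hx : R2 * (e / 4) = m * (K + 2) + 1) by (unfold R2; field; lra).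
    assert (R2 * (e / 4) <= r * (e / 4)) by (apply Rmult_le_compat_r; lra); lra. }
  assert (H1 : m * Cmod (2 * atan r - J) <= m * (K / r)) by (apply Rmult_le_compat_l; lra).
  assert (H2 : m * Rabs (2 * atan r - PI) <= m * (2 / r)) by (apply Rmult_le_compat_l; lra).
  replace (m * (K + 2) / r) with (m * (K / r) + m * (2 / r)) in Hr2 by (field; lra).
  lra.
Qed.

(** After exchanging the integrals the kernel is centred at [t]; by evenness each of [[0, t]] and
    [[t, T]] contributes [PI * phi t]. *)
Lemma fourier_inversion (phi : R -> C) (l : C) (T t e : R) : 0 < t < T -> 0 < e ->
  (forall x, ccont phi x) -> cderive phi t l ->
  exists R0, 0 < R0 /\ forall r, R0 <= r ->
    Cmod (CInt (fun u => CInt (fun s => (Cexp (Ci * u * (s - t)%R) * phi s)%C) 0 T) (- r) r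
      - 2 * PI * phi t) < e.
Proof.
intros Ht He Hphi Hd.
assert (He2 : 0 < e / 2) by lra.
assert (Dp : cderive (fun s => phi (t + s)) 0 l).
{ eapply cderive_eq.
  - apply (is_derive_comp (K := R_AbsRing) (V := C_R_NormedModule) phi (fun s => t + s) 0 l 1).
    + rewrite Rplus_0_r; exact Hd.
    + auto_derive; trivial; ring.
  - rewrite scal_RtoC; ring. }
assert (Dm : cderive (fun s => phi (t - s)) 0 (- l)%C).
{ eapply cderive_eq.
  - apply (is_derive_comp (K := R_AbsRing) (V := C_R_NormedModule) phi (fun s => t - s) 0 l (-1)).
    + rewrite Rminus_0_r; exact Hd.
    + auto_derive; trivial; ring.
  - rewrite scal_RtoC; ring. }
assert (Cp : forall x, ccont (fun s => phi (t + s)) x).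
{ cont. }
assert (Cm : forall x, ccont (fun s => phi (t - s)) x).
{ cont. }
destruct (dirichlet_limit _ _ (T - t) (e / 2) ltac:(lra) He2 Cp Dp) as [R1 [HR1 H1]].
destruct (dirichlet_limit _ _ t (e / 2) ltac:(lra) He2 Cm Dm) as [R2 [HR2 H2]].
exists (R1 + R2); split; [lra |]; intros r Hr.
specialize (H1 r ltac:(lra)); specialize (H2 r ltac:(lra)).
rewrite Rplus_0_r in H1; rewrite Rminus_0_r in H2.
assert (Hmin : forall s, continuous (fun s => s - t) s).
{ cont. }
set (f := fun u s : R => (Cexp (Ci * u * (s - t)%R) * phi s)%C).
assert (Hf : forall u s, ccont (fun p : R * R => f (fst p) (snd p)) (u, s)).
{ intros u s; apply ccont_mult.
  - cont.
  - cont. }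
fold f; rewrite (CInt_exchange f Hf) by lra.
set (g := fun s : R => (phi s * dirichlet r (s - t)%R)%C).
assert (Hg : forall s, ccont g s).
{ intros s; apply ccont_mult; [apply Hphi |].
  apply (continuous_comp (fun s => s - t) (dirichlet r)); [apply Hmin | apply ccont_dirichlet]. }
rewrite (CInt_ext _ g); [| lra |].
2:{ intros s _; unfold f, g, dirichlet; rewrite <- CInt_mult.
    - apply CInt_ext; [lra |]; intros u _; ring.
    - cont. }
rewrite <- (CInt_Chasles g 0 t T Hg).
assert (E1 : CInt g t T = CInt (fun s => (phi (t + s)%R * dirichlet r s)%C) 0 (T - t)).
{ replace T with (t + (T - t)) at 1 by ring; rewrite <- CInt_shift; [| lra | exact Hg].
  apply CInt_ext; [lra |]; intros s _; unfold g; do 2 f_equal; ring. }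
assert (E2 : CInt g 0 t = CInt (fun s => (phi (t - s)%R * dirichlet r s)%C) 0 t).
{ replace 0 with (t - t) at 1 by ring; rewrite <- CInt_reflect; [| lra | exact Hg].
  apply CInt_ext; [lra |]; intros s _; unfold g.
  rewrite <- (dirichlet_even r s) by lra; do 2 f_equal; ring. }
rewrite E1, E2.
match goal with |- Cmod (?a + ?b - _) < _ =>
  replace (a + b - 2 * PI * phi t)%C with ((a - PI * phi t) + (b - PI * phi t))%C by ring end.
eapply Rle_lt_trans; [apply Cmod_triangle | lra].
Qed.

(** * Decay of transforms and the time cutoff *)

Lemma Cmod_kernel (z : C) (s : R) : Cmod (Cexp (Ci * z * s)) = exp (- (Im z * s)).
Proof. rewrite Cmod_Cexp; f_equal; reim; ring. Qed.

Lemma exp_le (a b : R) : a <= b -> exp a <= exp b.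
Proof. intros [H | ->]; [left; now apply exp_increasing | apply Rle_refl]. Qed.

Section by_parts.
Variable z : C.
Hypothesis Hz : 0 <= Im z.

Lemma Cmod_kernel_le (a s : R) : a <= s -> Cmod (Cexp (Ci * z * s)) <= exp (- (Im z * a)).
Proof. intros H; rewrite Cmod_kernel; apply exp_le; nra. Qed.

Lemma ccont_kernel_at (f : R -> C) (s : R) : ccont f s -> ccont (fun s : R => (Cexp (Ci * z * s) * f s)%C) s.
Proof. cont. Qed.

Lemma CInt_by_parts (h h' : R -> C) (a b : R) : a <= b ->
  (forall s, ccont h s) -> (forall s, ccont h' s) ->
  (forall s, a < s < b -> cderive h s (h' s)) ->
  (Ci * z * CInt (fun s : R => (Cexp (Ci * z * s) * h s)%C) a b)%C =
  (Cexp (Ci * z * b) * h b - Cexp (Ci * z * a) * h a - CInt (fun s : R => (Cexp (Ci * z * s) * h' s)%C) a b)%C.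
Proof.
intros Hab Hh Hh' Hd.
assert (H := CInt_FTC (fun s : R => (Cexp (Ci * z * s) * h s)%C)
  (fun s : R => (Ci * z * (Cexp (Ci * z * s) * h s) + Cexp (Ci * z * s) * h' s)%C) a b Hab).
rewrite <- H.
- rewrite CInt_plus, CInt_mult.
  + ring.
  + cont.
  + cont.
  + cont.
- cont.
- cont.
- intros s Hs; eapply cderive_eq; [apply cderive_mult; [apply cderive_Cexp_lin | now apply Hd] |].
  cbv beta; ring.
Qed.

(** Each integration by parts moves one derivative onto [Y] and gains [/ |z|]; the boundary terms
    vanish because all derivatives do at [0] and [T]. *)
Lemma kernel_decay_flat (Y : nat -> R -> C) (N : nat) (T K : R) : 0 <= T ->
  (forall l s, (l <= N)%nat -> ccont (Y l) s) ->
  (forall l s, (l <= N)%nat -> Cmod (Y l s) <= K) ->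
  (forall l s, (l < N)%nat -> 0 < s < T -> cderive (Y l) s (Y (S l) s)) ->
  (forall l, (l <= N)%nat -> Y l 0 = 0%C /\ Y l T = 0%C) ->
  forall n l, (n + l <= N)%nat -> Cmod z ^ n * Cmod (lap (Y l) T z) <= T * K.
Proof.
intros HT Hc HK Hd H0; induction n as [| n IH]; intros l Hl.
- rewrite Rmult_1_l; unfold lap; replace (T * K) with ((T - 0) * K) by ring.
  apply Cmod_CInt_le_const; trivial.
  + cont.
  + intros s Hs; rewrite Cmod_mult, <- (Rmult_1_l K).
    apply Rmult_le_compat; try apply Cmod_ge_0; [| apply HK; lia].
    eapply Rle_trans; [apply (Cmod_kernel_le 0 s); lra |].
    rewrite Rmult_0_r, Ropp_0, exp_0; lra.
- assert (E : (Ci * z * lap (Y l) T z)%C = (- lap (Y (S l)) T z)%C).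
  { unfold lap; rewrite (CInt_by_parts (Y l) (Y (S l))); trivial.
    - destruct (H0 l ltac:(lia)) as [-> ->]; ring.
    - intros; apply Hc; lia.
    - intros; apply Hc; lia.
    - intros; apply Hd; [lia | assumption]. }
  apply (f_equal Cmod) in E; rewrite Cmod_opp, !Cmod_mult, Cmod_Ci, Rmult_1_l in E.
  simpl; replace (Cmod z * Cmod z ^ n * Cmod (lap (Y l) T z))
    with (Cmod z ^ n * (Cmod z * Cmod (lap (Y l) T z))) by ring.
  rewrite E; apply IH; lia.
Qed.

Definition bump (a b : R) (i j : nat) (s : R) : R := (s - a) ^ i * (b - s) ^ j.

(** When [i = 0] or [j = 0] the factor [INR] removes the term in which [pred] stays at 0, so the
    family is closed under differentiation. *)
Lemma is_derive_bump (a b : R) (i j : nat) (s : R) :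
  is_derive (bump a b i j) s (INR i * bump a b (pred i) j s - INR j * bump a b i (pred j) s).
Proof. unfold bump; auto_derive; trivial; unfold Rminus; ring. Qed.

Lemma continuous_bump (a b : R) (i j : nat) (s : R) : continuous (bump a b i j) s.
Proof.
apply (ex_derive_continuous (V := R_NormedModule)); eexists; apply is_derive_bump.
Qed.

(** The bump supplies the vanishing at both ends that [Y] itself lacks, as long as its exponents are
    at least the number [n] of integrations by parts. One step produces three integrals with
    coefficients [i], [j] and 1, whence [(1 + 2 m)^n]; the integrand starts at [a], whence the
    exponential. *)
Lemma kernel_decay_bump (Y : nat -> R -> C) (N m : nat) (a b K : R) : a <= b ->
  (forall l s, (l <= N)%nat -> ccont (Y l) s) ->
  (forall l s, (l <= N)%nat -> Cmod (Y l s) <= K) ->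
  (forall l s, (l < N)%nat -> a < s < b -> cderive (Y l) s (Y (S l) s)) ->
  forall n i j l, (n <= i <= m)%nat -> (n <= j <= m)%nat -> (n + l <= N)%nat ->
  Cmod z ^ n * Cmod (CInt (fun s : R => (Cexp (Ci * z * s) * (bump a b i j s * Y l s))%C) a b)
  <= (1 + 2 * INR m) ^ n * ((b - a) * ((1 + (b - a)) ^ m * (1 + (b - a)) ^ m * K)) * exp (- (Im z * a)).
Proof.
intros Hab Hc HK Hd.
assert (Hcb : forall i j l s, (l <= N)%nat -> ccont (fun s => (bump a b i j s * Y l s)%C) s).
{ intros; apply ccont_mult; [apply ccont_RtoC, continuous_bump | now apply Hc]. }
induction n as [| n IH]; intros i j l Hi Hj Hl.
- rewrite !Rmult_1_l, Rmult_assoc.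
  apply Cmod_CInt_le_const; trivial.
  + intros; apply ccont_kernel_at, Hcb; lia.
  + intros s Hs; rewrite Cmod_mult, (Rmult_comm (_ * K)).
    apply Rmult_le_compat; try apply Cmod_ge_0; [apply Cmod_kernel_le; lra |].
    rewrite Cmod_mult; apply Rmult_le_compat; try apply Cmod_ge_0; [| apply HK; lia].
    rewrite Cmod_R; unfold bump; rewrite Rabs_mult.
    assert (Hp : forall u k, 0 <= u <= b - a -> (k <= m)%nat -> Rabs (u ^ k) <= (1 + (b - a)) ^ m).
    { intros u k Hu Hk; rewrite Rabs_pos_eq by (apply pow_le; lra).
      apply Rle_trans with ((1 + (b - a)) ^ k); [apply pow_incr; lra |].
      apply Rle_pow; [lra | exact Hk]. }
    apply Rmult_le_compat; try apply Rabs_pos; apply Hp; try lra; lia.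
- set (I := fun i j l => CInt (fun s : R => (Cexp (Ci * z * s) * (bump a b i j s * Y l s))%C) a b) in *.
  assert (HIc : forall i j l s, (l <= N)%nat -> ccont (fun s : R => (Cexp (Ci * z * s) * (bump a b i j s * Y l s))%C) s).
  { intros; apply ccont_kernel_at, Hcb; assumption. }
  assert (E : (Ci * z * I i j l)%C =
    (- (INR i * I (pred i) j l - INR j * I i (pred j) l + I i j (S l)))%C).
  { unfold I at 1.
    rewrite (CInt_by_parts (fun s => (bump a b i j s * Y l s)%C)
      (fun s => (INR i * (bump a b (pred i) j s * Y l s) - INR j * (bump a b i (pred j) s * Y l s)
         + bump a b i j s * Y (S l) s)%C)); trivial.
    - assert (B : forall s, s = a \/ s = b -> bump a b i j s = 0).
      { intros s [-> | ->]; unfold bump; rewrite Rminus_diag; rewrite pow_i by lia; ring. }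
      rewrite (B b), (B a) by auto.
      rewrite (CInt_ext _ (fun s : R => (INR i * (Cexp (Ci * z * s) * (bump a b (pred i) j s * Y l s))
         - INR j * (Cexp (Ci * z * s) * (bump a b i (pred j) s * Y l s))
         + Cexp (Ci * z * s) * (bump a b i j s * Y (S l) s))%C)); [| exact Hab | intros; ring].
      rewrite CInt_plus, CInt_minus, !CInt_mult.
      + unfold I; ring.
      + intros; apply HIc; lia.
      + intros; apply HIc; lia.
      + intros; apply ccont_mult; [apply ccont_const | apply HIc; lia].
      + intros; apply ccont_mult; [apply ccont_const | apply HIc; lia].
      + intros; apply ccont_minus; (apply ccont_mult; [apply ccont_const | apply HIc; lia]).
      + intros; apply HIc; lia.
    - intros; apply Hcb; lia.
    - intros; apply ccont_plus; [apply ccont_minus |];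
        [apply ccont_mult; [apply ccont_const | apply Hcb; lia]
        |apply ccont_mult; [apply ccont_const | apply Hcb; lia] | apply Hcb; lia].
    - intros s Hs; eapply cderive_eq.
      + apply cderive_mult; [apply cderive_RtoC, is_derive_bump | apply Hd; [lia | exact Hs]].
      + rewrite RtoC_minus, !RtoC_mult; ring. }
  apply (f_equal Cmod) in E; rewrite Cmod_opp, !Cmod_mult, Cmod_Ci, Rmult_1_l in E.
  set (q := (b - a) * ((1 + (b - a)) ^ m * (1 + (b - a)) ^ m * K)) in *.
  assert (H1 := IH (pred i) j l ltac:(lia) ltac:(lia) ltac:(lia)).
  assert (H2 := IH i (pred j) l ltac:(lia) ltac:(lia) ltac:(lia)).
  assert (H3 := IH i j (S l) ltac:(lia) ltac:(lia) ltac:(lia)).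
  fold (I (pred i) j l) in H1; fold (I i (pred j) l) in H2; fold (I i j (S l)) in H3; fold (I i j l).
  assert (Htri : Cmod z * Cmod (I i j l) <= INR m * Cmod (I (pred i) j l) + INR m * Cmod (I i (pred j) l) + Cmod (I i j (S l))).
  { rewrite E; eapply Rle_trans; [apply Cmod_triangle |].
    apply Rplus_le_compat_r; eapply Rle_trans; [apply Cmod_minus_le |].
    rewrite !Cmod_mult, !Cmod_R, !Rabs_pos_eq by apply pos_INR.
    apply Rplus_le_compat; (apply Rmult_le_compat_r; [apply Cmod_ge_0 | apply le_INR; lia]). }
  simpl; replace (Cmod z * Cmod z ^ n * Cmod (I i j l)) with (Cmod z ^ n * (Cmod z * Cmod (I i j l))) by ring.
  pose proof (pow_le _ n (Cmod_ge_0 z)) as Hzn; pose proof (pos_INR m) as Hm.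
  apply Rle_trans with (Cmod z ^ n * (INR m * Cmod (I (pred i) j l) + INR m * Cmod (I i (pred j) l) + Cmod (I i j (S l)))).
  { apply Rmult_le_compat_l; assumption. }
  set (X := (1 + 2 * INR m) ^ n * q * exp (- (Im z * a))) in *.
  replace ((1 + 2 * INR m) * (1 + 2 * INR m) ^ n * q * exp (- (Im z * a))) with (INR m * X + INR m * X + X)
    by (unfold X; ring).
  replace (Cmod z ^ n * (INR m * Cmod (I (pred i) j l) + INR m * Cmod (I i (pred j) l) + Cmod (I i j (S l))))
    with (INR m * (Cmod z ^ n * Cmod (I (pred i) j l)) + INR m * (Cmod z ^ n * Cmod (I i (pred j) l))
      + Cmod z ^ n * Cmod (I i j (S l))) by ring.
  apply Rplus_le_compat; [apply Rplus_le_compat |]; trivial; apply Rmult_le_compat_l; assumption.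
Qed.

End by_parts.

(** * The polynomial time cutoff *)

Lemma continuous_Rmax_0 (x : R) : continuous (Rmax 0) x.
Proof.
apply (continuous_ext (fun u => (u + Rabs u) / 2)).
- assert (E : forall u : R, (u + Rabs u) / 2 = Rmax 0 u); [| exact E].
  intros u; unfold Rmax; destruct (Rle_dec 0 u);
    [rewrite Rabs_pos_eq by lra | rewrite Rabs_left by lra]; field.
- apply (continuous_mult (K := R_AbsRing) (fun u => u + Rabs u) (fun _ => / 2));
    [| apply continuous_const].
  apply (continuous_plus (V := R_NormedModule)); [apply continuous_id |].
  apply continuous_Rabs_comp, continuous_id.
Qed.

(** A normalized primitive of a polynomial bump: its derivative is an explicit [bump] on [[t1, T]],
    flat to a finite order at both ends, which is the form [kernel_decay_bump] treats. *)
Lemma cutoff_exists (t1 T : R) (m : nat) : t1 < T ->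
  exists (chi chi' : R -> R) (I : R), 0 < I /\
    (forall s, is_derive chi s (chi' s)) /\ (forall s, continuous chi' s) /\
    (forall s, s <= t1 -> chi s = 1 /\ chi' s = 0) /\
    (forall s, t1 <= s <= T -> chi' s = - (bump t1 T (S m) (S m) s / I)) /\
    (forall s, t1 <= s <= T -> 0 <= chi s <= 1) /\ chi T = 0.
Proof.
intros Ht.
(* [Rmax 0] switches the bump off to the left of [t1]; the claims stop at [T]. *)
set (p := fun s => Rmax 0 (s - t1) ^ S m * (T - s) ^ S m).
assert (Hp : forall s, continuous p s).
{ intros s.
assert (Hm : continuous (fun s => Rmax 0 (s - t1)) s).
  { apply (continuous_comp (fun s => s - t1) (Rmax 0)); [| apply continuous_Rmax_0].
    apply (continuous_minus (V := R_NormedModule)); [apply continuous_id | apply continuous_const]. }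
  assert (Hpow : forall (f : R -> R) n, continuous f s -> continuous (fun s => f s ^ n) s).
  { intros f n Hf; induction n as [| n IHn]; [apply continuous_const |].
    now apply (continuous_mult (K := R_AbsRing) f (fun s => f s ^ n)). }
  apply (continuous_mult (K := R_AbsRing)); apply Hpow; [exact Hm |].
  apply (continuous_minus (V := R_NormedModule)); [apply continuous_const | apply continuous_id]. }
assert (Hex : forall a b, ex_RInt p a b).
{ intros; apply (ex_RInt_continuous (V := R_CompleteNormedModule)); intros; apply Hp. }
assert (Hnn : forall s, s <= T -> 0 <= p s).
{ intros s Hs; apply Rmult_le_pos; apply pow_le; [apply Rmax_l | lra]. }
assert (H0 : forall s, s <= t1 -> p s = 0).
{ intros s Hs; unfold p; rewrite Rmax_left by lra; rewrite pow_i by lia; ring. }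
set (I := RInt p t1 T).
assert (HI : 0 < I).
{ apply RInt_gt_0; trivial; intros s Hs; unfold p; rewrite Rmax_right by lra.
  apply Rmult_lt_0_compat; apply pow_lt; lra. }
exists (fun s => 1 - RInt p t1 s * / I), (fun s => - (p s * / I)), I.
split; [exact HI | split; [| split; [| split; [| split; [| split]]]]].
- intros s.
  assert (HD : is_derive (fun s => RInt p t1 s) s (p s)).
  { apply (is_derive_RInt (V := R_NormedModule) p (fun s => RInt p t1 s) t1); [| apply Hp].
    apply filter_forall; intros; apply (RInt_correct (V := R_CompleteNormedModule)), Hex. }
  evar_last; [apply (is_derive_minus (V := R_NormedModule) (fun _ => 1));
    [apply is_derive_const | exact (Rderive_mult _ _ _ _ _ HD (is_derive_const (V := R_NormedModule) (/ I) s))] |].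
  unfold minus, plus, opp, zero; simpl; ring.
- cont.
- intros s Hs; rewrite (H0 s Hs); split; [| ring].
  rewrite (RInt_ext p (fun _ => 0)).
  + rewrite (RInt_const (V := R_CompleteNormedModule)); unfold scal; simpl; unfold mult; simpl; ring.
  + intros u; rewrite Rmax_left by lra; intros Hu; apply H0; lra.
- intros s Hs; unfold bump, p; rewrite Rmax_right by lra; reflexivity.
- intros s Hs.
  assert (HA : 0 <= RInt p t1 s) by (apply RInt_ge_0; [lra | apply Hex | intros; apply Hnn; lra]).
  assert (HB : 0 <= RInt p s T) by (apply RInt_ge_0; [lra | apply Hex | intros; apply Hnn; lra]).
  pose proof (RInt_Chasles p t1 s T (Hex _ _) (Hex _ _)) as HC.
  change (RInt p t1 s + RInt p s T = I) in HC.
  assert (HIi : 0 < / I) by now apply Rinv_0_lt_compat.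
  assert (E : 1 = (RInt p t1 s + RInt p s T) * / I) by (rewrite HC; field; lra).
  assert (0 <= RInt p t1 s * / I) by (apply Rmult_le_pos; lra).
  assert (0 <= RInt p s T * / I) by (apply Rmult_le_pos; lra).
  lra.
- fold I; field; lra.
Qed.

(** The solution together with its partial derivatives [Y i j], extended to
    the whole plane by freezing the arguments at the boundary of [Omega_bar T];
    this makes all of them globally continuous. *)
Record extended_solution (N : nat) (T K : R) (Y : nat -> nat -> R -> R -> C) : Prop := {
  ext_cont : forall i j x t, (i + j <= N)%nat -> ccont (fun p : R * R => Y i j (fst p) (snd p)) (x, t);
  ext_dx : forall i j x t, (i + j < N)%nat -> 0 < x ->
    cderive (fun r => Y i j r t) x (Y (S i) j x t);
  ext_dt : forall i j x t, (i + j < N)%nat -> 0 < t < T ->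
    cderive (fun r => Y i j x r) t (Y i (S j) x t);
  ext_bound : forall i j x t, (i + j <= N)%nat -> Cmod (Y i j x t) <= K;
  ext_pde : forall x t, 0 < x -> 0 < t < T ->
    Y 0%nat 1%nat x t = (Ci * (Y 4%nat 0%nat x t + Y 2%nat 0%nat x t))%C;
  ext_init : forall x, 0 < x -> Y 0%nat 0%nat x 0 = 0%C;
  ext_ends : forall i j, (i <= 1)%nat -> (i + j <= N)%nat ->
    Y i j 0 0 = 0%C /\ Y i j 0 T = 0%C
}.

(** The decaying solution on the half-line with value [B] and slope [A] at 0, combined from
    [exp (i a x)] and [exp (i b x)]. *)
Definition half_line (x : R) (A B a b : C) : C :=
  ((Cexp (Ci * a * x) * (A - Ci * b * B) - Cexp (Ci * b * x) * (A - Ci * a * B)) / (Ci * (a - b)))%C.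

(** * The transformed problem and the resolvent estimate *)

Section assembly.
Variables (T K : R) (Y : nat -> nat -> R -> R -> C).
Hypothesis HT : 0 < T.
Hypothesis HY : extended_solution 20 T K Y.

Let A (z : C) : C := lap (Y 1%nat 0%nat 0) T z.
Let B (z : C) : C := lap (Y 0%nat 0%nat 0) T z.

Lemma ext_cont_t (i j : nat) (x t : R) : (i + j <= 20)%nat -> ccont (Y i j x) t.
Proof. intros H; apply (ccont_2d_r (Y i j)); intros; now apply (ext_cont _ _ _ _ HY). Qed.

Section cutoff.
Variables (t1 I : R) (chi chi' : R -> R).
Hypothesis Ht1 : 0 < t1 < T.
Hypothesis HI : 0 < I.
Hypothesis Hchi : forall s, is_derive chi s (chi' s).
Hypothesis Hchi'c : forall s, continuous chi' s.
Hypothesis Hchi1 : forall s, s <= t1 -> chi s = 1 /\ chi' s = 0.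
Hypothesis Hchi' : forall s, t1 <= s <= T -> chi' s = - (bump t1 T 14 14 s / I).
Hypothesis Hchib : forall s, t1 <= s <= T -> 0 <= chi s <= 1.
Hypothesis HchiT : chi T = 0.
Hypothesis Hsupp : forall s, t1 < s < T -> Y 0%nat 0%nat 0 s = 0%C /\ Y 1%nat 0%nat 0 s = 0%C.

Lemma continuous_chi (s : R) : continuous chi s.
Proof. apply (ex_derive_continuous (V := R_NormedModule)); eexists; apply Hchi. Qed.

Let Z (z : C) (i : nat) (x : R) : C := lap (fun s => (chi s * Y i 0%nat x s)%C) T z.

Lemma ccont_Z (z : C) (i : nat) (x : R) : (i <= 20)%nat -> ccont (Z z i) x.
Proof.
intros Hi; apply (ccont_CInt_param (fun x s : R => (Cexp (Ci * z * s) * (chi s * Y i 0%nat x s))%C)).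
- intros s; apply ccont_mult; [| apply ccont_mult].
  + cont.
  + apply ccont_RtoC, (continuous_comp (fun p : R * R => snd p) chi); [apply continuous_snd | apply continuous_chi].
  + apply (ext_cont _ _ _ _ HY); lia.
- intros v s; apply ccont_kernel_at, ccont_mult; [apply ccont_RtoC, continuous_chi | apply ext_cont_t; lia].
Qed.

Lemma cderive_Z (z : C) (i : nat) (x : R) : (i < 20)%nat -> 0 < x -> cderive (Z z i) x (Z z (S i) x).
Proof.
intros Hi Hx.
apply (cderive_CInt_param (fun x s : R => (Cexp (Ci * z * s) * (chi s * Y i 0%nat x s))%C)
  (fun x s : R => (Cexp (Ci * z * s) * (chi s * Y (S i) 0%nat x s))%C) 0 T x (mkposreal x Hx)).
- intros u s Hu; simpl in Hu; apply Rabs_lt_between in Hu.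
  eapply cderive_eq.
  + apply cderive_mult; [apply cderive_const | apply cderive_mult; [apply cderive_const |]].
    apply (ext_dx _ _ _ _ HY); [lia | lra].
  + cbv beta; ring.
- intros s; apply ccont_mult; [| apply ccont_mult].
  + cont.
  + apply ccont_RtoC, (continuous_comp (fun p : R * R => snd p) chi); [apply continuous_snd | apply continuous_chi].
  + apply (ext_cont _ _ _ _ HY); lia.
- intros v s; apply ccont_kernel_at, ccont_mult; [apply ccont_RtoC, continuous_chi | apply ext_cont_t; lia].
- intros s; apply ccont_kernel_at, ccont_mult; [apply ccont_RtoC, continuous_chi | apply ext_cont_t; lia].
Qed.

Lemma chi_bound (s : R) : s <= T -> 0 <= chi s <= 1.
Proof.
intros Hs; destruct (Rle_lt_dec s t1) as [H | H].
- destruct (Hchi1 s H) as [-> _]; lra.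
- apply Hchib; lra.
Qed.

Lemma Z_bound (z : C) (i : nat) (x : R) : 0 <= Im z -> (i <= 20)%nat -> Cmod (Z z i x) <= T * K.
Proof.
intros Hz Hi; unfold Z, lap; replace (T * K) with ((T - 0) * K) by ring.
apply Cmod_CInt_le_const; [lra | |].
- intros s; apply ccont_kernel_at, ccont_mult; [apply ccont_RtoC, continuous_chi | apply ext_cont_t; lia].
- intros s Hs; rewrite !Cmod_mult, Cmod_R.
  assert (H1 : Cmod (Cexp (Ci * z * s)) <= 1).
  { eapply Rle_trans; [apply (Cmod_kernel_le z Hz 0 s); lra |].
    rewrite Rmult_0_r, Ropp_0, exp_0; lra. }
  pose proof (chi_bound s ltac:(lra)) as H2; rewrite Rabs_pos_eq by lra.
  pose proof (ext_bound _ _ _ _ HY i 0%nat x s ltac:(lia)) as H3.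
  pose proof (Cmod_ge_0 (Cexp (Ci * z * s))); pose proof (Cmod_ge_0 (Y i 0%nat x s)).
  rewrite <- (Rmult_1_l K); apply Rmult_le_compat; trivial; [apply Rmult_le_pos; lra |].
  rewrite <- (Rmult_1_l K); apply Rmult_le_compat; lra.
Qed.

(** The cutoff commutes with the space derivatives, so the sole source is its commutator with the
    time derivative. The initial condition removes the boundary term at 0 and [chi T = 0] the one at
    [T]. The source lives on [[t1, T]], which yields [exp (- t1 Im z)] later. *)
Lemma Z_equation (z : C) (x : R) : 0 < x ->
  (Z z 4%nat x + Z z 2%nat x + z * Z z 0%nat x)%C =
  (- (Ci / I) * CInt (fun s : R => (Cexp (Ci * z * s) * (bump t1 T 14 14 s * Y 0%nat 0%nat x s))%C) t1 T)%C.
Proof.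
intros Hx.
assert (Hc : forall i j s, (i + j <= 20)%nat -> ccont (fun s => (chi s * Y i j x s)%C) s).
{ intros; apply ccont_mult; [apply ccont_RtoC, continuous_chi | now apply ext_cont_t]. }
assert (Hc' : forall s, ccont (fun s => (chi' s * Y 0%nat 0%nat x s)%C) s).
{ intros; apply ccont_mult; [apply ccont_RtoC, Hchi'c | apply ext_cont_t; lia]. }
assert (HIc : (RtoC I) <> 0%C) by (apply RtoC_neq_0; lra).
assert (E1 : (Z z 4%nat x + Z z 2%nat x)%C = (- Ci * lap (fun s => (chi s * Y 0%nat 1%nat x s)%C) T z)%C).
{ unfold Z, lap; rewrite <- CInt_plus, <- CInt_mult.
  - apply CInt_ext; [lra |]; intros s Hs; rewrite (ext_pde _ _ _ _ HY x s Hx Hs).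
    replace (- Ci * (Cexp (Ci * z * s) * (chi s * (Ci * (Y 4%nat 0%nat x s + Y 2%nat 0%nat x s)))))%C
      with (- (Ci * Ci) * (Cexp (Ci * z * s) * (chi s * (Y 4%nat 0%nat x s + Y 2%nat 0%nat x s))))%C by ring.
    rewrite Ci_sqr; ring.
  - intros; apply ccont_kernel_at, Hc; lia.
  - intros; apply ccont_kernel_at, Hc; lia.
  - intros; apply ccont_kernel_at, Hc; lia. }
assert (E2 : (Ci * z * Z z 0%nat x)%C = (- (lap (fun s => (chi' s * Y 0%nat 0%nat x s)%C) T z
  + lap (fun s => (chi s * Y 0%nat 1%nat x s)%C) T z))%C).
{ unfold Z, lap; rewrite (CInt_by_parts z _ (fun s => (chi' s * Y 0%nat 0%nat x s + chi s * Y 0%nat 1%nat x s)%C)).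
  - rewrite HchiT, (ext_init _ _ _ _ HY x Hx).
    rewrite (CInt_ext _ (fun s : R => (Cexp (Ci * z * s) * (chi' s * Y 0%nat 0%nat x s)
      + Cexp (Ci * z * s) * (chi s * Y 0%nat 1%nat x s))%C)); [| lra | intros; ring].
    rewrite CInt_plus; [ring | intros; now apply ccont_kernel_at | intros; apply ccont_kernel_at, Hc; lia].
  - lra.
  - intros; apply Hc; lia.
  - intros; apply ccont_plus; [apply Hc' | apply Hc; lia].
  - intros s Hs; eapply cderive_eq;
      [apply cderive_mult; [apply cderive_RtoC, Hchi | apply (ext_dt _ _ _ _ HY); [lia | exact Hs]] |].
    reflexivity. }
assert (E3 : lap (fun s => (chi' s * Y 0%nat 0%nat x s)%C) T z =
  (- (/ I) * CInt (fun s : R => (Cexp (Ci * z * s) * (bump t1 T 14 14 s * Y 0%nat 0%nat x s))%C) t1 T)%C).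
{ unfold lap; rewrite <- (CInt_Chasles _ 0 t1 T) by (intros; now apply ccont_kernel_at).
  rewrite (CInt_ext _ (fun _ => RtoC 0) 0 t1); [| lra |].
  2:{ intros s Hs; destruct (Hchi1 s ltac:(lra)) as [_ ->]; ring. }
  rewrite CInt_zero, Cplus_0_l, <- CInt_mult.
  - apply CInt_ext; [lra |]; intros s Hs; rewrite Hchi' by lra.
    rewrite RtoC_opp, RtoC_div by lra; field; exact HIc.
  - intros; apply ccont_kernel_at, ccont_mult; [apply ccont_RtoC, continuous_bump | apply ext_cont_t; lia]. }
assert (E4 : lap (fun s => (chi s * Y 0%nat 1%nat x s)%C) T z =
  (- (Ci * z * Z z 0%nat x) - lap (fun s => (chi' s * Y 0%nat 0%nat x s)%C) T z)%C) by (rewrite E2; ring).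
rewrite E1, E4, E3.
replace (- Ci * (- (Ci * z * Z z 0%nat x) - - / I *
  CInt (fun s : R => (Cexp (Ci * z * s) * (bump t1 T 14 14 s * Y 0%nat 0%nat x s))%C) t1 T))%C
  with ((Ci * Ci) * (z * Z z 0%nat x) - Ci / I *
    CInt (fun s : R => (Cexp (Ci * z * s) * (bump t1 T 14 14 s * Y 0%nat 0%nat x s))%C) t1 T)%C
  by (field; exact HIc).
rewrite Ci_sqr; ring.
Qed.

(** The cutoff acts where the boundary values are already zero, so it leaves their transforms
    unchanged. *)
Lemma Z_at_0 (z : C) (i : nat) : (i <= 1)%nat -> Z z i 0 = lap (Y i 0%nat 0) T z.
Proof.
intros Hi; unfold Z, lap; apply CInt_ext; [lra |]; intros s Hs.
destruct (Rle_lt_dec s t1) as [H | H].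
- destruct (Hchi1 s H) as [-> _]; ring.
- destruct (Hsupp s ltac:(lra)) as [H0 H1].
  destruct i as [| [| i]]; [rewrite H0 | rewrite H1 | lia]; ring.
Qed.

Lemma Cmod_ge_Im (z : C) : 1 <= Im z -> 1 <= Cmod z.
Proof.
intros H; apply Rle_trans with (2 := Im_le_Cmod z), Rle_trans with (2 := Rle_abs _), H.
Qed.

(** Fourteen integrations by parts gain [|z|^-14] and the four resolvent factors lose at most
    [(36 |z|^3)^4]; this leaves [|z|^-2] and the constant [36^4]. *)
Lemma resolvent_bound : exists c : R, 0 <= c /\ forall z x, 1 <= Im z -> 0 <= x ->
  Cmod (Z z 0%nat x - half_line x (A z) (B z) (k1 z) (k2 z))
  <= c * exp (- (Im z * t1)) / Cmod z ^ 2.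
Proof.
assert (HK : 0 <= K) by (apply Rle_trans with (2 := ext_bound _ _ _ _ HY 0 0 0 0 ltac:(lia)), Cmod_ge_0).
set (c0 := (1 + 2 * INR 14) ^ 14 * ((T - t1) * ((1 + (T - t1)) ^ 14 * (1 + (T - t1)) ^ 14 * K))).
assert (Hc0 : 0 <= c0).
{ unfold c0; apply Rmult_le_pos; [apply pow_le; pose proof (pos_INR 14); lra |].
  apply Rmult_le_pos; [lra |]; apply Rmult_le_pos; [| exact HK].
  apply Rmult_le_pos; apply pow_le; lra. }
exists (c0 / I * 36 ^ 4); split.
{ apply Rmult_le_pos; [apply Rdiv_le_0_compat; lra | lra]. }
intros z x Hz Hx.
assert (Hz0 : 0 <= Im z) by lra.
pose proof (Cmod_ge_Im z Hz) as Hm.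
destruct (Im_k_inv_le z Hz) as [[P1 Q1] [P2 Q2]].
set (M := c0 * exp (- (Im z * t1)) / Cmod z ^ 14 / I).
assert (Hm14 : 0 < Cmod z ^ 14) by (apply pow_lt; lra).
assert (HM0 : 0 <= M).
{ unfold M; apply Rdiv_le_0_compat; [| exact HI]; apply Rdiv_le_0_compat; [| exact Hm14].
  apply Rmult_le_pos; [exact Hc0 | apply Rlt_le, exp_pos]. }
assert (Hd : (k1 z - k2 z)%C <> 0%C).
{ rewrite k1_minus_k2; intros E; pose proof (Cmod_rd_ge_1 z) as H; rewrite E, Cmod_0 in H; lra. }
assert (H4 := fourth_order_bound z (k1 z) (k2 z) (Z z)
  (fun x => (Z z 4%nat x + Z z 2%nat x + z * Z z 0%nat x)%C) M (T * K) P1 P2 Hd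
  (k1_sqr_k2 z) (k1_k2_sqr z Hz0)).
rewrite (Z_at_0 z 0), (Z_at_0 z 1) in H4 by lia.
apply Rle_trans with (M / Im (k1 z) / Im (k2 z) / Im (k1 z) / Im (k2 z)).
- apply H4; trivial.
  + intros i x0 Hi; apply ccont_Z; lia.
  + intros i x0 Hi _; apply Z_bound; [exact Hz0 | lia].
  + intros i x0 Hi Hx0; apply cderive_Z; [lia | exact Hx0].
  + intros x0 Hx0; rewrite (Z_equation z x0 Hx0).
    assert (HIc : (RtoC I) <> 0%C) by (apply RtoC_neq_0; lra).
    rewrite Cmod_mult, Cmod_opp, Cmod_div by exact HIc.
    rewrite Cmod_Ci, Cmod_R, Rabs_pos_eq by lra.
    assert (Hb := kernel_decay_bump z Hz0 (fun l => Y 0%nat l x0) 14 14 t1 T K ltac:(lra)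
      ltac:(intros; apply ext_cont_t; lia)
      ltac:(intros; apply (ext_bound _ _ _ _ HY); lia)
      ltac:(intros; apply (ext_dt _ _ _ _ HY); [lia | lra]) 14 14 14 0 ltac:(lia) ltac:(lia) ltac:(lia)).
    fold c0 in Hb; cbv beta in Hb.
    unfold M; unfold Rdiv; rewrite Rmult_1_l, (Rmult_comm (/ I)).
    apply Rmult_le_compat_r; [apply Rlt_le, Rinv_0_lt_compat, HI |].
    apply Rmult_le_reg_l with (Cmod z ^ 14); [exact Hm14 |].
    eapply Rle_trans; [exact Hb |].
    right; field; lra.
- assert (H36 : 0 <= 36 * Cmod z ^ 3) by (apply Rmult_le_pos; [lra | apply pow_le; lra]).
  unfold Rdiv at 1 2 3 4.
  assert (Hi1 : 0 < / Im (k1 z)) by now apply Rinv_0_lt_compat.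
  assert (Hi2 : 0 < / Im (k2 z)) by now apply Rinv_0_lt_compat.
  apply Rle_trans with (M * (36 * Cmod z ^ 3) * (36 * Cmod z ^ 3) * (36 * Cmod z ^ 3) * (36 * Cmod z ^ 3)).
  + assert (S1 : forall p q u v, 0 <= p -> p <= q -> 0 < u -> u <= v -> 0 <= p * u /\ p * u <= q * v).
    { intros p q u v Hp Hq Hu Hv; split; [apply Rmult_le_pos; lra | apply Rmult_le_compat; lra]. }
    destruct (S1 M M _ _ HM0 (Rle_refl _) Hi1 Q1) as [A1 B1].
    destruct (S1 _ _ _ _ A1 B1 Hi2 Q2) as [A2 B2].
    destruct (S1 _ _ _ _ A2 B2 Hi1 Q1) as [A3 B3].
    destruct (S1 _ _ _ _ A3 B3 Hi2 Q2) as [A4 B4]; exact B4.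
  + right; unfold M; field; split; [lra | lra].
Qed.

End cutoff.

End assembly.

(** * The boundary waves *)

(** The part of the half-line solution that belongs to the root [a], times the inversion factor.
    Exchanging [a] and [b] also changes the sign of the denominator, so the two waves add up. *)
Definition wave (x t : R) (A B a b z : C) : C :=
  (Cexp (- Ci * z * t) * (Cexp (Ci * a * x) * (A - Ci * b * B) / (Ci * (a - b))))%C.

Lemma k1_minus_k2_neq_0 (z : C) : (k1 z - k2 z)%C <> 0%C.
Proof.
rewrite k1_minus_k2; intros E; pose proof (Cmod_rd_ge_1 z) as H; rewrite E, Cmod_0 in H; lra.
Qed.

Lemma k2_minus_k1_neq_0 (z : C) : (k2 z - k1 z)%C <> 0%C.
Proof.
intros E; apply (k1_minus_k2_neq_0 z).
replace (k1 z - k2 z)%C with (- (k2 z - k1 z))%C by ring; rewrite E; ring.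
Qed.

Lemma half_line_wave (x t : R) (A B z : C) :
  (Cexp (- Ci * z * t) * half_line x A B (k1 z) (k2 z))%C =
  (wave x t A B (k1 z) (k2 z) z + wave x t A B (k2 z) (k1 z) z)%C.
Proof.
unfold half_line, wave; field; repeat split;
  solve [apply k2_minus_k1_neq_0 | apply k1_minus_k2_neq_0 | apply Ci_neq_0].
Qed.

(** * Inversion on a horizontal line and descent to the real axis *)

Section inversion.
Variables (T K : R) (Y : nat -> nat -> R -> R -> C).
Hypothesis HT : 0 < T.
Hypothesis HY : extended_solution 20 T K Y.
Variables x t b : R.
Hypothesis Hx : 0 < x.
Hypothesis Ht : 0 < t < T.
Hypothesis Hb : b < T.
Hypothesis Hsupp : forall s, b < s < T -> Y 0%nat 0%nat 0 s = 0%C /\ Y 1%nat 0%nat 0 s = 0%C.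

Let A (z : C) : C := lap (Y 1%nat 0%nat 0) T z.
Let B (z : C) : C := lap (Y 0%nat 0%nat 0) T z.

Definition first_wave (z : C) : C := wave x t (A z) (B z) (k1 z) (k2 z) z.
Definition second_wave (z : C) : C := wave x t (A z) (B z) (k2 z) (k1 z) z.

Let Phi (z : C) : C := (first_wave z + second_wave z)%C.

Lemma ccont_boundary_1 : forall s, ccont (Y 1%nat 0%nat 0) s.
Proof. intros; apply (ext_cont_t T K Y HY); lia. Qed.

Lemma ccont_boundary_0 : forall s, ccont (Y 0%nat 0%nat 0) s.
Proof. intros; apply (ext_cont_t T K Y HY); lia. Qed.

Lemma ccont_wave (p q : C -> C) (z : C) : ccont p z -> ccont q z -> (p z - q z)%C <> 0%C ->
  ccont (fun z => wave x t (A z) (B z) (p z) (q z) z) z.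
Proof.
intros Ca Cb Hd.
assert (CA : ccont A z) by (apply ccont_lap; apply ccont_boundary_1).
assert (CB : ccont B z) by (apply ccont_lap; apply ccont_boundary_0).
apply ccont_mult; [cont |]; apply ccont_div; [cont | cont |].
apply Cmult_neq_0; [apply Ci_neq_0 | exact Hd].
Qed.

Lemma ccont_waves (z : C) : ccont first_wave z /\ ccont second_wave z.
Proof.
destruct (ccont_roots (fun z => z) z (ccont_id z)) as [_ [C1 C2]].
split.
- exact (ccont_wave k1 k2 z C1 C2 (k1_minus_k2_neq_0 z)).
- exact (ccont_wave k2 k1 z C2 C1 (k2_minus_k1_neq_0 z)).
Qed.

Lemma holo_wave (p q : C -> C) : holo p -> holo q -> (forall z, (p z - q z)%C <> 0%C) ->
  holo (fun z => wave x t (A z) (B z) (p z) (q z) z).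
Proof.
intros Ca Cb Hd.
assert (CA : holo A) by (apply holo_lap; [lra | apply ccont_boundary_1]).
assert (CB : holo B) by (apply holo_lap; [lra | apply ccont_boundary_0]).
assert (Ce : forall (c : C) (r : R) (f : C -> C), holo f -> holo (fun z => Cexp (c * f z * r))).
{ intros c r f Hf; apply holo_Cexp, holo_mult; [apply holo_mult; [apply holo_const | exact Hf] | apply holo_const]. }
assert (Cc : forall f : C -> C, holo f -> holo (fun z => (Ci * f z)%C)).
{ intros f Hf; apply holo_mult; [apply holo_const | exact Hf]. }
apply holo_mult; [apply (Ce _ _ (fun z => z)), holo_id |]; apply holo_div.
- apply holo_mult; [now apply Ce |]; apply holo_minus; [exact CA |].
  apply holo_mult; [now apply Cc | exact CB].
- now apply Cc, holo_minus.
- intros z _; apply Cmult_neq_0; [apply Ci_neq_0 | apply Hd].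
Qed.

Lemma holo_Phi : holo Phi.
Proof.
destruct holo_roots as [_ [C1 C2]].
apply holo_plus.
- exact (holo_wave k1 k2 C1 C2 k1_minus_k2_neq_0).
- exact (holo_wave k2 k1 C2 C1 k2_minus_k1_neq_0).
Qed.

(** The transforms of the flat boundary data are [O(|z|^-3)] and the factor [q] grows at most
    linearly, which leaves two powers: enough for integrability on the real line and for the
    vertical sides of the shifted contour. The constant 5 is 1 from [A] plus 4 from
    [2 (1 + m) <= 4 m]. *)
Lemma waves_bound : exists c : R, 0 <= c /\ forall z, 0 <= Im z -> 1 <= Rabs (Re z) ->
  Cmod (first_wave z) <= c * exp (Im z * t) / Re z ^ 2 /\ Cmod (second_wave z) <= c * exp (Im z * t) / Re z ^ 2.
Proof.
assert (HK : 0 <= K) by (apply Rle_trans with (2 := ext_bound _ _ _ _ HY 0 0 0 0 ltac:(lia)), Cmod_ge_0).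
assert (HTK : 0 <= T * K) by (apply Rmult_le_pos; lra).
exists (5 * (T * K)); split; [lra |]; intros z Hz Hr.
pose proof (re_le_Cmod z) as Hre; set (m := Cmod z) in *.
assert (Hm : 1 <= m) by lra.
assert (HA : m ^ 3 * Cmod (A z) <= T * K).
{ apply (kernel_decay_flat z Hz (fun l => Y 1%nat l 0) 3 T K); try lia; [lra | | | |].
  - intros; apply (ext_cont_t T K Y HY); lia.
  - intros; apply (ext_bound _ _ _ _ HY); lia.
  - intros; apply (ext_dt _ _ _ _ HY); [lia | assumption].
  - intros; apply (ext_ends _ _ _ _ HY); lia. }
assert (HB : m ^ 3 * Cmod (B z) <= T * K).
{ apply (kernel_decay_flat z Hz (fun l => Y 0%nat l 0) 3 T K); try lia; [lra | | | |].
  - intros; apply (ext_cont_t T K Y HY); lia.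
  - intros; apply (ext_bound _ _ _ _ HY); lia.
  - intros; apply (ext_dt _ _ _ _ HY); [lia | assumption].
  - intros; apply (ext_ends _ _ _ _ HY); lia. }
destruct (Cmod_k_le z Hz) as [K1 K2]; fold m in K1, K2.
destruct (Im_k_nonneg z) as [I1 I2].
assert (D1 : 1 <= Cmod (k1 z - k2 z)) by (rewrite k1_minus_k2; apply Cmod_rd_ge_1).
assert (D2 : 1 <= Cmod (k2 z - k1 z)).
{ rewrite <- Cmod_opp; replace (- (k2 z - k1 z))%C with (k1 z - k2 z)%C by ring; exact D1. }
assert (Hgen : forall p q : C, 0 <= Im p -> Cmod q <= 2 * (1 + m) -> 1 <= Cmod (p - q) ->
  Cmod (wave x t (A z) (B z) p q z) <= 5 * (T * K) * exp (Im z * t) / Re z ^ 2).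
{ intros p q Hp Hq Hd; unfold wave.
  assert (Hd0 : (Ci * (p - q))%C <> 0%C).
  { apply Cmult_neq_0; [apply Ci_neq_0 |]; intros E; rewrite E, Cmod_0 in Hd; lra. }
  rewrite Cmod_mult, Cmod_div by exact Hd0.
  rewrite !Cmod_mult, Cmod_Ci, Rmult_1_l, !Cmod_Cexp.
  replace (Re (- Ci * z * t)) with (Im z * t) by (reim; ring).
  replace (Re (Ci * p * x)) with (- (Im p * x)) by (reim; ring).
  assert (He : exp (- (Im p * x)) <= 1) by (rewrite <- exp_0; apply exp_le; nra).
  pose proof (exp_pos (- (Im p * x))); pose proof (exp_pos (Im z * t)).
  assert (HAB : m ^ 2 * Cmod (A z - Ci * q * B z) <= 5 * (T * K)).
  { assert (Ht1 : Cmod (A z - Ci * q * B z) <= Cmod (A z) + 2 * (1 + m) * Cmod (B z)).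
    { eapply Rle_trans; [apply Cmod_minus_le |]; apply Rplus_le_compat_l.
      rewrite !Cmod_mult, Cmod_Ci, Rmult_1_l.
      apply Rmult_le_compat_r; [apply Cmod_ge_0 | exact Hq]. }
    pose proof (Cmod_ge_0 (A z)); pose proof (Cmod_ge_0 (B z)).
    assert (Hm2 : 1 <= m ^ 2) by nra.
    apply Rle_trans with (m ^ 2 * (Cmod (A z) + 2 * (1 + m) * Cmod (B z))).
    { apply Rmult_le_compat_l; lra. }
    assert (m ^ 2 * Cmod (A z) <= m ^ 3 * Cmod (A z)).
    { apply Rmult_le_compat_r; [assumption | simpl; nra]. }
    assert (m ^ 2 * (2 * (1 + m)) * Cmod (B z) <= 4 * m ^ 3 * Cmod (B z)).
    { apply Rmult_le_compat_r; [assumption | simpl; nra]. }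
    lra. }
  set (W := Cmod (A z - Ci * q * B z)) in *.
  assert (HW : 0 <= W) by apply Cmod_ge_0.
  assert (Hr2 : 1 <= Re z ^ 2) by (rewrite <- pow2_abs; nra).
  assert (Hrm : Re z ^ 2 <= m ^ 2) by (rewrite <- (pow2_abs (Re z)); apply pow_incr; lra).
  assert (HW2 : W <= 5 * (T * K) / Re z ^ 2).
  { apply Rmult_le_reg_l with (Re z ^ 2); [lra |].
    replace (Re z ^ 2 * (5 * (T * K) / Re z ^ 2)) with (5 * (T * K)) by (field; nra).
    apply Rle_trans with (2 := HAB), Rmult_le_compat_r; lra. }
  replace (5 * (T * K) * exp (Im z * t) / Re z ^ 2) with (exp (Im z * t) * (5 * (T * K) / Re z ^ 2))
    by (field; nra).
  apply Rmult_le_compat_l; [lra |].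
  apply Rle_trans with W; [| exact HW2].
  apply Rmult_le_reg_r with (Cmod (p - q)); [lra |].
  unfold Rdiv; rewrite Rmult_assoc, Rinv_l, Rmult_1_r by lra.
  apply Rle_trans with (1 * W); [apply Rmult_le_compat_r; lra |].
  rewrite Rmult_comm; apply Rmult_le_compat_l; lra. }
split; [exact (Hgen (k1 z) (k2 z) I1 K2 D1) | exact (Hgen (k2 z) (k1 z) I2 K1 D2)].
Qed.

Lemma inverse_square_integral (r : R) : 0 <= r -> RInt (fun u => / (1 + u²)) (- r) r <= PI.
Proof.
intros Hr; assert (E : RInt (fun u => / (1 + u²)) (- r) r = atan r - atan (- r)).
{ apply is_RInt_unique, (is_RInt_derive (V := R_CompleteNormedModule)).
  - intros u _; apply is_derive_atan.
  - intros u _; apply continuous_Rinv_comp; [| pose proof (Rle_0_sqr u); lra].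
    apply (continuous_plus (V := R_NormedModule)); [apply continuous_const |].
    apply (continuous_mult (K := R_AbsRing)); apply continuous_id. }
rewrite E, atan_opp; pose proof (atan_bound r); lra.
Qed.

Lemma Phi_integral_limit (e : R) : 0 < e ->
  exists R0, 0 < R0 /\ forall r, R0 <= r ->
    Cmod (CInt (fun u : R => Phi u) (- r) r - 2 * PI * Y 0%nat 0%nat x t) < e.
Proof.
intros He; pose proof PI_RGT_0 as Hpi.
(* After [b], so that the cutoff spares the data, and after [t], so that [exp (- (t1 - t) Im z)]
   decays. *)
set (t1 := (Rmax b t + T) / 2).
assert (Hbt : b <= Rmax b t /\ t <= Rmax b t /\ Rmax b t < T).
{ split; [apply Rmax_l | split; [apply Rmax_r | now apply Rmax_lub_lt]]. }
assert (Ht1 : b < t1 /\ t < t1 < T) by (unfold t1; lra).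
destruct (cutoff_exists t1 T 13 ltac:(lra)) as [chi [chi' [I [HI [Q1 [Q2 [Q3 [Q4 [Q5 Q6]]]]]]]]].
destruct (resolvent_bound T K Y HT HY t1 I chi chi' ltac:(lra) HI Q1 Q2 Q3 Q4 Q5 Q6) as [c [Hc0 Hc]].
{ intros s Hs; apply Hsupp; lra. }
fold A B in Hc.
destruct waves_bound as [c2 [Hc20 Hc2]].
destruct (exp_opp_small (t1 - t) (c * PI) (e / 3) ltac:(lra) ltac:(lra)) as [L0 [HL0 HL]].
(* The height is fixed before [r] grows: large enough for the resolvent error to stay below [e / 3],
   and above 1 so that [resolvent_bound] applies. Inversion and shift each take another [e / 3]. *)
set (S := L0 + 1); assert (HS : 1 < S) by (unfold S; lra).
specialize (HL S ltac:(unfold S; lra)).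
assert (HchiC : forall s, continuous chi s).
{ intros s; apply (ex_derive_continuous (V := R_NormedModule)); eexists; apply Q1. }
assert (HYc : forall s, ccont (Y 0%nat 0%nat x) s) by (intros; apply (ext_cont_t T K Y HY); lia).
(* The exponential turns inversion along the real line into inversion along [Im z = S]; it equals 1
   at [s = t], so [phi t] is the value of the solution. *)
set (phi := fun s => (exp (- S * (s - t)) * (chi s * Y 0%nat 0%nat x s))%C).
assert (Hexp : forall s, is_derive (fun s => exp (- S * (s - t))) s (- S * exp (- S * (s - t)))).
{ intros s; auto_derive; trivial; unfold Rminus; ring. }
assert (Hphi : forall s, ccont phi s).
{ intros s; apply ccont_mult; [eapply cderive_ccont, cderive_RtoC, Hexp |].
  apply ccont_mult; [apply ccont_RtoC, HchiC | apply HYc]. }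
assert (Hphit : phi t = Y 0%nat 0%nat x t).
{ unfold phi; rewrite Rminus_diag, Rmult_0_r, exp_0; destruct (Q3 t ltac:(lra)) as [-> _]; ring. }
destruct (fourier_inversion phi
  (RtoC (- S * exp (- S * (t - t))) * (chi t * Y 0%nat 0%nat x t)
   + exp (- S * (t - t)) * (chi' t * Y 0%nat 0%nat x t + chi t * Y 0%nat 1%nat x t))%C
  T t (e / 3) Ht ltac:(lra) Hphi) as [R1 [HR1 Hinv]].
{ apply (cderive_mult (fun s => RtoC (exp (- S * (s - t))))); [apply (cderive_RtoC (fun s => exp (- S * (s - t)))), Hexp |].
  apply (cderive_mult (fun s => RtoC (chi s))); [apply cderive_RtoC, Q1 | apply (ext_dt _ _ _ _ HY); [lia | exact Ht]]. }
rewrite Hphit in Hinv.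
set (M0 := 2 * (2 * (c2 * exp (S * t))) * S).
assert (HM0 : 0 <= M0).
{ unfold M0; pose proof (exp_pos (S * t)); apply Rmult_le_pos; [| lra].
  assert (0 <= c2 * exp (S * t)) by (apply Rmult_le_pos; lra); lra. }
set (R2 := 1 + 3 * (M0 + 1) / e).
assert (HR2 : 1 < R2).
{ unfold R2; assert (0 < 3 * (M0 + 1) / e) by (apply Rdiv_lt_0_compat; lra); lra. }
exists (R1 + R2); split; [lra |]; intros r Hr.
specialize (Hinv r ltac:(lra)).
assert (Hr1 : 1 < r) by lra.
assert (HPc : forall z, ccont Phi z) by (intros z; destruct (ccont_waves z); now apply ccont_plus).
assert (HImz : forall u s : R, Im (u + s * Ci)%C = s) by (intros; reim; ring).
assert (HRez : forall u s : R, Re (u + s * Ci)%C = u) by (intros; reim; ring).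
assert (Hshift : Cmod (CInt (fun u : R => Phi (u + S * Ci)%C) (- r) r - CInt (fun u : R => Phi u) (- r) r) < e / 3).
{ apply Rle_lt_trans with (2 * (2 * (c2 * exp (S * t) / r ^ 2)) * S).
  - apply contour_shift; [apply holo_Phi | exact HPc | lra | lra |].
    assert (Hgen : forall u s : R, 0 < s < S -> Rabs u = r ->
      Cmod (Phi (u + s * Ci)%C) <= 2 * (c2 * exp (S * t) / r ^ 2)).
    { intros u s Hs Hu.
      destruct (Hc2 (u + s * Ci)%C) as [B1 B2]; rewrite ?HImz, ?HRez in *; [lra | lra |].
      assert (Hu2 : u ^ 2 = r ^ 2) by (rewrite <- (pow2_abs u), Hu; reflexivity).
      rewrite Hu2 in B1, B2.
      assert (Hle : c2 * exp (s * t) / r ^ 2 <= c2 * exp (S * t) / r ^ 2).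
      { apply Rmult_le_compat_r; [apply Rlt_le, Rinv_0_lt_compat; nra |].
        apply Rmult_le_compat_l; [exact Hc20 | apply exp_le; nra]. }
      unfold Phi; eapply Rle_trans; [apply Cmod_triangle | lra]. }
    intros s Hs; split; [apply Hgen; [exact Hs | apply Rabs_pos_eq; lra] |].
    rewrite <- RtoC_opp; apply Hgen; [exact Hs |]; rewrite Rabs_Ropp; apply Rabs_pos_eq; lra.
  - replace (2 * (2 * (c2 * exp (S * t) / r ^ 2)) * S) with (M0 / r ^ 2) by (unfold M0; field; nra).
    apply Rmult_lt_reg_r with (r ^ 2); [nra |].
    replace (M0 / r ^ 2 * r ^ 2) with M0 by (field; nra).
    assert (Hq : 3 * (M0 + 1) / e * (e / 3) = M0 + 1) by (field; lra).
    assert (3 * (M0 + 1) / e <= r) by (unfold R2 in Hr; lra).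
    assert (3 * (M0 + 1) / e * (e / 3) <= r * (e / 3)) by (apply Rmult_le_compat_r; lra).
    assert (r * (e / 3) <= r ^ 2 * (e / 3)) by (apply Rmult_le_compat_r; nra).
    lra. }
set (Zt := fun u : R => CInt (fun s => (Cexp (Ci * u * (s - t)%R) * phi s)%C) 0 T) in *.
assert (HZt : forall u : R, Zt u = (Cexp (- Ci * (u + S * Ci) * t) *
  lap (fun s => (chi s * Y 0%nat 0%nat x s)%C) T (u + S * Ci)%C)%C).
{ intros u; unfold Zt, lap; rewrite <- CInt_mult.
  - apply CInt_ext; [lra |]; intros s _; unfold phi.
    assert (E : RtoC (exp (- S * (s - t))) = Cexp (RtoC (- S * (s - t)))).
    { unfold Cexp; apply C_ext; simpl; rewrite ?cos_0, ?sin_0; ring. }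
    rewrite E, !Cmult_assoc, <- !Cexp_plus; do 3 f_equal.
    rewrite RtoC_mult, RtoC_opp, RtoC_minus.
    replace (- Ci * (u + S * Ci) * t + Ci * (u + S * Ci) * s)%C
      with (Ci * u * (s - t) + (Ci * Ci) * (S * (s - t)))%C by ring.
    rewrite Ci_sqr; ring.
  - cont. }
assert (Hline : forall u, ccont (fun u : R => (u + S * Ci)%C) u).
{ cont. }
assert (HPl : forall u, ccont (fun u : R => Phi (u + S * Ci)%C) u).
{ cont. }
assert (HZc : forall u, ccont Zt u).
{ intros u; apply (ccont_CInt_param (fun u s : R => (Cexp (Ci * u * (s - t)%R) * phi s)%C)).
  - cont.
  - cont. }
assert (Hdiff : Cmod (CInt Zt (- r) r - CInt (fun u : R => Phi (u + S * Ci)%C) (- r) r) < e / 3).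
{ rewrite <- CInt_minus; [| exact HZc | exact HPl].
  set (k := c * exp (- (t1 - t) * S)).
  assert (Hk : 0 <= k) by (apply Rmult_le_pos; [exact Hc0 | apply Rlt_le, exp_pos]).
  assert (Hcq : forall u : R, continuous (fun u => / (1 + u²)) u).
  { intros u; apply continuous_Rinv_comp; [| pose proof (Rle_0_sqr u); lra].
    apply (continuous_plus (V := R_NormedModule)); [apply continuous_const |].
    apply (continuous_mult (K := R_AbsRing)); apply continuous_id. }
  (* On this line [|z|^2 = u^2 + S^2 >= 1 + u^2], so the error has a majorant whose integral is at
     most [k * PI], uniformly in [r]. *)
  apply Rle_lt_trans with (RInt (fun u => k * / (1 + u²)) (- r) r).
  - apply Cmod_CInt_le; [lra | | |].
    + cont.
    + cont.
    + intros u _; rewrite HZt.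
      set (z := (u + S * Ci)%C).
      assert (Hz : Im z = S) by apply HImz.
      replace (Phi z) with (Cexp (- Ci * z * t) * half_line x (A z) (B z) (k1 z) (k2 z))%C
        by (unfold Phi; apply half_line_wave).
      replace (Cexp (- Ci * z * t) * lap (fun s => (chi s * Y 0%nat 0%nat x s)%C) T z -
        Cexp (- Ci * z * t) * half_line x (A z) (B z) (k1 z) (k2 z))%C
        with (Cexp (- Ci * z * t) * (lap (fun s => (chi s * Y 0%nat 0%nat x s)%C) T z -
         half_line x (A z) (B z) (k1 z) (k2 z)))%C by ring.
      rewrite Cmod_mult, Cmod_Cexp.
      replace (Re (- Ci * z * t)) with (S * t) by (rewrite <- Hz; reim; ring).
      specialize (Hc z x ltac:(lra) ltac:(lra)); rewrite Hz in Hc.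
      assert (Hm : 1 + u² <= Cmod z ^ 2).
      { rewrite Cmod_sqr, Hz; unfold z; rewrite HRez; unfold Rsqr; nra. }
      pose proof (Rle_0_sqr u) as Hu.
      apply Rle_trans with (exp (S * t) * (c * exp (- (S * t1)) / Cmod z ^ 2)).
      { apply Rmult_le_compat_l; [apply Rlt_le, exp_pos | exact Hc]. }
      replace k with (exp (S * t) * (c * exp (- (S * t1)))).
      * rewrite Rmult_assoc; apply Rmult_le_compat_l; [apply Rlt_le, exp_pos |].
        apply Rmult_le_compat_l; [apply Rmult_le_pos; [exact Hc0 | apply Rlt_le, exp_pos] |].
        apply Rinv_le_contravar; lra.
      * unfold k; replace (- (t1 - t) * S) with (S * t + - (S * t1)) by ring; rewrite exp_plus; ring.
  - assert (E : RInt (fun u => k * / (1 + u²)) (- r) r = k * RInt (fun u => / (1 + u²)) (- r) r).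
    { apply (RInt_scal (V := R_CompleteNormedModule)).
      apply (ex_RInt_continuous (V := R_CompleteNormedModule)); intros; apply Hcq. }
    rewrite E; apply Rle_lt_trans with (k * PI).
    + apply Rmult_le_compat_l; [exact Hk | apply inverse_square_integral; lra].
    + unfold k; replace (c * exp (- (t1 - t) * S) * PI) with (c * PI * exp (- (t1 - t) * S)) by ring; exact HL. }
replace (CInt (fun u : R => Phi u) (- r) r - 2 * PI * Y 0%nat 0%nat x t)%C
  with ((CInt Zt (- r) r - 2 * PI * Y 0%nat 0%nat x t)
    - (CInt Zt (- r) r - CInt (fun u : R => Phi (u + S * Ci)%C) (- r) r)
    - (CInt (fun u : R => Phi (u + S * Ci)%C) (- r) r - CInt (fun u : R => Phi u) (- r) r))%C by ring.
eapply Rle_lt_trans; [apply Cmod_minus_le |].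
eapply Rle_lt_trans; [apply Rplus_le_compat_r, Cmod_minus_le |].
lra.
Qed.

End inversion.

(** * The arcs of the boundary *)

(** This reduces the branch computations to a sign: the square of [nu] is known, and the sign of one
    of its components decides between the two roots. *)
Lemma C_sqr_eq (a c : C) : (a * a)%C = (c * c)%C -> a = c \/ a = (- c)%C.
Proof.
intros H; destruct (Ceq_dec (a - c) 0) as [E | E].
- left; replace a with (a - c + c)%C by ring; rewrite E; ring.
- destruct (Ceq_dec (a + c) 0) as [E' | E'].
  + right; replace a with (a + c - c)%C by ring; rewrite E'; ring.
  + exfalso; apply (Cmult_neq_0 _ _ E E').
    replace ((a - c) * (a + c))%C with (a * a - c * c)%C by ring; rewrite H; ring.
Qed.

Lemma sqrt_rot_eq (e : R) (z : C) :
  sqrt_rot e z = (sqrt (Cmod z) * cos (arg_rot e z / 2), sqrt (Cmod z) * sin (arg_rot e z / 2)).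
Proof.
unfold sqrt_rot.
replace (Ci * (arg_rot e z / 2))%C with (Ci * (arg_rot e z / 2)%R * 1%R)%C
  by (rewrite RtoC_div by lra; ring).
rewrite Cexp_imag, Rmult_1_r; apply C_ext; simpl; ring.
Qed.

Lemma sqrt_rot_sqr (e : R) (z : C) : 0 <= e <= 2 * PI -> (sqrt_rot e z * sqrt_rot e z)%C = z.
Proof.
intros He; rewrite sqrt_rot_eq.
destruct (Ceq_dec z 0) as [-> | Hz].
- rewrite Cmod_0, sqrt_0, !Rmult_0_l; apply C_ext; simpl; ring.
- destruct (arg_rot_spec e z He Hz) as [_ Hp].
  assert (Hs : sqrt (Cmod z) * sqrt (Cmod z) = Cmod z) by apply sqrt_sqrt, Cmod_ge_0.
  set (th := arg_rot e z) in *; set (m := Cmod z) in *; set (q := sqrt m) in *.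
  replace th with (2 * (th / 2)) in Hp by field.
  rewrite cos_2a, sin_2a in Hp.
  transitivity (q * q * (cos (th / 2) * cos (th / 2) - sin (th / 2) * sin (th / 2)),
                q * q * (2 * sin (th / 2) * cos (th / 2)) : R).
  + apply C_ext; simpl; ring.
  + rewrite Hs; symmetry; exact Hp.
Qed.

Lemma nu_sqr (e : R) (k : C) : 0 <= e <= 2 * PI -> (nu e k * nu e k)%C = (1 - k * k)%C.
Proof.
intros He; unfold nu; pose proof PI_RGT_0.
rewrite sqrt_rot_sqr; [simpl; ring |].
destruct (Rlt_dec (Re k) 0); lra.
Qed.

Lemma arg0_real (r : R) : (0 < r -> arg0 r = 0) /\ (0 <= arg0 r <= PI).
Proof.
unfold arg0; simpl Im; destruct (Rle_dec 0 0) as [_ | H]; [| lra].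
split; [| apply acos_bound].
intros Hr; simpl Re; rewrite Cmod_R, Rabs_pos_eq by lra.
replace (r / r) with 1 by (field; lra); apply acos_1.
Qed.

Section branches.
Variable eps : R.
Hypothesis Heps : 0 < eps < PI.

(** On the right the argument 0 lies below [eps] and is moved to [2 PI]; its half is [PI], whence
    the negative root. *)
Lemma nu_right_real (k : C) (r : R) : 0 <= Re k -> 0 < r -> (1 - k * k)%C = r -> nu eps k = (- sqrt r)%R.
Proof.
intros Hk Hr E; pose proof PI_RGT_0.
assert (Hs : (nu eps k * nu eps k)%C = ((- sqrt r)%R * (- sqrt r)%R)%C).
{ rewrite nu_sqr, E by lra; rewrite <- RtoC_mult; f_equal.
  replace (- sqrt r * - sqrt r) with (sqrt r * sqrt r) by ring; rewrite sqrt_sqrt; lra. }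
destruct (C_sqr_eq _ _ Hs) as [H' | H']; [exact H' | exfalso].
apply (f_equal Re) in H'; revert H'; unfold nu.
destruct (Rlt_dec (Re k) 0) as [Hn | _]; [lra |].
rewrite sqrt_rot_eq; replace (1 - k ^ 2)%C with (RtoC r) by (rewrite <- E; simpl; ring).
unfold arg_rot; rewrite (proj1 (arg0_real r) Hr).
destruct (Rlt_dec 0 eps) as [_ | Hn]; [| lra].
replace ((0 + 2 * PI) / 2) with PI by field; rewrite cos_PI.
rewrite Cmod_R, Rabs_pos_eq by lra; reim.
pose proof (sqrt_lt_R0 r Hr); lra.
Qed.

(** On the left the argument is not rotated and lies in [[0, PI]], so the root is in the closed
    first quadrant; if the root is 0, both signs agree. *)
Lemma nu_left_real (k : C) (r : R) : Re k < 0 -> (1 - k * k)%C = r ->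
  nu eps k = if Rle_dec 0 r then RtoC (sqrt r) else (Ci * sqrt (- r))%C.
Proof.
intros Hk E; pose proof PI_RGT_0.
set (c := if Rle_dec 0 r then RtoC (sqrt r) else (Ci * sqrt (- r))%C).
assert (Hs : (nu eps k * nu eps k)%C = (c * c)%C).
{ rewrite nu_sqr, E by lra; unfold c; destruct (Rle_dec 0 r) as [Hr | Hr].
  - rewrite <- RtoC_mult, sqrt_sqrt; trivial.
  - replace (Ci * sqrt (- r) * (Ci * sqrt (- r)))%C with ((Ci * Ci) * (sqrt (- r) * sqrt (- r)))%C by ring.
    rewrite Ci_sqr, <- RtoC_mult, sqrt_sqrt, RtoC_opp by lra; ring. }
assert (Hnu : nu eps k = (sqrt (Cmod r) * cos (arg0 r / 2), sqrt (Cmod r) * sin (arg0 r / 2))).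
{ unfold nu; destruct (Rlt_dec (Re k) 0) as [_ | Hn]; [| lra].
  rewrite sqrt_rot_eq; replace (1 - k ^ 2)%C with (RtoC r) by (rewrite <- E; simpl; ring).
  destruct (arg0_real r) as [_ Ha].
  unfold arg_rot; destruct (Rlt_dec (arg0 r) 0) as [Hn | _]; [lra | reflexivity]. }
destruct (arg0_real r) as [A0 A1].
assert (Hc0 : 0 <= cos (arg0 r / 2)) by (apply cos_ge_0; lra).
assert (Hs0 : 0 <= sin (arg0 r / 2)) by (apply sin_ge_0; lra).
pose proof (sqrt_pos (Cmod r)) as Hq.
destruct (C_sqr_eq _ _ Hs) as [H' | H']; [exact H' |].
assert (Hre : 0 <= Re (nu eps k)) by (rewrite Hnu; simpl; now apply Rmult_le_pos).
assert (Him : 0 <= Im (nu eps k)) by (rewrite Hnu; simpl; now apply Rmult_le_pos).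
rewrite H' in Hre, Him |- *; unfold c in *; destruct (Rle_dec 0 r) as [Hr | Hr].
- reim_in Hre; pose proof (sqrt_pos r); assert (E0 : sqrt r = 0) by lra; rewrite E0; ring.
- reim_in Him; pose proof (sqrt_pos (- r)); assert (E0 : sqrt (- r) = 0) by lra; rewrite E0; ring.
Qed.

(** Points of the two branches of the hyperbola at equal height are the two roots for one real value
    of [z]. *)
Lemma hyperbola_roots (u : R) (h := sqrt (/ 2 + u ^ 2)) :
  (((h, u) : C) * (h, u) + ((- h)%R, u) * ((- h)%R, u))%C = 1%C /\
  (((h, u) : C) * (h, u) * (((- h)%R, u) * ((- h)%R, u)))%C = RtoC (/ 4 + 2 * u ^ 2 + 4 * u ^ 4).
Proof.
destruct (hyperbola u) as [_ [Hh _]]; fold h in Hh.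
split; apply C_ext; simpl; try ring.
- replace (h * h - u * u + (- h * - h - u * u)) with (2 * (h * h) - 2 * (u * u)) by ring.
  rewrite Hh; field.
- replace ((h * h - u * u) * (- h * - h - u * u) - (h * u + u * h) * (- h * u + u * - h))
    with (h * h * (h * h) + 2 * (h * h) * (u * u) + u * u * (u * u)) by ring.
  rewrite Hh; field.
Qed.

(** The argument of [1 - k^2] lies in [[PI, 2 PI]], beyond [eps], so half of it has a nonpositive
    cosine and [nu] lies on the left. *)
Lemma nu_bd3 (u : R) : 0 < u -> nu eps (bd3 u) = bd5 u.
Proof.
intros Hu; unfold bd3, bd5; pose proof PI_RGT_0.
destruct (hyperbola u) as [H0 [Hh _]]; destruct (hyperbola_roots u) as [Hr _].
set (h := sqrt (/ 2 + u ^ 2)) in *.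
set (k := ((h, u) : C)) in *; set (c := (((- h)%R, u) : C)) in *.
assert (Hs : (nu eps k * nu eps k)%C = (c * c)%C) by (rewrite nu_sqr by lra; rewrite <- Hr; ring).
destruct (C_sqr_eq _ _ Hs) as [H' | H']; [exact H' | exfalso].
apply (f_equal Re) in H'; revert H'; unfold nu.
destruct (Rlt_dec (Re k) 0) as [Hn | _]; [simpl in Hn; lra |].
assert (HIm : Im (1 - k ^ 2)%C = - (2 * h * u)) by (unfold k, Im; simpl; ring).
rewrite sqrt_rot_eq; unfold arg_rot.
assert (Ha : PI <= arg0 (1 - k ^ 2) <= 2 * PI).
{ unfold arg0; rewrite HIm; destruct (Rle_dec 0 (- (2 * h * u))) as [Hn | _]; [nra |].
  pose proof (acos_bound (Re (1 - k ^ 2) / Cmod (1 - k ^ 2))); lra. }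
destruct (Rlt_dec (arg0 (1 - k ^ 2)) eps) as [Hn | _]; [lra |].
assert (Hc : cos (arg0 (1 - k ^ 2) / 2) <= 0) by (apply cos_le_0; lra).
pose proof (sqrt_pos (Cmod (1 - k ^ 2))); unfold c; reim; nra.
Qed.

Lemma nu_bd5 (u : R) : 0 < u -> nu eps (bd5 u) = bd3 u.
Proof.
intros Hu; unfold bd3, bd5; pose proof PI_RGT_0.
destruct (hyperbola u) as [H0 [Hh _]]; destruct (hyperbola_roots u) as [Hr _].
set (h := sqrt (/ 2 + u ^ 2)) in *.
set (k := (((- h)%R, u) : C)) in *; set (c := ((h, u) : C)) in *.
assert (Hs : (nu eps k * nu eps k)%C = (c * c)%C) by (rewrite nu_sqr by lra; rewrite <- Hr; ring).
destruct (C_sqr_eq _ _ Hs) as [H' | H']; [exact H' | exfalso].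
apply (f_equal Re) in H'; revert H'; unfold nu.
destruct (Rlt_dec (Re k) 0) as [_ | Hn]; [| simpl in Hn; lra].
assert (HIm : Im (1 - k ^ 2)%C = 2 * h * u) by (unfold k, Im; simpl; ring).
rewrite sqrt_rot_eq; unfold arg_rot.
assert (Ha : 0 <= arg0 (1 - k ^ 2) <= PI).
{ unfold arg0; rewrite HIm; destruct (Rle_dec 0 (2 * h * u)) as [_ | Hn]; [| nra].
  apply acos_bound. }
destruct (Rlt_dec (arg0 (1 - k ^ 2)) 0) as [Hn | _]; [lra |].
assert (Hc : 0 <= cos (arg0 (1 - k ^ 2) / 2)) by (apply cos_ge_0; lra).
pose proof (sqrt_pos (Cmod (1 - k ^ 2))); unfold c; reim; nra.
Qed.

(** With [v = nu k] the other root, [dtau = - 2 k (k - v) (k + v) dk]. The factor [k - v] cancels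
    the denominator of [wave], and the remaining factors are those of [G]. *)
Lemma kernel_on_path (g0 g1 : R -> C) (T x t : R) (k v dk : C) (tau dtau : R) :
  nu eps k = v -> (k * k + v * v)%C = 1%C -> (k * k * (v * v))%C = RtoC tau ->
  (k - v)%C <> 0%C -> RtoC dtau = ((2 * k - 4 * (k * k * k)) * dk)%C ->
  (E k x t * G eps g0 g1 k T * dk)%C =
  (/ (2 * PI) * (dtau * wave x t (ttransform g1 (Ci * tau) T) (ttransform g0 (Ci * tau) T) k v tau))%C.
Proof.
intros Hv H1 H2 Hd Hdt; unfold E, G; rewrite Hv, (w_root tau k v H1 H2).
set (A := ttransform g1 (Ci * tau) T); set (B := ttransform g0 (Ci * tau) T).
unfold wave; rewrite Hdt.
replace (Ci * k * x - Ci * tau * t)%C with (- Ci * tau * t + Ci * k * x)%C by ring.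
rewrite Cexp_plus.
replace (2 * k - 4 * (k * k * k))%C with (- 2 * k * (k - v) * (k + v))%C.
2:{ replace (- 2 * k * (k - v) * (k + v))%C with (2 * k * (v * v) - 2 * (k * k * k))%C by ring.
    replace (v * v)%C with (1 - k * k)%C by (rewrite <- H1; ring); ring. }
set (e1 := Cexp (- Ci * tau * t)); set (e2 := Cexp (Ci * k * x)).
assert (HPI : RtoC PI <> 0%C).
{ apply RtoC_neq_0, PI_neq0. }
assert (Hw : (e2 * (A - Ci * v * B) / (Ci * (k - v)))%C = (- (e2 * (Ci * A + v * B)) / (k - v))%C).
{ replace (Ci * A + v * B)%C with (Ci * (A - Ci * v * B))%C.
  - replace (- (e2 * (Ci * (A - Ci * v * B))) / (k - v))%C
      with (- (Ci * Ci) * (e2 * (A - Ci * v * B)) / (Ci * (k - v)))%C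
      by (field; split; [exact Hd | apply Ci_neq_0]).
    rewrite Ci_sqr; field; split; [exact Hd | apply Ci_neq_0].
  - replace (Ci * (A - Ci * v * B))%C with (Ci * A - (Ci * Ci) * (v * B))%C by ring.
    rewrite Ci_sqr; ring. }
rewrite Hw; field; split; [exact Hd | exact HPI].
Qed.

End branches.

(** * Improper integrals and substitution along the arcs *)

Lemma tail_small (h : R -> C) (c a b : R) : 0 < a <= b -> (forall u, ccont h u) ->
  (forall u, a <= u -> Cmod (h u) <= c / u ^ 2) -> 0 <= c -> Cmod (CInt h a b) <= c / a.
Proof.
intros Hab Hc Hb Hc0.
replace (CInt h a b) with (CInt h a b - CInt h a a)%C by (rewrite CInt_point; ring).
assert (HQ : forall s, 0 < s -> is_derive (fun s => - (c / s)) s (c / s ^ 2)).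
{ intros s Hs; auto_derive; [lra |]; field; lra. }
apply Rle_trans with (- (c / b) - - (c / a)).
- apply (cderive_mean_value (fun s => CInt h a s) h (fun s => - (c / s)) (fun s => c / s ^ 2)); [lra | | | | |].
  + intros s _; now apply ccont_CInt_bound.
  + intros s Hs; apply (ex_derive_continuous (V := R_NormedModule)); eexists; apply HQ; lra.
  + intros s _; now apply cderive_CInt.
  + intros s Hs; apply HQ; lra.
  + intros s Hs; apply Hb; lra.
- assert (0 <= c / b) by (apply Rdiv_le_0_compat; lra); lra.
Qed.

(** The Cauchy criterion, with tails bounded by [c / u]. *)
Lemma integral_tail_limit (h : R -> C) (c : R) : (forall u, ccont h u) -> 0 <= c ->
  (forall u, 1 <= u -> Cmod (h u) <= c / u ^ 2) ->
  exists l : C, forall e, 0 < e -> exists R0, 0 < R0 /\ forall r, R0 <= r -> Cmod (CInt h 0 r - l) < e.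
Proof.
intros Hc Hc0 Hb.
assert (Hcauchy : exists l : C_R_CompleteNormedModule,
  filterlim (fun r => CInt h 0 r) (Rbar_locally p_infty) (locally l)).
{ apply (filterlim_locally_cauchy (U := C_R_CompleteNormedModule)); intros eps.
  exists (fun r => Rmax 1 (c / eps + c) < r); split; [now exists (Rmax 1 (c / eps + c)) |].
  assert (Hgen : forall u v, Rmax 1 (c / eps + c) < u -> u <= v -> Cmod (CInt h 0 v - CInt h 0 u) < eps).
  { intros u v Hu Huv; pose proof (Rmax_l 1 (c / eps + c)); pose proof (Rmax_r 1 (c / eps + c)).
    rewrite <- (CInt_Chasles h 0 u v Hc).
    replace (CInt h 0 u + CInt h u v - CInt h 0 u)%C with (CInt h u v) by ring.
    apply Rle_lt_trans with (c / u).
    - apply tail_small; [lra | exact Hc | | exact Hc0]; intros; apply Hb; lra.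
    - pose proof (cond_pos eps) as He.
      apply Rmult_lt_reg_r with u; [lra |]; replace (c / u * u) with c by (field; lra).
      assert (Hq : eps * (c / eps) = c) by (field; lra).
      assert (0 <= c / eps) by (apply Rdiv_le_0_compat; lra).
      destruct (Req_dec c 0) as [-> | Hn]; nra. }
  assert (Hball : forall u v : C, Cmod (v - u) < eps -> @ball C_UniformSpace u eps v).
  { intros u v H; split.
    - eapply Rle_lt_trans; [apply (re_le_Cmod (v - u)) | exact H].
    - eapply Rle_lt_trans; [apply (Im_le_Cmod (v - u)) | exact H]. }
  intros u v Hu Hv; destruct (Rle_lt_dec u v) as [Huv | Huv].
  - apply Hball; now apply Hgen.
  - apply ball_sym, Hball; apply Hgen; [assumption | lra]. }
destruct Hcauchy as [l Hl]; exists l; intros e He.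
assert (He2 : 0 < e / 2) by lra.
destruct (Hl _ (locally_ball l (mkposreal _ He2))) as [M HM].
exists (Rabs M + 1); pose proof (Rabs_pos M); split; [lra |]; intros r Hr.
assert (HMr : M < r) by (pose proof (Rle_abs M); lra).
destruct (HM r HMr) as [B1 B2].
change (Rabs (Re (CInt h 0 r) - Re l) < e / 2) in B1.
change (Rabs (Im (CInt h 0 r) - Im l) < e / 2) in B2.
eapply Rle_lt_trans; [apply Cmod_le_abs |]; rewrite Re_minus, Im_minus; lra.
Qed.

Lemma locally_C_intro (P : C -> Prop) (l : C) : locally (T := C_UniformSpace) l P ->
  exists e : R, 0 < e /\ forall z, Cmod (z - l) < e -> P z.
Proof.
intros [eps HP]; exists eps; split; [apply cond_pos |]; intros z Hz; apply HP; split.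
- eapply Rle_lt_trans; [apply (re_le_Cmod (z - l)) | exact Hz].
- eapply Rle_lt_trans; [apply (Im_le_Cmod (z - l)) | exact Hz].
Qed.

Lemma is_RInt_gen_p_infty (f : R -> C) (I : R -> C) (a : R) (l : C) :
  (forall r, a <= r -> is_RInt (V := C_R_NormedModule) f a r (I r)) ->
  (forall e, 0 < e -> exists R0, forall r, R0 <= r -> Cmod (I r - l) < e) ->
  is_RInt_gen (V := C_R_NormedModule) f (at_point a) (Rbar_locally p_infty) l.
Proof.
intros Hf Hl P HP; apply locally_C_intro in HP; destruct HP as [e [He HP]].
destruct (Hl e He) as [R0 HR].
apply (Filter_prod _ _ _ (fun u => u = a) (fun r => Rmax a R0 < r)).
- reflexivity.
- now exists (Rmax a R0).
- intros u r -> Hr; pose proof (Rmax_l a R0); pose proof (Rmax_r a R0).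
  exists (I r); split; [apply Hf; lra | apply HP, HR; lra].
Qed.

Lemma is_RInt_gen_m_infty (f : R -> C) (I : R -> C) (b : R) (l : C) :
  (forall r, r <= b -> is_RInt (V := C_R_NormedModule) f r b (I r)) ->
  (forall e, 0 < e -> exists R0, forall r, r <= R0 -> Cmod (I r - l) < e) ->
  is_RInt_gen (V := C_R_NormedModule) f (Rbar_locally m_infty) (at_point b) l.
Proof.
intros Hf Hl P HP; apply locally_C_intro in HP; destruct HP as [e [He HP]].
destruct (Hl e He) as [R0 HR].
apply (Filter_prod _ _ _ (fun r => r < Rmin b R0) (fun u => u = b)).
- now exists (Rmin b R0).
- reflexivity.
- intros r u Hr ->; pose proof (Rmin_l b R0); pose proof (Rmin_r b R0).
  exists (I r); split; [apply Hf; lra | apply HP, HR; lra].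
Qed.

(** The integrand is compared in the open segment, which keeps the branch values of [nu] at the
    corners of the boundary out of the argument. *)
Lemma path_segment (F h : R -> C) (tau dtau : R -> R) (c : C) (a b : R) : a <= b ->
  (forall u, ccont h u) ->
  (forall u, is_derive tau u (dtau u)) -> (forall u, continuous dtau u) ->
  (forall u, a < u < b -> F u = (c * (dtau u * h (tau u)))%C) ->
  is_RInt (V := C_R_NormedModule) F a b (c * CInt h (tau a) (tau b))%C.
Proof.
intros Hab Hh Hd Hdc HF.
assert (Hct : forall u, continuous tau u).
{ intros u; apply (ex_derive_continuous (V := R_NormedModule)); eexists; apply Hd. }
assert (Hcc : forall u, ccont (fun u => (dtau u * h (tau u))%C) u).
{ cont. }
apply (is_RInt_ext (V := C_R_NormedModule) (fun u => (c * (dtau u * h (tau u)))%C)).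
- rewrite Rmin_left, Rmax_right by exact Hab; intros u Hu; symmetry; now apply HF.
- rewrite <- (CInt_comp h tau dtau a b Hab Hh) by (intros; split; [apply Hd | apply Hdc]).
  rewrite <- CInt_mult by exact Hcc.
  apply CInt_correct; intros; apply ccont_mult; [apply ccont_const | apply Hcc].
Qed.

(** [h] may be negative, so the identity serves both branches of the hyperbola. *)
Lemma hyperbola_speed (h u : R) : h * h = / 2 + u ^ 2 ->
  ((2 * (h, u) - 4 * ((h, u) * (h, u) * (h, u))) * ((u / h)%R, 1%R))%C = RtoC (4 * u + 16 * u ^ 3).
Proof.
intros Hh; assert (h <> 0) by nra.
assert (E : (((h, u) : C) * (h, u))%C = (/ 2, 2 * (h * u))).
{ apply C_ext; simpl; [rewrite Hh; simpl; ring | ring]. }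
rewrite E; apply C_ext; simpl.
- replace (_ - _) with (8 * u ^ 3 + 8 * (h * h) * u) by (field; assumption); rewrite Hh; simpl; field.
- field; assumption.
Qed.

(** * The integral over the boundary of [Dplus] *)

Section contour.
Variables (T K : R) (Y : nat -> nat -> R -> R -> C).
Hypothesis HT : 0 < T.
Hypothesis HY : extended_solution 20 T K Y.
Variables x t b : R.
Hypothesis Hx : 0 < x.
Hypothesis Ht : 0 < t < T.
Hypothesis Hb : b < T.
Hypothesis Hsupp : forall s, b < s < T -> Y 0%nat 0%nat 0 s = 0%C /\ Y 1%nat 0%nat 0 s = 0%C.
Variable eps : R.
Hypothesis Heps : 0 < eps < PI.
Variables g0 g1 : R -> C.
Hypothesis Hg0 : forall s, 0 < s < T -> Y 0%nat 0%nat 0 s = g0 s.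
Hypothesis Hg1 : forall s, 0 < s < T -> Y 1%nat 0%nat 0 s = g1 s.

Let h1 (u : R) : C := first_wave T Y x t u.
Let h2 (u : R) : C := second_wave T Y x t u.
Let f (k : C) : C := (E k x t * G eps g0 g1 k T)%C.

Lemma ttransform_lap (z : C) :
  ttransform g1 (Ci * z) T = lap (Y 1%nat 0%nat 0) T z /\
  ttransform g0 (Ci * z) T = lap (Y 0%nat 0%nat 0) T z.
Proof.
split; apply CInt_ext; try lra; intros s Hs.
- now rewrite Hg1.
- now rewrite Hg0.
Qed.

Lemma kernel_first_root (k v dk : C) (tau dtau : R) :
  nu eps k = v -> (k * k + v * v)%C = 1%C -> (k * k * (v * v))%C = RtoC tau ->
  RtoC dtau = ((2 * k - 4 * (k * k * k)) * dk)%C ->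
  0 <= Re (k - v) -> 0 <= Im (k - v) -> 0 <= Im (k + v) -> Re (k + v) <= 0 ->
  Re (k * v) <= 0 -> Im (k * v) <= 0 ->
  (f k * dk)%C = (/ (2 * PI) * (dtau * h1 tau))%C.
Proof.
intros Hv E1 E2 E3 D1 D2 R1 R2 Q1 Q2.
destruct (roots_unique k v E1 D1 D2 R1 R2 Q1 Q2) as [K1 K2]; rewrite E2 in K1, K2.
destruct (ttransform_lap tau) as [T1 T0].
unfold f; rewrite (kernel_on_path eps g0 g1 T x t k v dk tau dtau Hv E1 E2); [| | exact E3].
- unfold h1, first_wave; rewrite K1, K2, T1, T0; reflexivity.
- rewrite <- K1, <- K2; apply k1_minus_k2_neq_0.
Qed.

Lemma kernel_second_root (k v dk : C) (tau dtau : R) :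
  nu eps k = v -> (v * v + k * k)%C = 1%C -> (v * v * (k * k))%C = RtoC tau ->
  RtoC dtau = ((2 * k - 4 * (k * k * k)) * dk)%C ->
  0 <= Re (v - k) -> 0 <= Im (v - k) -> 0 <= Im (v + k) -> Re (v + k) <= 0 ->
  Re (v * k) <= 0 -> Im (v * k) <= 0 ->
  (f k * dk)%C = (/ (2 * PI) * (dtau * h2 tau))%C.
Proof.
intros Hv E1 E2 E3 D1 D2 R1 R2 Q1 Q2.
destruct (roots_unique v k E1 D1 D2 R1 R2 Q1 Q2) as [K1 K2]; rewrite E2 in K1, K2.
destruct (ttransform_lap tau) as [T1 T0].
unfold f; rewrite (kernel_on_path eps g0 g1 T x t k v dk tau dtau Hv); [| | | | exact E3].
- unfold h2, second_wave; rewrite K1, K2, T1, T0; reflexivity.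
- rewrite Cplus_comm; exact E1.
- rewrite Cmult_comm; exact E2.
- rewrite <- K1, <- K2; apply k2_minus_k1_neq_0.
Qed.

(** These functions are [k^2 - k^4] along the arcs. They carry [bd1], [bd2], [bd3] onto [(-oo, 0]],
    [[0, 1/4]], [[1/4, +oo)] and [bd4], [bd5] onto [(-oo, 1/4]], [[1/4, +oo)], so each component of
    the boundary covers the real line once, from left to right. *)
Definition tau_im (u : R) : R := - (u ^ 2 + u ^ 4).
Definition tau_re (u : R) : R := u ^ 2 - u ^ 4.
Definition tau_hyp (u : R) : R := / 4 + 2 * u ^ 2 + 4 * u ^ 4.

Definition on_arc (gamma : R -> C) (tau dtau : R -> R) (h : R -> C) (u : R) : Prop :=
  (f (gamma u) * CDerive gamma u)%C = (/ (2 * PI) * (dtau u * h (tau u)))%C.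

Lemma arc_bd1 (u : R) : u < 0 -> on_arc bd1 tau_im (fun u => - (2 * u + 4 * u ^ 3)) h1 u.
Proof.
intros Hu; unfold on_arc.
assert (HD : CDerive bd1 u = (0, -1)) by (unfold bd1; apply CDerive_pair; auto_derive; trivial; ring).
rewrite HD.
assert (Hr : 0 < 1 + u ^ 2) by nra.
assert (Hq : sqrt (1 + u ^ 2) * sqrt (1 + u ^ 2) = 1 + u ^ 2) by (apply sqrt_sqrt; lra).
pose proof (sqrt_lt_R0 _ Hr) as Hp.
assert (Hnu : nu eps (bd1 u) = RtoC (- sqrt (1 + u ^ 2))).
{ apply nu_right_real; [exact Heps | simpl; lra | exact Hr |]; apply C_ext; simpl; ring. }
set (q := sqrt (1 + u ^ 2)) in *; clearbody q.
apply kernel_first_root with (RtoC (- q)); [exact Hnu |..]; unfold bd1, tau_im.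
- rewrite <- RtoC_mult; replace (- q * - q) with (1 + u ^ 2) by lra; apply C_ext; simpl; ring.
- rewrite <- RtoC_mult; replace (- q * - q) with (1 + u ^ 2) by lra; apply C_ext; simpl; ring.
- apply C_ext; simpl; ring.
- simpl; nra.
- simpl; nra.
- simpl; nra.
- simpl; nra.
- simpl; nra.
- simpl; nra.
Qed.

Lemma arc_bd2 (u : R) : 0 < u < / sqrt 2 -> on_arc bd2 tau_re (fun u => 2 * u - 4 * u ^ 3) h1 u.
Proof.
intros Hu; unfold on_arc; pose proof inv_sqrt2 as [S0 S2].
assert (HD : CDerive bd2 u = (1, 0)) by (unfold bd2; apply CDerive_pair; auto_derive; trivial; ring).
rewrite HD.
assert (Hu2 : u * u < / 2) by nra.
assert (Hr : 0 < 1 - u ^ 2) by nra.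
assert (Hq : sqrt (1 - u ^ 2) * sqrt (1 - u ^ 2) = 1 - u ^ 2) by (apply sqrt_sqrt; lra).
pose proof (sqrt_lt_R0 _ Hr) as Hp.
assert (Hle : u <= sqrt (1 - u ^ 2)) by nra.
assert (Hnu : nu eps (bd2 u) = RtoC (- sqrt (1 - u ^ 2))).
{ apply nu_right_real; [exact Heps | simpl; lra | exact Hr |]; apply C_ext; simpl; ring. }
set (q := sqrt (1 - u ^ 2)) in *; clearbody q.
apply kernel_first_root with (RtoC (- q)); [exact Hnu |..]; unfold bd2, tau_re.
- rewrite <- RtoC_mult; replace (- q * - q) with (1 - u ^ 2) by lra; apply C_ext; simpl; ring.
- rewrite <- RtoC_mult; replace (- q * - q) with (1 - u ^ 2) by lra; apply C_ext; simpl; ring.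
- apply C_ext; simpl; ring.
- simpl; nra.
- simpl; nra.
- simpl; nra.
- simpl; nra.
- simpl; nra.
- simpl; nra.
Qed.

Lemma arc_bd4 (u : R) : u < - / sqrt 2 -> on_arc bd4 tau_re (fun u => 2 * u - 4 * u ^ 3) h2 u.
Proof.
intros Hu; unfold on_arc; pose proof inv_sqrt2 as [S0 S2].
assert (HD : CDerive bd4 u = (1, 0)) by (unfold bd4; apply CDerive_pair; auto_derive; trivial; ring).
rewrite HD.
assert (Hu2 : / 2 < u * u) by nra.
pose proof (nu_left_real eps Heps (bd4 u) (1 - u ^ 2) ltac:(simpl; lra)
  ltac:(apply C_ext; simpl; ring)) as Hnu.
(* The partner root is real up to [u = -1] and purely imaginary beyond. *)
destruct (Rle_dec 0 (1 - u ^ 2)) as [Hr | Hr].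
- assert (Hq : sqrt (1 - u ^ 2) * sqrt (1 - u ^ 2) = 1 - u ^ 2) by (apply sqrt_sqrt; lra).
  pose proof (sqrt_pos (1 - u ^ 2)) as Hp.
  assert (Hle : sqrt (1 - u ^ 2) <= - u) by nra.
  set (q := sqrt (1 - u ^ 2)) in *; clearbody q.
  apply kernel_second_root with (RtoC q); [exact Hnu |..]; unfold bd4, tau_re.
  + rewrite <- RtoC_mult, Hq; apply C_ext; simpl; ring.
  + rewrite <- RtoC_mult, Hq; apply C_ext; simpl; ring.
  + apply C_ext; simpl; ring.
  + simpl; nra.
  + simpl; nra.
  + simpl; nra.
  + simpl; nra.
  + simpl; nra.
  + simpl; nra.
- apply Rnot_le_lt in Hr.
  assert (Hq : sqrt (- (1 - u ^ 2)) * sqrt (- (1 - u ^ 2)) = - (1 - u ^ 2)) by (apply sqrt_sqrt; lra).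
  pose proof (sqrt_pos (- (1 - u ^ 2))) as Hp.
  set (q := sqrt (- (1 - u ^ 2))) in *; clearbody q.
  assert (Hcc : (Ci * q * (Ci * q))%C = RtoC (1 - u ^ 2)).
  { replace (Ci * q * (Ci * q))%C with ((Ci * Ci) * (q * q))%C by ring.
    rewrite Ci_sqr, <- RtoC_mult, Hq, RtoC_opp; ring. }
  apply kernel_second_root with (Ci * q)%C; [exact Hnu |..]; unfold bd4, tau_re.
  + rewrite Hcc; apply C_ext; simpl; ring.
  + rewrite Hcc; apply C_ext; simpl; ring.
  + apply C_ext; simpl; ring.
  + simpl; nra.
  + simpl; nra.
  + simpl; nra.
  + simpl; nra.
  + simpl; nra.
  + simpl; nra.
Qed.

Lemma arc_bd3 (u : R) : 0 < u -> on_arc bd3 tau_hyp (fun u => 4 * u + 16 * u ^ 3) h1 u.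
Proof.
intros Hu; unfold on_arc.
destruct (hyperbola u) as [H0 [Hh Hl]]; rewrite Rabs_pos_eq in Hl by lra.
assert (HD : CDerive bd3 u = (u / sqrt (/ 2 + u ^ 2), 1)).
{ unfold bd3; apply CDerive_pair; [apply hyperbola_derive | auto_derive; trivial; ring]. }
rewrite HD; destruct (hyperbola_roots u) as [E1 E2].
apply kernel_first_root with (bd5 u); [now apply nu_bd3 | exact E1 | exact E2 |..];
  unfold bd3, bd5, tau_hyp; set (h := sqrt (/ 2 + u ^ 2)) in *.
- rewrite hyperbola_speed by lra; reflexivity.
- simpl; nra.
- simpl; nra.
- simpl; nra.
- simpl; nra.
- simpl; nra.
- simpl; nra.
Qed.

Lemma arc_bd5 (u : R) : 0 < u -> on_arc bd5 tau_hyp (fun u => 4 * u + 16 * u ^ 3) h2 u.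
Proof.
intros Hu; unfold on_arc.
destruct (hyperbola u) as [H0 [Hh Hl]]; rewrite Rabs_pos_eq in Hl by lra.
assert (HD : CDerive bd5 u = (- (u / sqrt (/ 2 + u ^ 2)), 1)).
{ unfold bd5; apply CDerive_pair; [apply Rderive_opp, hyperbola_derive | auto_derive; trivial; ring]. }
rewrite HD; destruct (hyperbola_roots u) as [E1 E2].
apply kernel_second_root with (bd3 u); [now apply nu_bd5 | exact E1 | exact E2 |..];
  unfold bd3, bd5, tau_hyp; set (h := sqrt (/ 2 + u ^ 2)) in *.
- replace (- (u / h)) with (u / - h) by (field; lra); rewrite hyperbola_speed by nra; reflexivity.
- simpl; nra.
- simpl; nra.
- simpl; nra.
- simpl; nra.
- simpl; nra.
- simpl; nra.
Qed.

Lemma ccont_h (u : R) : ccont h1 u /\ ccont h2 u.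
Proof.
destruct (ccont_waves T K Y HY x t u) as [C1 C2].
split; apply (continuous_comp RtoC _ u (ccont_RtoC_id u)); assumption.
Qed.

Lemma h_bound : exists c : R, 0 <= c /\ forall u : R, 1 <= Rabs u ->
  Cmod (h1 u) <= c / u ^ 2 /\ Cmod (h2 u) <= c / u ^ 2.
Proof.
destruct (waves_bound T K Y HT HY x t Hx) as [c [Hc H]].
exists c; split; [exact Hc |]; intros u Hu.
specialize (H (RtoC u) ltac:(simpl; lra) Hu).
rewrite Im_RtoC, Re_RtoC, Rmult_0_l, exp_0, Rmult_1_r in H; exact H.
Qed.

Lemma two_sided_limits (h : R -> C) (c : R) : (forall u, ccont h u) -> 0 <= c ->
  (forall u, 1 <= Rabs u -> Cmod (h u) <= c / u ^ 2) ->
  exists m p : C, forall e, 0 < e -> exists R0, 0 < R0 /\ forall r, R0 <= r ->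
    Cmod (CInt h (- r) 0 - m) < e /\ Cmod (CInt h 0 r - p) < e.
Proof.
intros Hh Hc Hbd.
destruct (integral_tail_limit h c Hh Hc) as [p Hp].
{ intros u Hu; apply Hbd; rewrite Rabs_pos_eq; lra. }
destruct (integral_tail_limit (fun s => h (0 - s)) c) as [m Hm]; [| exact Hc | |].
{ cont. }
{ intros u Hu; replace (u ^ 2) with ((0 - u) ^ 2) by ring; apply Hbd.
  rewrite Rminus_0_l, Rabs_Ropp, Rabs_pos_eq; lra. }
exists m, p; intros e He.
destruct (Hp e He) as [R1 [HR1 H1']], (Hm e He) as [R2 [HR2 H2']].
exists (R1 + R2); split; [lra |]; intros r Hr; split; [| apply H1'; lra].
specialize (H2' r ltac:(lra)); rewrite CInt_reflect, Rminus_0_l in H2'; [exact H2' | lra | exact Hh].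
Qed.

Lemma is_derive_tau (u : R) :
  is_derive tau_im u (- (2 * u + 4 * u ^ 3)) /\ is_derive tau_re u (2 * u - 4 * u ^ 3) /\
  is_derive tau_hyp u (4 * u + 16 * u ^ 3).
Proof.
unfold tau_im, tau_re, tau_hyp; split; [| split]; auto_derive; trivial; simpl; ring.
Qed.

Lemma continuous_dtau (u : R) :
  continuous (fun u => - (2 * u + 4 * u ^ 3)) u /\ continuous (fun u => 2 * u - 4 * u ^ 3) u /\
  continuous (fun u => 4 * u + 16 * u ^ 3) u.
Proof.
split; [| split]; apply (ex_derive_continuous (V := R_NormedModule)); auto_derive; trivial.
Qed.

Lemma contour_integral : is_int_bdDplus f (Y 0%nat 0%nat x t).
Proof.
pose proof inv_sqrt2 as [S0 S2]; pose proof PI_RGT_0 as Hpi.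
assert (C1 : forall u, ccont h1 u) by (intros u; exact (proj1 (ccont_h u))).
assert (C2 : forall u, ccont h2 u) by (intros u; exact (proj2 (ccont_h u))).
destruct h_bound as [c [Hc Hcb]].
destruct (two_sided_limits h1 c C1 Hc) as [m1 [p1 L1]]; [intros u Hu; exact (proj1 (Hcb u Hu)) |].
destruct (two_sided_limits h2 c C2 Hc) as [m2 [p2 L2]]; [intros u Hu; exact (proj2 (Hcb u Hu)) |].
set (q := (/ (2 * PI))%C).
assert (Hpi0 : RtoC PI <> 0%C) by (apply RtoC_neq_0; lra).
assert (Hq : Cmod q <= 1).
{ unfold q; rewrite Cmod_inv by (apply Cmult_neq_0; [apply two_neq_0 | exact Hpi0]).
  rewrite <- RtoC_mult, Cmod_R, Rabs_pos_eq by lra.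
  apply Rle_trans with (/ 1); [apply Rinv_le_contravar; [lra |] | lra].
  pose proof PI2_1; unfold PI2 in *; lra. }
assert (Hscale : forall (u v : C) e, Cmod (u - v) < e -> Cmod (q * u - q * v) < e).
{ intros u v e H; replace (q * u - q * v)%C with (q * (u - v))%C by ring; rewrite Cmod_mult.
  pose proof (Cmod_ge_0 (u - v)); nra. }
assert (Ti0 : tau_im 0 = 0) by (unfold tau_im; ring).
assert (Tr0 : tau_re 0 = 0) by (unfold tau_re; ring).
assert (Tr1 : tau_re (/ sqrt 2) = / 4).
{ unfold tau_re; replace ((/ sqrt 2) ^ 2 - (/ sqrt 2) ^ 4) with
    ((/ sqrt 2 * / sqrt 2) - (/ sqrt 2 * / sqrt 2) * (/ sqrt 2 * / sqrt 2)) by ring; rewrite S2; field. }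
assert (Tr2 : tau_re (- / sqrt 2) = / 4) by (rewrite <- Tr1; unfold tau_re; ring).
assert (Th0 : tau_hyp 0 = / 4) by (unfold tau_hyp; ring).
assert (Th : forall r, 1 <= r -> r <= tau_hyp r) by (intros; unfold tau_hyp; nra).
assert (Ti : forall r, r <= -2 -> tau_im r <= r) by (intros; unfold tau_im; nra).
assert (Tr : forall r, r <= -2 -> tau_re r <= r).
{ intros r Hr; unfold tau_re; replace (r ^ 2 - r ^ 4) with (r ^ 2 * (1 - r ^ 2)) by ring.
  assert (4 <= r ^ 2) by nra; nra. }
assert (Hup : forall gamma (h : R -> C) p, (forall u, ccont h u) ->
  (forall u, 0 < u -> on_arc gamma tau_hyp (fun u => 4 * u + 16 * u ^ 3) h u) ->
  (forall e, 0 < e -> exists R0, 0 < R0 /\ forall r, R0 <= r -> Cmod (CInt h 0 r - p) < e) ->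
  is_path_int f gamma (at_point 0) (Rbar_locally p_infty) (q * (p - CInt h 0 (/ 4)))%C).
{ intros gamma h p Ch Harc Hp.
  apply is_RInt_gen_p_infty with (fun r => (q * CInt h (tau_hyp 0) (tau_hyp r))%C).
  - intros r Hr; apply path_segment with (fun u => 4 * u + 16 * u ^ 3); trivial;
      [intros; apply is_derive_tau | intros; apply continuous_dtau |].
    intros u Hu; apply Harc; lra.
  - rewrite Th0; intros e He; destruct (Hp e He) as [R0 [HR0 H]].
    exists (R0 + 1); intros r Hr; apply Hscale; specialize (Th r ltac:(lra)).
    specialize (H (tau_hyp r) ltac:(lra)); rewrite <- (CInt_Chasles h 0 (/ 4) (tau_hyp r) Ch) in H.
    replace (CInt h (/ 4) (tau_hyp r) - (p - CInt h 0 (/ 4)))%C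
      with (CInt h 0 (/ 4) + CInt h (/ 4) (tau_hyp r) - p)%C by ring; exact H. }
assert (Hdown : forall gamma (h : R -> C) m tau dtau b0, (forall u, ccont h u) ->
  (forall u, is_derive tau u (dtau u)) -> (forall u, continuous dtau u) ->
  (forall r, r <= -2 -> tau r <= r) -> (forall u, u < b0 -> on_arc gamma tau dtau h u) ->
  (forall e, 0 < e -> exists R0, 0 < R0 /\ forall r, R0 <= r -> Cmod (CInt h (- r) 0 - m) < e) ->
  is_path_int f gamma (Rbar_locally m_infty) (at_point b0) (q * (m + CInt h 0 (tau b0)))%C).
{ intros gamma h m tau dtau b0 Ch Hd Hdc Hle Harc Hm.
  apply is_RInt_gen_m_infty with (fun r => (q * CInt h (tau r) (tau b0))%C).
  - intros r Hr; apply path_segment with dtau; trivial; intros u Hu; apply Harc; lra.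
  - intros e He; destruct (Hm e He) as [R0 [HR0 H]].
    exists (- (R0 + 2)); intros r Hr; apply Hscale; specialize (Hle r ltac:(lra)).
    specialize (H (- tau r) ltac:(lra)); rewrite Ropp_involutive in H.
    rewrite <- (CInt_Chasles h (tau r) 0 (tau b0) Ch).
    replace (CInt h (tau r) 0 + CInt h 0 (tau b0) - (m + CInt h 0 (tau b0)))%C
      with (CInt h (tau r) 0 - m)%C by ring; exact H. }
assert (Hsplit : forall (h : R -> C) m p,
  (forall e, 0 < e -> exists R0, 0 < R0 /\ forall r, R0 <= r ->
    Cmod (CInt h (- r) 0 - m) < e /\ Cmod (CInt h 0 r - p) < e) ->
  (forall e, 0 < e -> exists R0, 0 < R0 /\ forall r, R0 <= r -> Cmod (CInt h (- r) 0 - m) < e) /\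
  (forall e, 0 < e -> exists R0, 0 < R0 /\ forall r, R0 <= r -> Cmod (CInt h 0 r - p) < e)).
{ intros h m p H; split; intros e He; destruct (H e He) as [R0 [HR0 HR]];
    exists R0; (split; [exact HR0 |]); intros r Hr; apply (HR r Hr). }
destruct (Hsplit _ _ _ L1) as [M1 P1], (Hsplit _ _ _ L2) as [M2 P2].
exists (q * (m1 + CInt h1 0 (tau_im 0)))%C, (q * CInt h1 (tau_re 0) (tau_re (/ sqrt 2)))%C,
  (q * (p1 - CInt h1 0 (/ 4)))%C, (q * (m2 + CInt h2 0 (tau_re (- / sqrt 2))))%C,
  (q * (p2 - CInt h2 0 (/ 4)))%C.
split; [| split; [| split; [| split; [| split]]]].
- apply (Hdown _ _ _ _ (fun u => - (2 * u + 4 * u ^ 3))); trivial;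
    [intros; apply is_derive_tau | intros; apply continuous_dtau | exact arc_bd1].
- apply is_RInt_gen_at_point, path_segment with (fun u => 2 * u - 4 * u ^ 3); trivial;
    [lra | intros; apply is_derive_tau | intros; apply continuous_dtau | exact arc_bd2].
- apply Hup; trivial; exact arc_bd3.
- apply (Hdown _ _ _ _ (fun u => 2 * u - 4 * u ^ 3)); trivial;
    [intros; apply is_derive_tau | intros; apply continuous_dtau | exact arc_bd4].
- apply Hup; trivial; exact arc_bd5.
- rewrite Ti0, Tr0, Tr1, Tr2, CInt_point, Cplus_0_r; clear Hup Hdown Hsplit.
  (* The one-sided limits belong to the single waves, whereas [Phi_integral_limit] concerns
     symmetric integrals of their sum; all are compared at one common [r], with five errors
     [e / 5]. *)
  assert (HS : (m1 + p1 + m2 + p2 - 2 * PI * Y 0%nat 0%nat x t)%C = 0%C).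
  { apply Cmod_eq_0, Rle_antisym; [| apply Cmod_ge_0].
    apply le_epsilon; intros e He; assert (He5 : 0 < e / 5) by lra.
    destruct (L1 _ He5) as [R1 [HR1 HL1]], (L2 _ He5) as [R2 [HR2 HL2]].
    destruct (Phi_integral_limit T K Y HT HY x t b Hx Ht Hb Hsupp (e / 5) He5) as [R3 [HR3 HL3]].
    set (r := R1 + R2 + R3).
    destruct (HL1 r ltac:(unfold r; lra)) as [A1 A2], (HL2 r ltac:(unfold r; lra)) as [B1 B2].
    specialize (HL3 r ltac:(unfold r; lra)).
    change (Cmod (CInt (fun u => (h1 u + h2 u)%C) (- r) r - 2 * PI * Y 0%nat 0%nat x t) < e / 5) in HL3.
    rewrite CInt_plus in HL3 by assumption.
    rewrite <- (CInt_Chasles h1 (- r) 0 r C1), <- (CInt_Chasles h2 (- r) 0 r C2) in HL3.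
    set (a1 := CInt h1 (- r) 0) in *; set (a2 := CInt h1 0 r) in *.
    set (b1 := CInt h2 (- r) 0) in *; set (b2 := CInt h2 0 r) in *.
    replace (m1 + p1 + m2 + p2 - 2 * PI * Y 0%nat 0%nat x t)%C with
      ((a1 + a2 + (b1 + b2) - 2 * PI * Y 0%nat 0%nat x t) - (a1 - m1) - (a2 - p1) - (b1 - m2) - (b2 - p2))%C by ring.
    rewrite Rplus_0_l.
    eapply Rle_trans; [apply Cmod_minus_le |].
    eapply Rle_trans; [apply Rplus_le_compat_r, Cmod_minus_le |].
    eapply Rle_trans; [apply Rplus_le_compat_r, Rplus_le_compat_r, Cmod_minus_le |].
    eapply Rle_trans; [apply Rplus_le_compat_r, Rplus_le_compat_r, Rplus_le_compat_r, Cmod_minus_le |].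
    lra. }
  replace (q * m1 + q * CInt h1 0 (/ 4) + q * (p1 - CInt h1 0 (/ 4)) + q * (m2 + CInt h2 0 (/ 4))
    + q * (p2 - CInt h2 0 (/ 4)))%C
    with (q * (m1 + p1 + m2 + p2 - 2 * PI * Y 0%nat 0%nat x t) + q * (2 * PI * Y 0%nat 0%nat x t))%C by ring.
  rewrite HS; unfold q; field; exact Hpi0.
Qed.

End contour.

(** * Extension of the solution to the plane *)

Lemma ccont_small (f : R -> C) (v : R) (e : R) : ccont f v -> 0 < e ->
  exists d, 0 < d /\ forall u, Rabs (u - v) < d -> Cmod (f u - f v) < e.
Proof.
intros Hf He; destruct (proj1 (ccont_eps _ _) Hf (mkposreal e He)) as [d Hd].
exists d; split; [apply cond_pos |]; intros u Hu; apply Hd; exact Hu.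
Qed.

Definition adherent (S : R -> Prop) (v : R) : Prop :=
  forall d, 0 < d -> exists u, S u /\ Rabs (u - v) < d.

Lemma adherent_left (a b : R) : a < b -> adherent (fun s => a < s < b) a.
Proof.
intros H d Hd; pose proof (Rmin_l ((b - a) / 2) (d / 2)); pose proof (Rmin_r ((b - a) / 2) (d / 2)).
assert (0 < Rmin ((b - a) / 2) (d / 2)) by (apply Rmin_glb_lt; lra).
exists (a + Rmin ((b - a) / 2) (d / 2)); split; [lra | apply Rabs_lt_between; lra].
Qed.

Lemma adherent_right (a b : R) : a < b -> adherent (fun s => a < s < b) b.
Proof.
intros H d Hd; destruct (adherent_left (- b) (- a) ltac:(lra) d Hd) as [u [Hu Hu']].
apply Rabs_lt_between in Hu'.
exists (- u); split; [lra | apply Rabs_lt_between; lra].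
Qed.

Lemma zero_adherent (f : R -> C) (S : R -> Prop) (v : R) : ccont f v -> adherent S v ->
  (forall u, S u -> f u = 0%C) -> f v = 0%C.
Proof.
intros Hf HS H0; apply Cmod_eq_0, Rle_antisym; [| apply Cmod_ge_0].
apply le_epsilon; intros e He; destruct (ccont_small f v e Hf He) as [d [Hd H]].
destruct (HS d Hd) as [u [Hu Huv]]; specialize (H u Huv); rewrite (H0 u Hu) in H.
rewrite <- Cmod_opp; replace (- f v)%C with (0 - f v)%C by ring; lra.
Qed.

(* The integral form of the derivative passes to the limit in the parameter. *)
Lemma cderive_adherent (F F1 : R -> R -> C) (S : R -> Prop) (u0 v0 d : R) : 0 < d ->
  (forall u v, ccont (fun p : R * R => F (fst p) (snd p)) (u, v)) ->
  (forall u v, ccont (fun p : R * R => F1 (fst p) (snd p)) (u, v)) ->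
  adherent S v0 ->
  (forall u v, S v -> Rabs (u - u0) < d -> cderive (fun r => F r v) u (F1 u v)) ->
  cderive (fun r => F r v0) u0 (F1 u0 v0).
Proof.
intros Hd HF HF1 HS HD.
set (u1 := u0 - d / 2).
assert (HE : forall u, u1 <= u -> u < u0 + d ->
  F u v0 = (F u1 v0 + CInt (fun s => F1 s v0) u1 u)%C).
{ intros u Hu Hud.
  assert (H0 : (F u v0 - (F u1 v0 + CInt (fun s => F1 s v0) u1 u))%C = 0%C).
  { apply (zero_adherent (fun v => (F u v - (F u1 v + CInt (fun s => F1 s v) u1 u))%C) S); [| exact HS |].
    - apply ccont_minus; [apply (ccont_2d_r F HF) |].
      apply ccont_plus; [apply (ccont_2d_r F HF) |].
      apply (ccont_CInt_param (fun v s => F1 s v)); [intros; apply (ccont_2d_swap F1 HF1) | intros; apply (ccont_2d_l F1 HF1)].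
    - intros v Hv; rewrite (CInt_FTC (fun s => F s v)); [ring | exact Hu | | |].
      + intros; apply (ccont_2d_l F HF).
      + intros; apply (ccont_2d_l F1 HF1).
      + intros s Hs; apply HD; [exact Hv | apply Rabs_lt_between; unfold u1 in Hs; lra]. }
  replace (F u v0) with (F u v0 - (F u1 v0 + CInt (fun s => F1 s v0) u1 u) +
    (F u1 v0 + CInt (fun s => F1 s v0) u1 u))%C by ring.
  rewrite H0; ring. }
assert (Hd2 : 0 < d / 2) by lra.
apply (cderive_ext_loc (fun u => (F u1 v0 + CInt (fun s => F1 s v0) u1 u)%C)).
- exists (mkposreal _ Hd2); intros u Hu; change (Rabs (u - u0) < d / 2) in Hu.
  apply Rabs_lt_between in Hu; symmetry; apply HE; unfold u1; lra.
- eapply cderive_eq.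
  + apply cderive_plus; [apply cderive_const |].
    apply (cderive_CInt (fun s => F1 s v0)); intros; apply (ccont_2d_l F1 HF1).
  + ring.
Qed.

(** This is [min (T, max (0, t))], written with [Rmax 0] alone so that continuity reduces to
    [continuous_Rmax_0]. *)
Definition clamp (T t : R) : R := T - Rmax 0 (T - Rmax 0 t).

Lemma clamp_spec (T t : R) : 0 < T ->
  0 <= clamp T t <= T /\ (0 <= t <= T -> clamp T t = t).
Proof.
intros HT; unfold clamp.
pose proof (Rmax_l 0 t); pose proof (Rmax_l 0 (T - Rmax 0 t)).
split.
- split; [| lra].
  assert (Rmax 0 (T - Rmax 0 t) <= T) by (apply Rmax_lub; lra); lra.
- intros Ht; rewrite (Rmax_right 0 t) by lra; rewrite Rmax_right by lra; ring.
Qed.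

Lemma continuous_clamp (T t : R) : continuous (clamp T) t.
Proof.
apply (continuous_minus (V := R_NormedModule) (fun _ => T)); [apply continuous_const |].
apply (continuous_comp (fun t => T - Rmax 0 t) (Rmax 0)); [| apply continuous_Rmax_0].
apply (continuous_minus (V := R_NormedModule) (fun _ => T)); [apply continuous_const | apply continuous_Rmax_0].
Qed.

Lemma CDerive_cderive (f : R -> C) (s : R) (l : C) : cderive f s l -> CDerive f s = l.
Proof.
intros H; apply cderive_iff in H; destruct H as [H1 H2]; unfold CDerive.
apply C_ext; simpl; apply is_derive_unique; assumption.
Qed.

Section extension.
Variables (N : nat) (T : R) (y : R -> R -> C) (Y : nat -> nat -> R -> R -> C) (g0 g1 : R -> C).
Hypothesis HT : 0 < T.
Hypothesis HN : (4 <= N)%nat.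
Hypothesis HYy : forall x t, Omega_bar T x t -> Y 0%nat 0%nat x t = y x t.
Hypothesis HYd : forall i j, (i + j < N)%nat -> forall x t, Omega T x t ->
  is_derive (V := C_R_NormedModule) (fun s => Y i j s t) x (Y (S i) j x t) /\
  is_derive (V := C_R_NormedModule) (fun s => Y i j x s) t (Y i (S j) x t).
Hypothesis HYc : forall i j, (i + j <= N)%nat -> forall x t, Omega_bar T x t ->
  filterlim (fun p : R * R => Y i j (fst p) (snd p))
    (within (fun p => Omega_bar T (fst p) (snd p)) (locally (x, t))) (locally (Y i j x t)).
Variable K : R.
Hypothesis HK : forall i j, (i + j <= N)%nat -> forall x t, Omega T x t ->
  Cmod (Nat.iter i dx (Nat.iter j dt y) x t) <= K.
Hypothesis Hs : solves T g0 g1 y.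
Hypothesis Hg0 : compact_support_in T g0.
Hypothesis Hg1 : compact_support_in T g1.

Definition extend (i j : nat) (x t : R) : C := Y i j (Rmax 0 x) (clamp T t).

Lemma extend_inside (i j : nat) (x t : R) : Omega_bar T x t -> extend i j x t = Y i j x t.
Proof.
intros [Hx Ht]; unfold extend; rewrite Rmax_right by exact Hx.
now rewrite (proj2 (clamp_spec T t HT) Ht).
Qed.

Lemma extend_cont (i j : nat) (x t : R) : (i + j <= N)%nat ->
  ccont (fun p : R * R => extend i j (fst p) (snd p)) (x, t).
Proof.
intros Hij.
assert (Hb : forall p : R * R, Omega_bar T (Rmax 0 (fst p)) (clamp T (snd p))).
{ intros p; split; [apply Rmax_l | now apply clamp_spec]. }
assert (Hphi : continuous (fun p : R * R => (Rmax 0 (fst p), clamp T (snd p))) (x, t)).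
{ apply (continuous_comp_2 (fun p : R * R => Rmax 0 (fst p)) (fun p => clamp T (snd p)) (fun a b => (a, b))).
  - apply (continuous_comp (fun p : R * R => fst p) (Rmax 0)); [apply continuous_fst | apply continuous_Rmax_0].
  - apply (continuous_comp (fun p : R * R => snd p) (clamp T)); [apply continuous_snd | apply continuous_clamp].
  - apply continuous_ext with (fun p : R * R => p); [now intros [] | apply continuous_id]. }
intros P HP.
specialize (HYc i j Hij (Rmax 0 x) (clamp T t) (Hb (x, t)) P HP).
unfold filtermap, within in HYc.
specialize (Hphi _ HYc); unfold filtermap in Hphi |- *.
revert Hphi; apply (filter_imp (F := locally (x, t))); intros p Hp; apply Hp, Hb.
Qed.

Lemma adherent_x (x : R) : adherent (fun x => 0 < x) (Rmax 0 x).
Proof.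
intros d Hd; exists (Rmax 0 x + d / 2); pose proof (Rmax_l 0 x); split; [lra |].
replace (Rmax 0 x + d / 2 - Rmax 0 x) with (d / 2) by ring; rewrite Rabs_pos_eq; lra.
Qed.

Lemma adherent_t (t : R) : adherent (fun t => 0 < t < T) (clamp T t).
Proof.
destruct (clamp_spec T t HT) as [Hc _]; set (v := clamp T t) in *.
destruct (Rle_lt_dec v 0) as [H0 | H0]; [| destruct (Rle_lt_dec T v) as [H1' | H1']].
- replace v with 0 by lra; now apply adherent_left.
- replace v with T by lra; now apply adherent_right.
- intros d Hd; exists v; split; [lra | rewrite Rminus_diag, Rabs_R0; exact Hd].
Qed.

Lemma extend_clamp (i j : nat) (x t : R) :
  extend i j x t = extend i j (Rmax 0 x) t /\ extend i j x t = extend i j x (clamp T t).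
Proof.
unfold extend; rewrite (Rmax_right 0 (Rmax 0 x)) by apply Rmax_l.
rewrite (proj2 (clamp_spec T (clamp T t) HT) (proj1 (clamp_spec T t HT))); split; reflexivity.
Qed.

Lemma extend_interior (i j : nat) (x t : R) : (i + j < N)%nat -> Omega T x t ->
  cderive (fun r => extend i j r t) x (extend (S i) j x t) /\
  cderive (fun r => extend i j x r) t (extend i (S j) x t).
Proof.
intros Hij [Hx Ht].
assert (Ho : Omega_bar T x t) by (split; lra).
destruct (HYd i j Hij x t (conj Hx Ht)) as [D1 D2].
rewrite !(extend_inside _ _ x t Ho); split.
- apply (cderive_ext_loc (fun r => Y i j r t)); [| exact D1].
  generalize (open_gt 0 x Hx); apply (filter_imp (F := locally x)); intros r Hr.
  symmetry; apply extend_inside; split; lra.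
- apply (cderive_ext_loc (fun r => Y i j x r)); [| exact D2].
  generalize (filter_and _ _ (open_gt 0 t (proj1 Ht)) (open_lt T t (proj2 Ht))).
  apply (filter_imp (F := locally t)); intros r Hr.
  symmetry; apply extend_inside; split; lra.
Qed.

Lemma extend_dx (i j : nat) (x t : R) : (i + j < N)%nat -> 0 < x ->
  cderive (fun r => extend i j r t) x (extend (S i) j x t).
Proof.
intros Hij Hx; rewrite (proj2 (extend_clamp (S i) j x t)).
apply (cderive_ext (fun r => extend i j r (clamp T t))).
{ intros r; symmetry; apply extend_clamp. }
apply (cderive_adherent (extend i j) (extend (S i) j) (fun t => 0 < t < T) x (clamp T t) x Hx).
- intros; apply extend_cont; lia.
- intros; apply extend_cont; lia.
- apply adherent_t.
- intros u v Hv Hu; apply Rabs_lt_between in Hu.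
  apply extend_interior; [exact Hij | split; lra].
Qed.

Lemma extend_dt (i j : nat) (x t : R) : (i + j < N)%nat -> 0 < t < T ->
  cderive (fun r => extend i j x r) t (extend i (S j) x t).
Proof.
intros Hij Ht; rewrite (proj1 (extend_clamp i (S j) x t)).
apply (cderive_ext (fun r => extend i j (Rmax 0 x) r)).
{ intros r; symmetry; apply extend_clamp. }
assert (Hd : 0 < Rmin t (T - t)) by (apply Rmin_glb_lt; lra).
apply (cderive_adherent (fun t x => extend i j x t) (fun t x => extend i (S j) x t)
  (fun x => 0 < x) t (Rmax 0 x) (Rmin t (T - t)) Hd).
- intros; apply (ccont_2d_swap (extend i j)); intros; apply extend_cont; lia.
- intros; apply (ccont_2d_swap (extend i (S j))); intros; apply extend_cont; lia.
- apply adherent_x.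
- intros u v Hv Hu; pose proof (Rmin_l t (T - t)); pose proof (Rmin_r t (T - t)).
  apply Rabs_lt_between in Hu.
  apply (extend_interior i j v u Hij); split; lra.
Qed.

Lemma iter_dt_extend (j : nat) (x t : R) : (j <= N)%nat -> Omega T x t ->
  Nat.iter j dt y x t = extend 0 j x t.
Proof.
revert x t; induction j as [| j IH]; intros x t Hj [Hx Ht].
- simpl; rewrite extend_inside by (split; lra); symmetry; apply HYy; split; lra.
- change (Nat.iter (S j) dt y x t) with (CDerive (fun s => Nat.iter j dt y x s) t).
  apply CDerive_cderive.
  apply (cderive_ext_loc (fun r => extend 0 j x r)).
  + generalize (filter_and _ _ (open_gt 0 t (proj1 Ht)) (open_lt T t (proj2 Ht))).
    apply (filter_imp (F := locally t)); intros r Hr.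
    symmetry; apply IH; [lia | split; lra].
  + apply extend_dt; [lia | exact Ht].
Qed.

Lemma iter_dx_dt_extend (i j : nat) (x t : R) : (i + j <= N)%nat -> Omega T x t ->
  Nat.iter i dx (Nat.iter j dt y) x t = extend i j x t.
Proof.
revert x t; induction i as [| i IH]; intros x t Hij [Hx Ht].
- apply iter_dt_extend; [lia | now split].
- change (Nat.iter (S i) dx (Nat.iter j dt y) x t)
    with (CDerive (fun s => Nat.iter i dx (Nat.iter j dt y) s t) x).
  apply CDerive_cderive.
  apply (cderive_ext_loc (fun r => extend i j r t)).
  + generalize (open_gt 0 x Hx); apply (filter_imp (F := locally x)); intros r Hr.
    symmetry; apply IH; [lia | split; [exact Hr | exact Ht]].
  + apply extend_dx; [lia | exact Hx].
Qed.

(** The decay hypothesis concerns iterated derivatives of [y] in the open domain; there they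
    coincide with [extend i j], and continuity carries the bound to the boundary. *)
Lemma extend_bound (i j : nat) (x t : R) : (i + j <= N)%nat -> Cmod (extend i j x t) <= K.
Proof.
intros Hij; rewrite (proj1 (extend_clamp i j x t)), (proj2 (extend_clamp i j _ t)).
apply le_epsilon; intros e He.
destruct (proj1 (ccont_eps _ _) (extend_cont i j (Rmax 0 x) (clamp T t) Hij) (mkposreal e He)) as [d Hd].
destruct (adherent_x x d (cond_pos d)) as [u [Hu Hu']].
destruct (adherent_t t d (cond_pos d)) as [v [Hv Hv']].
specialize (Hd (u, v) (conj Hu' Hv')); simpl in Hd.
assert (HO : Omega T u v) by (split; assumption).
pose proof (HK i j Hij u v HO) as H1; rewrite iter_dx_dt_extend in H1 by assumption.
set (P := extend i j (Rmax 0 x) (clamp T t)) in *; set (Q := extend i j u v) in *.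
replace P with (Q - (Q - P))%C by ring.
eapply Rle_trans; [apply Cmod_minus_le | lra].
Qed.

Lemma extend_dirichlet (s : R) : 0 < s < T -> extend 0 0 0 s = g0 s.
Proof.
intros Hs'; rewrite extend_inside by (split; lra); rewrite HYy by (split; lra).
now apply (solves_dirichlet _ _ _ _ Hs).
Qed.

(** The difference quotient at step [h] is the mean of [extend 1 0] over [[0, h]], so continuity
    forces the two limits to agree. *)
Lemma extend_neumann (s : R) : 0 < s < T -> extend 1 0 0 s = g1 s.
Proof.
intros Hs'.
assert (Hc1 : forall r, ccont (fun r => extend 1 0 r s) r).
{ intros r; apply (ccont_2d_l (extend 1 0)); intros; apply extend_cont; lia. }
assert (Hc0 : forall r, ccont (fun r => extend 0 0 r s) r).
{ intros r; apply (ccont_2d_l (extend 0 0)); intros; apply extend_cont; lia. }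
assert (H0 : (extend 1 0 0 s - g1 s)%C = 0%C); [| replace (extend 1 0 0 s) with
  (extend 1 0 0 s - g1 s + g1 s)%C by ring; rewrite H0; ring].
apply Cmod_eq_0, Rle_antisym; [| apply Cmod_ge_0].
apply le_epsilon; intros e He; assert (He2 : 0 < e / 4) by lra.
pose proof (solves_neumann _ _ _ _ Hs s Hs' _ (locally_ball (g1 s) (mkposreal _ He2))) as [d Hd].
destruct (ccont_small _ 0 (e / 4) (Hc1 0) He2) as [d' [Hd' Hsm]].
pose proof (cond_pos d) as Hd0.
set (h := Rmin (d / 2) (d' / 2)).
assert (Hh : 0 < h) by (apply Rmin_glb_lt; lra).
assert (Hh1 : h <= d / 2) by apply Rmin_l; assert (Hh2 : h <= d' / 2) by apply Rmin_r.
assert (Hhd : Rabs (h - 0) < d) by (rewrite Rminus_0_r, Rabs_pos_eq; lra).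
destruct (Hd h Hhd Hh) as [B1 B2].
set (Q := ((y h s - y 0 s) / h)%C) in *.
change (Rabs (Re Q - Re (g1 s)) < e / 4) in B1; change (Rabs (Im Q - Im (g1 s)) < e / 4) in B2.
assert (HQ : Cmod (Q - g1 s) < e / 2).
{ eapply Rle_lt_trans; [apply Cmod_le_abs |]; rewrite Re_minus, Im_minus; lra. }
assert (Hhn : RtoC h <> 0%C) by (apply RtoC_neq_0; lra).
assert (HI : (h * (Q - extend 1 0 0 s))%C = CInt (fun r => (extend 1 0 r s - extend 1 0 0 s)%C) 0 h).
{ rewrite CInt_minus by cont.
  rewrite (CInt_FTC (fun r => extend 0 0 r s)); [| lra | intros; apply Hc0 | exact Hc1 |].
  - assert (Hcst : CInt (fun _ => extend 1 0 0 s) 0 h = (h * extend 1 0 0 s)%C).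
    { now rewrite CInt_const, Rminus_0_r. }
    rewrite Hcst, !extend_inside, !HYy by (split; lra).
    unfold Q; field; exact Hhn.
  - intros r Hr; apply extend_dx; [lia | lra]. }
assert (HB : Cmod (Q - extend 1 0 0 s) <= e / 4).
{ apply (f_equal Cmod) in HI; rewrite Cmod_mult, Cmod_R, Rabs_pos_eq in HI by lra.
  apply Rmult_le_reg_l with h; [exact Hh |]; rewrite HI.
  replace (h * (e / 4)) with ((h - 0) * (e / 4)) by ring.
  apply Cmod_CInt_le_const; [lra | |].
  - cont.
  - intros r Hr; apply Rlt_le, Hsm; rewrite Rminus_0_r, Rabs_pos_eq; lra. }
replace (extend 1 0 0 s - g1 s)%C with ((Q - g1 s) - (Q - extend 1 0 0 s))%C by ring.
eapply Rle_trans; [apply Cmod_minus_le | lra].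
Qed.

Lemma boundary_support : exists a b : R, 0 < a /\ b < T /\
  forall s, 0 < s < T -> s < a \/ b < s -> extend 0 0 0 s = 0%C /\ extend 1 0 0 s = 0%C.
Proof.
destruct Hg0 as [a0 [b0 [A1 [A2 [A3 A4]]]]], Hg1 as [a1 [b1 [B1 [B2 [B3 B4]]]]].
exists (Rmin a0 a1), (Rmax b0 b1); split; [now apply Rmin_glb_lt | split; [now apply Rmax_lub_lt |]].
intros s Hs' Hab; rewrite extend_dirichlet, extend_neumann by assumption.
pose proof (Rmin_l a0 a1); pose proof (Rmin_r a0 a1).
pose proof (Rmax_l b0 b1); pose proof (Rmax_r b0 b1).
split; [apply A4 | apply B4]; intros [H1' H2']; destruct Hab; lra.
Qed.

(** The boundary values vanish on open intervals next to [0] and [T], so all their time derivatives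
    vanish there too, and at the end points by continuity. *)
Lemma extend_ends (i j : nat) : (i <= 1)%nat -> (i + j <= N)%nat ->
  extend i j 0 0 = 0%C /\ extend i j 0 T = 0%C.
Proof.
intros Hi Hij; destruct boundary_support as [a [b [Ha [Hb Hab]]]].
assert (Hz : forall j, (i + j <= N)%nat -> forall s, 0 < s < T -> s < a \/ b < s -> extend i j 0 s = 0%C).
{ induction j0 as [| j0 IH]; intros Hj s Hs' Hor.
  - destruct i as [| [| i']]; [now apply Hab | now apply Hab | lia].
  - assert (HD := extend_dt i j0 0 s ltac:(lia) Hs').
    assert (HZ : cderive (fun r => extend i j0 0 r) s 0%C).
    { apply (cderive_ext_loc (fun _ => RtoC 0)); [| apply cderive_const].
      assert (Hloc : locally s (fun r => 0 < r < T /\ (r < a \/ b < r))).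
      { apply filter_and; [apply filter_and; [now apply open_gt | now apply open_lt] |].
        destruct Hor as [H1' | H1']; [generalize (open_lt a s H1') | generalize (open_gt b s H1')];
          apply (filter_imp (F := locally s)); tauto. }
      revert Hloc; apply (filter_imp (F := locally s)); intros r [Hr1 Hr2].
      symmetry; apply IH; [lia | exact Hr1 | exact Hr2]. }
    rewrite <- (CDerive_cderive _ _ _ HD), (CDerive_cderive _ _ _ HZ); reflexivity. }
assert (Hc : forall s, ccont (extend i j 0) s).
{ intros s; apply (ccont_2d_r (extend i j)); intros; now apply extend_cont. }
split.
- apply (zero_adherent (extend i j 0) (fun s => 0 < s < Rmin a T)); [apply Hc | apply adherent_left |].
  + now apply Rmin_glb_lt.
  + intros s Hs'; pose proof (Rmin_l a T); pose proof (Rmin_r a T); apply Hz; [exact Hij | lra | left; lra].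
- apply (zero_adherent (extend i j 0) (fun s => Rmax 0 b < s < T)); [apply Hc | apply adherent_right |].
  + now apply Rmax_lub_lt.
  + intros s Hs'; pose proof (Rmax_l 0 b); pose proof (Rmax_r 0 b); apply Hz; [exact Hij | lra | right; lra].
Qed.

Lemma extend_solution : extended_solution N T K extend.
Proof.
constructor.
- intros; now apply extend_cont.
- intros; now apply extend_dx.
- intros; now apply extend_dt.
- intros; now apply extend_bound.
- intros x t Hx Ht.
  assert (HO : Omega T x t) by now split.
  rewrite <- !iter_dx_dt_extend by (try exact HO; lia).
  pose proof (solves_pde _ _ _ _ Hs x t HO) as H.
  change (Nat.iter 0 dx (Nat.iter 1 dt y) x t) with (dt y x t).
  change (Nat.iter 0 dt y) with y.
  replace (dt y x t) with (dt y x t - Ci * (Nat.iter 4 dx y x t + Nat.iter 2 dx y x t)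
    + Ci * (Nat.iter 4 dx y x t + Nat.iter 2 dx y x t))%C by ring.
  rewrite H; ring.
- intros x Hx; rewrite extend_inside by (split; lra); rewrite HYy by (split; lra).
  now apply (solves_init _ _ _ _ Hs).
- apply extend_ends.
Qed.

End extension.

Theorem theorem2p1 :
  exists (eps0 : R) (N m : nat), 0 < eps0 /\
    forall eps : R, 0 < eps < eps0 ->
    forall (T : R) (g0 g1 : R -> C) (y : R -> R -> C),
      0 < T ->
      compact_support_in T g0 ->
      compact_support_in T g1 ->
      smooth_up_to_boundary N T y ->
      decays N m T y ->
      solves T g0 g1 y ->
      forall x t : R, Omega T x t ->
        is_int_bdDplus (fun k => (E k x t * G eps g0 g1 k T)%C) (y x t).
Proof.
(* [eps < PI] leaves the arguments in [[PI, 2 PI]] on the right untouched. Order 20 covers the 14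
   time derivatives of the integration by parts and the 4 space derivatives of the equation.
   Exponent 0 gives the uniform bound on which [extended_solution] is built. *)
exists PI, 20%nat, 0%nat; split; [apply PI_RGT_0 |].
intros eps Heps T g0 g1 y HT Hg0 Hg1 [Y [HYy [HYd HYc]]] [K HK] Hs x t [Hx Ht].
assert (HK' : forall i j, (i + j <= 20)%nat -> forall x t, Omega T x t ->
  Cmod (Nat.iter i dx (Nat.iter j dt y) x t) <= K).
{ intros i j Hij x' t' HO; specialize (HK i j Hij x' t' HO).
  rewrite pow_O, Rdiv_1_r in HK; exact HK. }
assert (HN : (4 <= 20)%nat) by lia.
pose proof (extend_solution 20 T y Y g0 g1 HT HN HYy HYd HYc K HK' Hs Hg0 Hg1) as HE.
destruct (boundary_support 20 T y Y g0 g1 HT HN HYy HYd HYc Hs Hg0 Hg1) as [a [b [Ha [Hb Hab]]]].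
rewrite <- HYy by (split; lra); rewrite <- (extend_inside T Y HT 0 0 x t) by (split; lra).
(* [Rmax b 0] guarantees [0 < s], which [boundary_support] asks for. *)
apply (contour_integral T K (extend T Y) HT HE x t (Rmax b 0) Hx Ht); [now apply Rmax_lub_lt | | exact Heps | |].
- intros s Hs'; pose proof (Rmax_l b 0); pose proof (Rmax_r b 0).
  apply Hab; [lra | right; lra].
- intros s Hs'; now apply (extend_dirichlet T y Y g0 g1 HT HYy Hs).
- intros s Hs'; now apply (extend_neumann 20 T y Y g0 g1 HT HN HYy HYd HYc Hs).
Qed.
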